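(* Let $\alpha\in(0,2)$, let $\Omega=(a_x,b_x)\times(a_y,b_y)\subset\mathbb{R}^2$ be a bounded rectangle, and let $u:\mathbb{R}^2\to\mathbb{R}$ satisfy $u=0$ on $\mathbb{R}^2\setminus\Omega$. Let $0<\varepsilon\le 1+\lfloor\alpha\rfloor-\alpha$ and assume $u\in C^{\lfloor\alpha\rfloor,\,\alpha-\lfloor\alpha\rfloor+\varepsilon}(\mathbb{R}^2)$. Then for every splitting parameter $\gamma\in(\alpha,2]$ there is a constant $C>0$ independent of $h$ such that, for all sufficiently small $h=L/N$, $$\sup_{\mathbf{x}\in\Omega}\big|(-\Delta)^{\alpha/2}u(\mathbf{x})-(-\Delta)^{\alpha/2}_{h,\gamma}u(\mathbf{x})\big|\le C h^{\varepsilon}.$$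
   Context: $\lfloor\cdot\rfloor$ is the floor function. For $k\in\mathbb{N}_0$, $s\in(0,1]$, $C^{k,s}(\mathbb{R}^d)$ is the space of functions $\mathbb{R}^d\to\mathbb{R}$ with continuous partial derivatives of all orders $\le k$ whose $k$-th order partial derivatives are uniformly Hölder continuous with exponent $s$. The fractional Laplacian is $(-\Delta)^{\alpha/2}u(\mathbf{x})=c_{d,\alpha}\,\mathrm{P.V.}\int_{\mathbb{R}^d}\frac{u(\mathbf{x})-u(\mathbf{x}')}{|\mathbf{x}-\mathbf{x}'|^{d+\alpha}}\,d\mathbf{x}'$ with $c_{d,\alpha}=\frac{2^{\alpha-1}\alpha\,\Gamma((d+\alpha)/2)}{\pi^{d/2}\Gamma(1-\alpha/2)}$. Two-dimensional discrete operator: let $L=\max\{b_x-a_x,b_y-a_y\}$, $N$ a positive integer, $h=L/N$, $\boldsymbol{\xi}_{ij}=(ih,jh)$, $I_{ij}=[ih,(i+1)h]\times[jh,(j+1)h]$, $D_1=(0,L)^2$, $D_2=[0,\infty)^2\setminus D_1$. For $\mathbf{x}=(x,y)$ and $\boldsymbol{\xi}=(\xi,\eta)\in[0,\infty)^2\setminus\{0\}$ set $\psi_\gamma(\mathbf{x},\boldsymbol{\xi})=|\boldsymbol{\xi}|^{-\gamma}\Big(\sum_{m,n\in\{0,1\}}u(x+(-1)^m\xi,\,y+(-1)^n\eta)-4u(\mathbf{x})\Big)$ and $\omega_\gamma(\boldsymbol{\xi})=|\boldsymbol{\xi}|^{\gamma-(2+\alpha)}$. Let $c^\gamma_{mn}=1$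 for $(m,n)\in\{(1,0),(0,1),(1,1)\}$ when $\gamma\in(\alpha,2)$, and $c^2_{10}=c^2_{01}=2$, $c^2_{11}=0$ when $\gamma=2$. Define, for $\mathbf{x}\in\Omega$, $$(-\Delta)^{\alpha/2}_{h,\gamma}u(\mathbf{x})=-c_{2,\alpha}\Big[\tfrac14\Big(\sum_{(m,n)\in\{0,1\}^2\setminus\{(0,0)\}}c^\gamma_{mn}\psi_\gamma(\mathbf{x},\boldsymbol{\xi}_{mn})\Big)\int_{I_{00}}\omega_\gamma\,d\boldsymbol{\xi}+\tfrac14\sum_{\substack{0\le i,j\le N-1\\(i,j)\ne(0,0)}}\Big(\sum_{m,n\in\{0,1\}}\psi_\gamma(\mathbf{x},\boldsymbol{\xi}_{(i+m)(j+n)})\Big)\int_{I_{ij}}\omega_\gamma\,d\boldsymbol{\xi}-4u(\mathbf{x})\int_{D_2}|\boldsymbol{\xi}|^{-(2+\alpha)}d\boldsymbol{\xi}\Big].$$ *)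

(* Defs.v *)
From Stdlib Require Export Reals Factorial.
Open Scope R_scope.

Definition nrm (a b : R) : R := sqrt (a * a + b * b).

Fixpoint fsum (n : nat) (f : nat -> R) : R :=
  match n with O => 0 | S k => fsum k f + f k end.
Fixpoint fprod (n : nat) (f : nat -> R) : R :=
  match n with O => 1 | S k => fprod k f * f k end.

(** Gamma function for s > 0 (Gauss's product/limit definition):
    Gamma(s) = lim_n n! n^s / (s (s+1) ... (s+n)). *)
Definition is_Gamma (s g : R) : Prop :=
  Un_cv (fun n => INR (fact n) * Rpower (INR n) s / fprod (S n) (fun k => s + INR k)) g.

(** The constant c_{d,alpha} for d = 2 (pi^{d/2} = pi). *)
Definition c2 (alpha c : R) : Prop :=
  exists g1 g2, is_Gamma ((2 + alpha) / 2) g1 /\ is_Gamma (1 - alpha / 2) g2 /\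
    c = Rpower 2 (alpha - 1) * alpha * g1 / (PI * g2).

Definition is_RInt2 (f : R -> R -> R) (a b c d l : R) : Prop :=
  forall eps, eps > 0 -> exists N : nat, forall n : nat, (N <= n)%nat ->
    forall tx ty : nat -> nat -> R,
      (forall i j, (i < n)%nat -> (j < n)%nat ->
         a + INR i * (b - a) / INR n <= tx i j <= a + INR (S i) * (b - a) / INR n /\
         c + INR j * (d - c) / INR n <= ty i j <= c + INR (S j) * (d - c) / INR n) ->
      Rabs (fsum n (fun i => fsum n (fun j =>
              f (tx i j) (ty i j) * ((b - a) / INR n) * ((d - c) / INR n))) - l) < eps.

Definition is_int_R2 (f : R -> R -> R) (l : R) : Prop :=
  forall eps, eps > 0 -> exists R0, forall Rr, Rr >= R0 ->
    exists v, is_RInt2 f (- Rr) Rr (- Rr) Rr v /\ Rabs (v - l) < eps.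

Definition is_pv (alpha : R) (u : R -> R -> R) (x y l : R) : Prop :=
  forall eps, eps > 0 -> exists d0, d0 > 0 /\ forall dl, 0 < dl < d0 ->
    exists I, is_int_R2 (fun x' y' =>
        if Rlt_dec dl (nrm (x - x') (y - y'))
        then (u x y - u x' y') / Rpower (nrm (x - x') (y - y')) (2 + alpha)
        else 0) I /\ Rabs (I - l) < eps.

Definition frac_lap (alpha : R) (u : R -> R -> R) (x y v : R) : Prop :=
  exists c I, c2 alpha c /\ is_pv alpha u x y I /\ v = c * I.

(** (Improper, singularity only possible at the origin) integral over a cell
    [a,b]x[c,d] in [0,oo)^2: excise a small disc around 0 and let it shrink. *)
Definition is_cell_int (f : R -> R -> R) (a b c d l : R) : Prop :=
  forall eps, eps > 0 -> exists d0, d0 > 0 /\ forall dl, 0 < dl < d0 ->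
    exists v, is_RInt2 (fun p q => if Rlt_dec dl (nrm p q) then f p q else 0) a b c d v
              /\ Rabs (v - l) < eps.

(** Integral over D_2 = [0,oo)^2 \ (0,L)^2 (up to a null set: [0,oo)^2 minus [0,L)^2). *)
Definition is_D2_int (f : R -> R -> R) (L l : R) : Prop :=
  forall eps, eps > 0 -> exists R0, forall Rr, Rr >= R0 ->
    exists v, is_RInt2 (fun p q => if Rle_dec L (Rmax p q) then f p q else 0) 0 Rr 0 Rr v
              /\ Rabs (v - l) < eps.

Definition psi (gamma : R) (u : R -> R -> R) (x y p q : R) : R :=
  Rpower (nrm p q) (- gamma) *
  (u (x + p) (y + q) + u (x + p) (y - q) + u (x - p) (y + q) + u (x - p) (y - q)
   - 4 * u x y).

Definition omega (alpha gamma : R) (p q : R) : R := Rpower (nrm p q) (gamma - (2 + alpha)).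

Definition cg (gamma : R) (m n : nat) : R :=
  if Req_EM_T gamma 2 then
    (match m, n with S O, O => 2 | O, S O => 2 | _, _ => 0 end)
  else 1.

Definition disc_lap (alpha gamma L : R) (N : nat) (u : R -> R -> R) (x y v : R) : Prop :=
  let h := L / INR N in
  exists c (w : nat -> nat -> R) W2,
    c2 alpha c /\
    (forall i j, (i < N)%nat -> (j < N)%nat ->
       is_cell_int (omega alpha gamma) (INR i * h) (INR (S i) * h)
                   (INR j * h) (INR (S j) * h) (w i j)) /\
    is_D2_int (fun p q => Rpower (nrm p q) (- (2 + alpha))) L W2 /\
    v = - c * (
      / 4 * (cg gamma 1 0 * psi gamma u x y h 0 + cg gamma 0 1 * psi gamma u x y 0 h
             + cg gamma 1 1 * psi gamma u x y h h) * w O O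
      + / 4 * fsum N (fun i => fsum N (fun j =>
          if andb (Nat.eqb i 0) (Nat.eqb j 0) then 0 else
          (psi gamma u x y (INR i * h) (INR j * h)
           + psi gamma u x y (INR (S i) * h) (INR j * h)
           + psi gamma u x y (INR i * h) (INR (S j) * h)
           + psi gamma u x y (INR (S i) * h) (INR (S j) * h)) * w i j))
      - 4 * u x y * W2).

Definition cont2 (f : R -> R -> R) : Prop :=
  forall x y eps, eps > 0 -> exists d, d > 0 /\ forall x' y',
    nrm (x' - x) (y' - y) < d -> Rabs (f x' y' - f x y) < eps.

Definition holder (s : R) (f : R -> R -> R) : Prop :=
  exists K, forall x y x' y', nrm (x - x') (y - y') > 0 ->
    Rabs (f x y - f x' y') <= K * Rpower (nrm (x - x') (y - y')) s.

Fixpoint CkHolder (k : nat) (s : R) (f : R -> R -> R) : Prop :=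
  match k with
  | O => cont2 f /\ holder s f
  | S k' => cont2 f /\ exists fx fy : R -> R -> R,
      (forall x y, derivable_pt_lim (fun t => f t y) x (fx x y)) /\
      (forall x y, derivable_pt_lim (fun t => f x t) y (fy x y)) /\
      CkHolder k' s fx /\ CkHolder k' s fy
  end.

(* Main.v *)
Require Import Defs.
From Stdlib Require Import Reals Lra Lia Psatz.
Open Scope R_scope.

(** Put [beta = alpha + eps] and let [S(z)] be the sum of the four values of [u] at the reflections of
    [x + z], minus [4 u(x)]. Folding the plane onto the quadrant, [(-Delta)^{alpha/2} u (x)] is [-c] times
    the integral of [S(z) |z|^-(2+alpha)], and outside [[0,L)^2] the function [S] equals [-4 u(x)], so the
    far part is exact in the scheme. Regularity gives [|S(z)| <= K |z|^beta], so the origin cell contributes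
    [O(h^eps)] on both sides. On any other cell, the corner average minus [psi], times [omega], is a linear
    function centred in the cell (which integrates to zero) up to [O(h^beta |z|^-(2+alpha))]; integrating
    over [|z| > h] gives [h^beta h^-alpha = h^eps]. For [alpha < 1] the Hoelder bound suffices; for
    [alpha >= 1] a second-order expansion is used, since at [alpha = eps = 1] a first-order bound
    would lose a logarithm. *)

(** * Riemann sums over uniform grids *)

(** The definitions take every integral as a limit of Riemann sums on the uniform grids of one box,
    and the conclusion asserts that both operators have values. Existence of the Gamma limits, the
    cell integrals, the far integral and the principal value is therefore proved along with the
    estimate. The uniform grids of a box and of its parts do not refine one another, so additivity
    is obtained from indicators of half-open rectangles inside a common larger box, where it is a
    pointwise identity. Existence rests on one criterion, small total oscillation, which is stable
    under products: on the quadrant each integrand is a product of a continuous factor, a monotone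
    cut and an antitone power of the norm. Sizes of singular integrals come from dyadic squares,
    which play the role of polar coordinates. All constants are uniform in [x] because the Hoelder
    bounds hold on the whole plane and pass to the reflected sums with one constant. The bound on
    [eps] says that beta is at most 1 plus the floor of alpha; at a point of norm [r >= h] this
    makes [h r^(beta-1)], respectively [h^2 r^(beta-2)], at most [h^beta]. *)

Lemma Rabs_le_inv x a : Rabs x <= a -> - a <= x <= a.
Proof. unfold Rabs; destruct Rcase_abs; lra. Qed.

Lemma fsum_ext n f g : (forall i, (i < n)%nat -> f i = g i) -> fsum n f = fsum n g.
Proof.
  induction n as [|n IH]; intros H; simpl; [reflexivity|].
  rewrite IH by (intros; apply H; lia). rewrite H by lia. reflexivity.
Qed.

Lemma fsum_plus n f g : fsum n (fun i => f i + g i) = fsum n f + fsum n g.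
Proof. induction n as [|n IH]; simpl; [lra|]. rewrite IH; lra. Qed.

Lemma fsum_scal n k f : fsum n (fun i => k * f i) = k * fsum n f.
Proof. induction n as [|n IH]; simpl; [lra|]. rewrite IH; lra. Qed.

Lemma fsum_le n f g : (forall i, (i < n)%nat -> f i <= g i) -> fsum n f <= fsum n g.
Proof.
  induction n as [|n IH]; intros H; simpl; [lra|].
  apply Rplus_le_compat; [apply IH; intros; apply H|apply H]; lia.
Qed.

Lemma fsum_abs n f : Rabs (fsum n f) <= fsum n (fun i => Rabs (f i)).
Proof.
  induction n as [|n IH]; simpl; [rewrite Rabs_R0; lra|].
  eapply Rle_trans; [apply Rabs_triang|lra].
Qed.

Lemma fsum_const n k : fsum n (fun _ => k) = INR n * k.
Proof. induction n as [|n IH]; [simpl; lra|]. rewrite S_INR; simpl; rewrite IH; lra. Qed.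

Lemma fsum_tele n f : fsum n (fun i => f (S i) - f i) = f n - f O.
Proof. induction n as [|n IH]; simpl; [lra|]. rewrite IH; lra. Qed.

Lemma fsum_S_l n f : fsum (S n) f = f O + fsum n (fun i => f (S i)).
Proof. induction n as [|n IH]; [simpl; lra|]. change (fsum (S n) f + f (S n) = f O + (fsum n (fun i => f (S i)) + f (S n))). rewrite IH; lra. Qed.

Lemma fsum_rev n f : fsum n (fun i => f (n - 1 - i)%nat) = fsum n f.
Proof.
  revert f; induction n as [|n IH]; intros f; [reflexivity|].
  rewrite fsum_S_l. simpl fsum at 2. rewrite <- (IH f).
  replace (S n - 1 - 0)%nat with n by lia. rewrite Rplus_comm. f_equal.
  apply fsum_ext; intros; f_equal; lia.
Qed.

Definition sum2 (n m : nat) (f : nat -> nat -> R) : R := fsum n (fun i => fsum m (f i)).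

Lemma sum2_ext n m f g :
  (forall i j, (i < n)%nat -> (j < m)%nat -> f i j = g i j) -> sum2 n m f = sum2 n m g.
Proof. intros H; apply fsum_ext; intros; apply fsum_ext; intros; apply H; assumption. Qed.

Lemma sum2_plus n m f g :
  sum2 n m (fun i j => f i j + g i j) = sum2 n m f + sum2 n m g.
Proof.
  unfold sum2. rewrite <- fsum_plus. apply fsum_ext; intros; apply fsum_plus.
Qed.

Lemma sum2_scal n m k f : sum2 n m (fun i j => k * f i j) = k * sum2 n m f.
Proof.
  unfold sum2. rewrite <- fsum_scal. apply fsum_ext; intros; apply fsum_scal.
Qed.

Lemma sum2_minus n m f g :
  sum2 n m (fun i j => f i j - g i j) = sum2 n m f - sum2 n m g.
Proof.
  replace (sum2 n m f - sum2 n m g) with (sum2 n m f + -1 * sum2 n m g) by ring.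
  rewrite <- sum2_scal, <- sum2_plus. apply sum2_ext; intros; ring.
Qed.

Lemma sum2_le n m f g :
  (forall i j, (i < n)%nat -> (j < m)%nat -> f i j <= g i j) -> sum2 n m f <= sum2 n m g.
Proof. intros H; apply fsum_le; intros; apply fsum_le; intros; apply H; assumption. Qed.

Lemma sum2_abs n m f : Rabs (sum2 n m f) <= sum2 n m (fun i j => Rabs (f i j)).
Proof.
  eapply Rle_trans; [apply fsum_abs|]. apply fsum_le; intros; apply fsum_abs.
Qed.

Lemma sum2_const n m k : sum2 n m (fun _ _ => k) = INR n * (INR m * k).
Proof.
  unfold sum2. rewrite <- fsum_const. apply fsum_ext; intros; apply fsum_const.
Qed.

Lemma sum2_swap n m f : sum2 n m f = sum2 m n (fun i j => f j i).
Proof.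
  unfold sum2. induction n as [|n IH]; simpl.
  - rewrite fsum_const; lra.
  - rewrite IH, <- fsum_plus. reflexivity.
Qed.

Lemma sum2_prod n m f g : sum2 n m (fun i j => f i * g j) = fsum n f * fsum m g.
Proof.
  unfold sum2. rewrite Rmult_comm, <- fsum_scal.
  apply fsum_ext; intros. rewrite fsum_scal; lra.
Qed.

Definition node (a b : R) (n i : nat) : R := a + INR i * (b - a) / INR n.

Lemma node_S a b n i : node a b n (S i) = node a b n i + (b - a) / INR n.
Proof. unfold node; rewrite S_INR; unfold Rdiv; ring. Qed.

Lemma node_0 a b n : node a b n 0 = a.
Proof. unfold node; simpl; unfold Rdiv; ring. Qed.

Lemma node_n a b n : (0 < n)%nat -> node a b n n = b.
Proof. intros H; unfold node; field. apply not_0_INR; lia. Qed.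

Lemma step_nonneg a b n : a <= b -> 0 <= (b - a) / INR n.
Proof.
  (* For [n = 0] the convention [/ 0 = 0] makes the step 0. *)
  intros H; unfold Rdiv. destruct n; [simpl; rewrite Rinv_0; lra|].
  apply Rmult_le_pos; [lra|]. left; apply Rinv_0_lt_compat, lt_0_INR; lia.
Qed.

Lemma node_mono a b n i j : a <= b -> (i <= j)%nat -> node a b n i <= node a b n j.
Proof.
  intros H Hij; unfold node, Rdiv. rewrite !Rmult_assoc.
  assert (H1 := step_nonneg a b n H). unfold Rdiv in H1. apply le_INR in Hij. nra.
Qed.

Lemma node_bound a b n i : a <= b -> (0 < n)%nat -> (i <= n)%nat -> a <= node a b n i <= b.
Proof.
  intros. split.
  - rewrite <- (node_0 a b n) at 1. apply node_mono; [assumption|lia].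
  - rewrite <- (node_n a b n) at 2 by assumption. apply node_mono; assumption.
Qed.

(** * Tagged Riemann sums in the plane *)

Definition tagged (a b c d : R) (n : nat) (tx ty : nat -> nat -> R) : Prop :=
  forall i j, (i < n)%nat -> (j < n)%nat ->
    node a b n i <= tx i j <= node a b n (S i) /\
    node c d n j <= ty i j <= node c d n (S j).

Definition riemann_sum (f : R -> R -> R) a b c d n tx ty : R :=
  sum2 n n (fun i j => f (tx i j) (ty i j) * ((b - a) / INR n) * ((d - c) / INR n)).

Lemma RInt2_riemann_sum f a b c d l : is_RInt2 f a b c d l <->
  forall eps, eps > 0 -> exists N : nat, forall n : nat, (N <= n)%nat ->
    forall tx ty, tagged a b c d n tx ty -> Rabs (riemann_sum f a b c d n tx ty - l) < eps.
Proof. reflexivity. Qed.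

Lemma tagged_box a b c d n tx ty i j : a <= b -> c <= d -> tagged a b c d n tx ty ->
  (i < n)%nat -> (j < n)%nat -> a <= tx i j <= b /\ c <= ty i j <= d.
Proof.
  intros H1 H2 Ht Hi Hj. destruct (Ht i j Hi Hj) as [Hx Hy].
  assert (0 < n)%nat by lia.
  pose proof (node_bound a b n i H1 ltac:(lia) ltac:(lia)).
  pose proof (node_bound a b n (S i) H1 ltac:(lia) ltac:(lia)).
  pose proof (node_bound c d n j H2 ltac:(lia) ltac:(lia)).
  pose proof (node_bound c d n (S j) H2 ltac:(lia) ltac:(lia)). lra.
Qed.

Lemma tagged_corner a b c d n : a <= b -> c <= d ->
  tagged a b c d n (fun i _ => node a b n i) (fun _ j => node c d n j).
Proof.
  intros H1 H2 i j Hi Hj. rewrite !node_S.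
  pose proof (step_nonneg a b n H1). pose proof (step_nonneg c d n H2). lra.
Qed.

Lemma arch_div C eps : 0 < eps -> exists N, (0 < N)%nat /\ forall n, (N <= n)%nat -> C / INR n < eps.
Proof.
  intros He. destruct (INR_unbounded (C / eps)) as [N HN].
  exists (S N); split; [lia|]. intros n Hn.
  assert (0 < INR n) by (apply lt_0_INR; lia).
  assert (INR N <= INR n) by (apply le_INR; lia).
  apply Rmult_lt_reg_r with (INR n); [assumption|].
  unfold Rdiv; rewrite Rmult_assoc, Rinv_l by lra.
  assert (C / eps < INR n) by lra.
  apply Rmult_lt_compat_r with (r := eps) in H1; [|assumption].
  unfold Rdiv in H1; rewrite Rmult_assoc, Rinv_l in H1 by lra. lra.
Qed.

(** Both functions are evaluated at the same tags, so a discrepancy [O(1/n)] uniform in the tags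
    vanishes in the limit. Boundary effects are of exactly this order. *)
Lemma RInt2_near f g a b c d l e C : is_RInt2 f a b c d l ->
  (forall n tx ty, (0 < n)%nat -> tagged a b c d n tx ty ->
     Rabs (riemann_sum g a b c d n tx ty - riemann_sum f a b c d n tx ty - e) <= C / INR n) ->
  is_RInt2 g a b c d (l + e).
Proof.
  intros Hf H. apply RInt2_riemann_sum; intros eps He.
  destruct (proj1 (RInt2_riemann_sum _ _ _ _ _ _) Hf (eps / 2) ltac:(lra)) as [N1 H1].
  destruct (arch_div C (eps / 2) ltac:(lra)) as [N2 [HN2 H2]].
  exists (max N1 N2); intros n Hn tx ty Ht.
  specialize (H1 n ltac:(lia) tx ty Ht). specialize (H2 n ltac:(lia)).
  specialize (H n tx ty ltac:(lia) Ht).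
  replace (riemann_sum g a b c d n tx ty - (l + e)) with
    ((riemann_sum g a b c d n tx ty - riemann_sum f a b c d n tx ty - e) + (riemann_sum f a b c d n tx ty - l)) by ring.
  eapply Rle_lt_trans; [apply Rabs_triang|lra].
Qed.

Lemma RInt2_ext f g a b c d l : a <= b -> c <= d ->
  (forall p q, a <= p <= b -> c <= q <= d -> f p q = g p q) ->
  is_RInt2 f a b c d l -> is_RInt2 g a b c d l.
Proof.
  intros H1 H2 H Hf. rewrite <- (Rplus_0_r l). apply (RInt2_near f g a b c d l 0 0 Hf).
  intros n tx ty Hn Ht.
  replace (riemann_sum g a b c d n tx ty) with (riemann_sum f a b c d n tx ty).
  - unfold Rdiv; rewrite Rminus_diag, Rminus_diag, Rabs_R0, Rmult_0_l; lra.
  - apply sum2_ext; intros i j Hi Hj.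
    destruct (tagged_box a b c d n tx ty i j H1 H2 Ht Hi Hj). rewrite H; auto.
Qed.

Lemma riemann_sum_plus f g a b c d n tx ty :
  riemann_sum (fun p q => f p q + g p q) a b c d n tx ty = riemann_sum f a b c d n tx ty + riemann_sum g a b c d n tx ty.
Proof. unfold riemann_sum. rewrite <- sum2_plus. apply sum2_ext; intros; ring. Qed.

Lemma riemann_sum_scal k f a b c d n tx ty :
  riemann_sum (fun p q => k * f p q) a b c d n tx ty = k * riemann_sum f a b c d n tx ty.
Proof. unfold riemann_sum. rewrite <- sum2_scal. apply sum2_ext; intros; ring. Qed.

Lemma RInt2_zero a b c d : is_RInt2 (fun _ _ => 0) a b c d 0.
Proof.
  apply RInt2_riemann_sum; intros eps He; exists O; intros n _ tx ty _.
  unfold riemann_sum. rewrite (sum2_ext _ _ _ (fun _ _ => 0)) by (intros; ring).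
  rewrite sum2_const, !Rmult_0_r, Rminus_0_r, Rabs_R0; lra.
Qed.

Lemma RInt2_plus f g a b c d l m : is_RInt2 f a b c d l -> is_RInt2 g a b c d m ->
  is_RInt2 (fun p q => f p q + g p q) a b c d (l + m).
Proof.
  intros Hf Hg. apply RInt2_riemann_sum; intros eps He.
  destruct (proj1 (RInt2_riemann_sum _ _ _ _ _ _) Hf (eps / 2) ltac:(lra)) as [N1 H1].
  destruct (proj1 (RInt2_riemann_sum _ _ _ _ _ _) Hg (eps / 2) ltac:(lra)) as [N2 H2].
  exists (max N1 N2); intros n Hn tx ty Ht.
  specialize (H1 n ltac:(lia) tx ty Ht). specialize (H2 n ltac:(lia) tx ty Ht).
  rewrite riemann_sum_plus.
  replace (riemann_sum f a b c d n tx ty + riemann_sum g a b c d n tx ty - (l + m)) with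
    ((riemann_sum f a b c d n tx ty - l) + (riemann_sum g a b c d n tx ty - m)) by ring.
  eapply Rle_lt_trans; [apply Rabs_triang|lra].
Qed.

Lemma RInt2_scal k f a b c d l : is_RInt2 f a b c d l ->
  is_RInt2 (fun p q => k * f p q) a b c d (k * l).
Proof.
  intros Hf. apply RInt2_riemann_sum; intros eps He.
  assert (Hk : 0 < Rabs k + 1) by (pose proof (Rabs_pos k); lra).
  destruct (proj1 (RInt2_riemann_sum _ _ _ _ _ _) Hf (eps / (Rabs k + 1))) as [N1 H1].
  { apply Rdiv_lt_0_compat; lra. }
  exists N1; intros n Hn tx ty Ht. specialize (H1 n Hn tx ty Ht).
  rewrite riemann_sum_scal, <- Rmult_minus_distr_l, Rabs_mult.
  apply Rle_lt_trans with ((Rabs k) * (eps / (Rabs k + 1))).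
  { apply Rmult_le_compat_l; [apply Rabs_pos|lra]. }
  apply Rmult_lt_reg_r with (Rabs k + 1); [assumption|].
  replace (Rabs k * (eps / (Rabs k + 1)) * (Rabs k + 1)) with (Rabs k * eps) by (field; lra).
  nra.
Qed.

Lemma riemann_sum_le f g a b c d n tx ty : a <= b -> c <= d -> tagged a b c d n tx ty ->
  (forall p q, a <= p <= b -> c <= q <= d -> f p q <= g p q) ->
  riemann_sum f a b c d n tx ty <= riemann_sum g a b c d n tx ty.
Proof.
  intros H1 H2 Ht H. apply sum2_le; intros i j Hi Hj.
  destruct (tagged_box a b c d n tx ty i j H1 H2 Ht Hi Hj).
  apply Rmult_le_compat_r; [apply step_nonneg; assumption|].
  apply Rmult_le_compat_r; [apply step_nonneg; assumption|]. auto.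
Qed.

Lemma RInt2_le f g a b c d l m : a <= b -> c <= d ->
  (forall p q, a <= p <= b -> c <= q <= d -> f p q <= g p q) ->
  is_RInt2 f a b c d l -> is_RInt2 g a b c d m -> l <= m.
Proof.
  intros H1 H2 H Hf Hg. apply Rnot_lt_le; intros Hlt.
  destruct (proj1 (RInt2_riemann_sum _ _ _ _ _ _) Hf ((l - m) / 2) ltac:(lra)) as [N1 HN1].
  destruct (proj1 (RInt2_riemann_sum _ _ _ _ _ _) Hg ((l - m) / 2) ltac:(lra)) as [N2 HN2].
  pose proof (tagged_corner a b c d (max N1 N2) H1 H2) as Ht.
  specialize (HN1 _ (Nat.le_max_l _ _) _ _ Ht). specialize (HN2 _ (Nat.le_max_r _ _) _ _ Ht).
  pose proof (riemann_sum_le f g _ _ _ _ _ _ _ H1 H2 Ht H).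
  apply Rabs_def2 in HN1. apply Rabs_def2 in HN2. lra.
Qed.

Lemma RInt2_squeeze f a b c d l : a <= b -> c <= d ->
  (forall eps, 0 < eps -> exists g1 g2 l1 l2,
     is_RInt2 g1 a b c d l1 /\ is_RInt2 g2 a b c d l2 /\
     (forall p q, a <= p <= b -> c <= q <= d -> g1 p q <= f p q <= g2 p q) /\
     l - eps <= l1 /\ l2 <= l + eps) ->
  is_RInt2 f a b c d l.
Proof.
  intros H1 H2 H. apply RInt2_riemann_sum; intros eps He.
  destruct (H (eps / 2) ltac:(lra)) as (g1 & g2 & l1 & l2 & Hg1 & Hg2 & Hb & Hl1 & Hl2).
  destruct (proj1 (RInt2_riemann_sum _ _ _ _ _ _) Hg1 (eps / 2) ltac:(lra)) as [N1 HN1].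
  destruct (proj1 (RInt2_riemann_sum _ _ _ _ _ _) Hg2 (eps / 2) ltac:(lra)) as [N2 HN2].
  exists (max N1 N2); intros n Hn tx ty Ht.
  specialize (HN1 n ltac:(lia) _ _ Ht). specialize (HN2 n ltac:(lia) _ _ Ht).
  apply Rabs_def2 in HN1. apply Rabs_def2 in HN2.
  assert (riemann_sum g1 a b c d n tx ty <= riemann_sum f a b c d n tx ty)
    by (apply riemann_sum_le; auto; intros; apply Hb; auto).
  assert (riemann_sum f a b c d n tx ty <= riemann_sum g2 a b c d n tx ty)
    by (apply riemann_sum_le; auto; intros; apply Hb; auto).
  apply Rabs_def1; lra.
Qed.

Lemma RInt2_swap f a b c d l :
  is_RInt2 f a b c d l -> is_RInt2 (fun p q => f q p) c d a b l.
Proof.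
  intros Hf. apply RInt2_riemann_sum; intros eps He.
  destruct (proj1 (RInt2_riemann_sum _ _ _ _ _ _) Hf eps He) as [N HN].
  exists N; intros n Hn tx ty Ht.
  specialize (HN n Hn (fun i j => ty j i) (fun i j => tx j i)).
  replace (riemann_sum (fun p q => f q p) c d a b n tx ty) with
    (riemann_sum f a b c d n (fun i j => ty j i) (fun i j => tx j i)).
  - apply HN. intros i j Hi Hj. destruct (Ht j i Hj Hi); split; assumption.
  - unfold riemann_sum. rewrite sum2_swap. apply sum2_ext; intros; ring.
Qed.

Lemma RInt2_trans f a b c d l v w :
  is_RInt2 f a b c d l ->
  is_RInt2 (fun p q => f (p - v) (q - w)) (a + v) (b + v) (c + w) (d + w) l.
Proof.
  intros Hf. apply RInt2_riemann_sum; intros eps He.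
  destruct (proj1 (RInt2_riemann_sum _ _ _ _ _ _) Hf eps He) as [N HN].
  exists N; intros n Hn tx ty Ht.
  specialize (HN n Hn (fun i j => tx i j - v) (fun i j => ty i j - w)).
  unfold riemann_sum in *. replace (b + v - (a + v)) with (b - a) by ring.
  replace (d + w - (c + w)) with (d - c) by ring.
  apply HN. intros i j Hi Hj. specialize (Ht i j Hi Hj). unfold node in *.
  replace (b + v - (a + v)) with (b - a) in Ht by ring.
  replace (d + w - (c + w)) with (d - c) in Ht by ring. lra.
Qed.

Lemma RInt2_refl f a b c d l :
  is_RInt2 f a b c d l -> is_RInt2 (fun p q => f (- p) q) (- b) (- a) c d l.
Proof.
  intros Hf. apply RInt2_riemann_sum; intros eps He.
  destruct (proj1 (RInt2_riemann_sum _ _ _ _ _ _) Hf eps He) as [N HN].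
  exists (S N); intros n Hn tx ty Ht.
  specialize (HN n ltac:(lia) (fun i j => - tx (n - 1 - i)%nat j)
     (fun i j => ty (n - 1 - i)%nat j)).
  replace (riemann_sum (fun p q => f (- p) q) (- b) (- a) c d n tx ty) with
    (riemann_sum f a b c d n (fun i j => - tx (n - 1 - i)%nat j) (fun i j => ty (n - 1 - i)%nat j)).
  - apply HN. intros i j Hi Hj.
    destruct (Ht (n - 1 - i)%nat j ltac:(lia) Hj) as [H1 H2]. split; [|assumption].
    assert (E : forall k, (k <= n)%nat -> node (- b) (- a) n (n - k) = - node a b n k).
    { intros k Hk. unfold node. rewrite minus_INR by lia. field. apply not_0_INR; lia. }
    replace (n - 1 - i)%nat with (n - S i)%nat in * by lia.
    rewrite E in H1 by lia. replace (S (n - S i)) with (n - i)%nat in H1 by lia.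
    rewrite E in H1 by lia. lra.
  - unfold riemann_sum, sum2. rewrite <- (fsum_rev n (fun i => fsum n _)).
    apply fsum_ext; intros i Hi; apply fsum_ext; intros j Hj.
    replace (- a - - b) with (b - a) by ring.
    replace (n - 1 - (n - 1 - i))%nat with i by lia. reflexivity.
Qed.

(** * Null edges and areas of rectangles *)

Definition hits (a b : R) (n : nat) (x : R) (i : nat) : R :=
  if Rle_dec (node a b n i) x then if Rle_dec x (node a b n (S i)) then 1 else 0 else 0.

Lemma hits_bounds a b n x i : 0 <= hits a b n x i <= 1.
Proof. unfold hits. destruct Rle_dec; [destruct Rle_dec|]; lra. Qed.

(* A ramp of slope 1/step and height 2 centred at [x] increases by 1 across every cell containing [x]. *)
Lemma hits_sum a b n x : a < b -> (0 < n)%nat -> fsum n (hits a b n x) <= 2.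
Proof.
  intros Hab Hn. set (dl := (b - a) / INR n).
  assert (Hdl : 0 < dl) by (apply Rdiv_lt_0_compat; [lra|apply lt_0_INR; lia]).
  set (th := fun y => Rmax 0 (Rmin 2 ((y - x) / dl + 1))).
  apply Rle_trans with (fsum n (fun i => th (node a b n (S i)) - th (node a b n i))).
  - apply fsum_le; intros i Hi. rewrite node_S. fold dl. set (y := node a b n i).
    unfold th. replace ((y + dl - x) / dl) with ((y - x) / dl + 1) by (field; lra).
    unfold hits. rewrite node_S; fold dl; fold y.
    assert (E : (y - x) / dl * dl = y - x) by (field; lra).
    unfold Rmax, Rmin; repeat destruct Rle_dec; try lra; nra.
  - rewrite (fsum_tele n (fun i => th (node a b n i))).
    unfold th, Rmax, Rmin; repeat destruct Rle_dec; lra.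
Qed.

(** A point on a node belongs to two closed cells, so each of the two lines meets at most two
    columns or two rows: at most [4n] of the [n^2] cells, each of area [O(1/n^2)], can contribute up
    to [M]. *)
Lemma RInt2_edge f g a b c d l M p0 q0 : a < b -> c < d ->
  (forall p q, a <= p <= b -> c <= q <= d -> p <> p0 -> q <> q0 -> f p q = g p q) ->
  (forall p q, a <= p <= b -> c <= q <= d -> Rabs (g p q - f p q) <= M) ->
  is_RInt2 f a b c d l -> is_RInt2 g a b c d l.
Proof.
  intros Hab Hcd H HM Hf. rewrite <- (Rplus_0_r l).
  assert (HM0 : 0 <= M).
  { eapply Rle_trans; [apply Rabs_pos|apply (HM a c); lra]. }
  apply (RInt2_near f g a b c d l 0 (4 * M * (b - a) * (d - c)) Hf).
  intros n tx ty Hn Ht. assert (0 < INR n) by (apply lt_0_INR; lia).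
  set (A := (b - a) / INR n * ((d - c) / INR n)).
  assert (HA : 0 <= A) by (apply Rmult_le_pos; apply step_nonneg; lra).
  rewrite Rminus_0_r.
  replace (riemann_sum g a b c d n tx ty - riemann_sum f a b c d n tx ty) with
    (sum2 n n (fun i j => (g (tx i j) (ty i j) - f (tx i j) (ty i j)) * A)).
  2:{ unfold riemann_sum. rewrite <- sum2_minus. apply sum2_ext; intros; unfold A; ring. }
  eapply Rle_trans; [apply sum2_abs|].
  apply Rle_trans with (sum2 n n (fun i j => (A * M) * (hits a b n p0 i * 1 + 1 * hits c d n q0 j))).
  - apply sum2_le; intros i j Hi Hj.
    destruct (tagged_box a b c d n tx ty i j ltac:(lra) ltac:(lra) Ht Hi Hj) as [Bx By].
    destruct (Ht i j Hi Hj) as [Tx Ty].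
    pose proof (hits_bounds a b n p0 i). pose proof (hits_bounds c d n q0 j).
    rewrite Rabs_mult, (Rabs_pos_eq A) by assumption.
    specialize (HM _ _ Bx By).
    destruct (Req_dec (tx i j) p0) as [E|E].
    + assert (hits a b n p0 i = 1).
      { unfold hits. rewrite <- E. destruct Rle_dec; [destruct Rle_dec|]; lra. }
      assert (0 <= A * M) by nra. nra.
    + destruct (Req_dec (ty i j) q0) as [E'|E'].
      * assert (hits c d n q0 j = 1).
        { unfold hits. rewrite <- E'. destruct Rle_dec; [destruct Rle_dec|]; lra. }
        assert (0 <= A * M) by nra. nra.
      * rewrite (H _ _ Bx By E E'), Rminus_diag, Rabs_R0.
        assert (0 <= A * M) by nra. nra.
  - rewrite sum2_scal, sum2_plus.
    rewrite (sum2_prod n n (hits a b n p0) (fun _ => 1)).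
    rewrite (sum2_prod n n (fun _ => 1) (hits c d n q0)), !fsum_const.
    pose proof (hits_sum a b n p0 Hab Hn). pose proof (hits_sum c d n q0 Hcd Hn).
    apply Rle_trans with (A * M * (4 * INR n)).
    + apply Rmult_le_compat_l; [nra|nra].
    + right. unfold A; field; lra.
Qed.

Definition ind1 (a b p : R) : R := if Rle_dec a p then if Rlt_dec p b then 1 else 0 else 0.

Lemma ind1_in a b p : a <= p < b -> ind1 a b p = 1.
Proof. unfold ind1; intros; destruct Rle_dec; [destruct Rlt_dec|]; lra. Qed.

Lemma ind1_01 a b p : ind1 a b p = 0 \/ ind1 a b p = 1.
Proof. unfold ind1; destruct Rle_dec; [destruct Rlt_dec|]; lra. Qed.

Definition ind (a b c d p q : R) : R := ind1 a b p * ind1 c d q.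

(** Serves as a distribution function: its increment over an interval is the length of the part of
    that interval lying in [[x1, x2]]. *)
Definition clamp (x1 x2 y : R) : R := Rmax x1 (Rmin x2 y).

Lemma clamp_cases x1 x2 y : x1 <= x2 ->
  (y <= x1 /\ clamp x1 x2 y = x1) \/ (x1 <= y <= x2 /\ clamp x1 x2 y = y) \/ (x2 <= y /\ clamp x1 x2 y = x2).
Proof. intros; unfold clamp, Rmax, Rmin; repeat destruct Rle_dec; lra. Qed.
Lemma clamp_step x1 x2 y dl t : 0 < dl -> x1 <= x2 -> y <= t <= y + dl ->
     0 <= clamp x1 x2 (y + dl) - clamp x1 x2 y <= dl /\
     (~ (y <= x1 <= y + dl) -> ~ (y <= x2 <= y + dl) ->
      dl * ind1 x1 x2 t = clamp x1 x2 (y + dl) - clamp x1 x2 y).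
Proof.
intros H1 H2 H3.
destruct (clamp_cases x1 x2 (y+dl) H2) as [[A ->]|[[A ->]|[A ->]]];
destruct (clamp_cases x1 x2 y H2) as [[B ->]|[[B ->]|[B ->]]]; (split; [lra|intros H4 H5; unfold ind1; destruct Rle_dec; try destruct Rlt_dec; lra]).
Qed.

(** The area is a product of two telescoping sums of [clamp] increments. The Riemann sum agrees with
    it term by term except in cells touching an edge line; four lines with at most two rows or
    columns each leave [8n] bad cells, so the error is [O(1/n)]. *)
Lemma RInt2_rect a b c d x1 x2 y1 y2 : a < b -> c < d ->
  a <= x1 -> x1 <= x2 -> x2 <= b -> c <= y1 -> y1 <= y2 -> y2 <= d ->
  is_RInt2 (ind x1 x2 y1 y2) a b c d ((x2 - x1) * (y2 - y1)).
Proof.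
  intros Hab Hcd Hx1 Hx Hx2 Hy1 Hy Hy2.
  rewrite <- (Rplus_0_l ((x2 - x1) * (y2 - y1))).
  apply (RInt2_near (fun _ _ => 0) _ a b c d 0 _ (8 * (b - a) * (d - c)) (RInt2_zero _ _ _ _)).
  intros n tx ty Hn Ht. assert (Hn' : 0 < INR n) by (apply lt_0_INR; lia).
  set (dx := (b - a) / INR n). set (dy := (d - c) / INR n).
  assert (Hdx : 0 < dx) by (apply Rdiv_lt_0_compat; lra).
  assert (Hdy : 0 < dy) by (apply Rdiv_lt_0_compat; lra).
  replace (riemann_sum (fun _ _ => 0) a b c d n tx ty) with 0
    by (unfold riemann_sum; rewrite (sum2_ext _ _ _ (fun _ _ => 0)) by (intros; ring);
        rewrite sum2_const; ring).
  rewrite Rminus_0_r.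
  set (lx := fun i => clamp x1 x2 (node a b n (S i)) - clamp x1 x2 (node a b n i)).
  set (ly := fun i => clamp y1 y2 (node c d n (S i)) - clamp y1 y2 (node c d n i)).
  assert (Elx : fsum n lx = x2 - x1).
  { unfold lx. rewrite (fsum_tele n (fun i => clamp x1 x2 (node a b n i))).
    rewrite node_0, node_n by lia. unfold clamp, Rmax, Rmin; repeat destruct Rle_dec; lra. }
  assert (Ely : fsum n ly = y2 - y1).
  { unfold ly. rewrite (fsum_tele n (fun i => clamp y1 y2 (node c d n i))).
    rewrite node_0, node_n by lia. unfold clamp, Rmax, Rmin; repeat destruct Rle_dec; lra. }
  rewrite <- Elx, <- Ely, <- sum2_prod.
  unfold riemann_sum. rewrite <- sum2_minus.
  eapply Rle_trans; [apply sum2_abs|].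
  apply Rle_trans with (sum2 n n (fun i j => (dx * dy) *
    ((hits a b n x1 i + hits a b n x2 i) * 1 + 1 * (hits c d n y1 j + hits c d n y2 j)))).
  - apply sum2_le; intros i j Hi Hj. fold dx dy.
    destruct (Ht i j Hi Hj) as [Tx Ty]. rewrite node_S in Tx, Ty. fold dx in Tx. fold dy in Ty.
    destruct (clamp_step x1 x2 _ dx _ Hdx Hx Tx) as [Kx1 Kx2].
    destruct (clamp_step y1 y2 _ dy _ Hdy Hy Ty) as [Ky1 Ky2].
    assert (Ex : node a b n i + dx = node a b n (S i)) by (rewrite node_S; reflexivity).
    assert (Ey : node c d n j + dy = node c d n (S j)) by (rewrite node_S; reflexivity).
    rewrite Ex in Kx1, Kx2. rewrite Ey in Ky1, Ky2.
    fold (lx i) in Kx1, Kx2. fold (ly j) in Ky1, Ky2.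
    unfold ind. set (s := ind1 x1 x2 (tx i j)) in *. set (t := ind1 y1 y2 (ty i j)) in *.
    assert (Hs : 0 <= s <= 1) by (destruct (ind1_01 x1 x2 (tx i j)); unfold s; lra).
    assert (Ht' : 0 <= t <= 1) by (destruct (ind1_01 y1 y2 (ty i j)); unfold t; lra).
    pose proof (hits_bounds a b n x1 i). pose proof (hits_bounds a b n x2 i).
    pose proof (hits_bounds c d n y1 j). pose proof (hits_bounds c d n y2 j).
    assert (Hbad : Rabs (s * t * dx * dy - lx i * ly j) <= dx * dy).
    { assert (0 <= lx i * ly j <= dx * dy) by nra.
      assert (0 <= s * t <= 1) by nra.
      assert (0 <= (s * t) * (dx * dy) <= dx * dy) by nra.
      apply Rabs_le; lra. }
    assert (Hb : forall e, 1 <= e -> Rabs (s * t * dx * dy - lx i * ly j) <= dx * dy * e).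
    { intros e He. assert (0 < dx * dy) by nra. nra. }
    assert (C1 : 1 <= hits a b n x1 i \/ ~ (node a b n i <= x1 <= node a b n (S i))).
    { unfold hits. destruct Rle_dec; [destruct Rle_dec|]; lra. }
    assert (C2 : 1 <= hits a b n x2 i \/ ~ (node a b n i <= x2 <= node a b n (S i))).
    { unfold hits. destruct Rle_dec; [destruct Rle_dec|]; lra. }
    assert (C3 : 1 <= hits c d n y1 j \/ ~ (node c d n j <= y1 <= node c d n (S j))).
    { unfold hits. destruct Rle_dec; [destruct Rle_dec|]; lra. }
    assert (C4 : 1 <= hits c d n y2 j \/ ~ (node c d n j <= y2 <= node c d n (S j))).
    { unfold hits. destruct Rle_dec; [destruct Rle_dec|]; lra. }
    destruct C1 as [C1|C1]; [apply Hb; lra|]. destruct C2 as [C2|C2]; [apply Hb; lra|].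
    destruct C3 as [C3|C3]; [apply Hb; lra|]. destruct C4 as [C4|C4]; [apply Hb; lra|].
    rewrite <- (Kx2 C1 C2), <- (Ky2 C3 C4).
    replace (s * t * dx * dy - dx * s * (dy * t)) with 0 by ring.
    rewrite Rabs_R0. apply Rmult_le_pos; nra.
  - rewrite sum2_scal, sum2_plus.
    rewrite (sum2_prod n n (fun i => hits a b n x1 i + hits a b n x2 i) (fun _ => 1)).
    rewrite (sum2_prod n n (fun _ => 1) (fun j => hits c d n y1 j + hits c d n y2 j)).
    rewrite !fsum_const, !fsum_plus.
    pose proof (hits_sum a b n x1 Hab Hn). pose proof (hits_sum a b n x2 Hab Hn).
    pose proof (hits_sum c d n y1 Hcd Hn). pose proof (hits_sum c d n y2 Hcd Hn).
    apply Rle_trans with (dx * dy * (8 * INR n)).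
    + apply Rmult_le_compat_l; [nra|nra].
    + right. unfold dx, dy; field; lra.
Qed.

(** * Integrals over half-open rectangles *)

Lemma ind_in a b c d p q : a <= p < b -> c <= q < d -> ind a b c d p q = 1.
Proof. intros; unfold ind; rewrite !ind1_in by assumption; ring. Qed.

Lemma ind_out a b c d p q : ~ (a <= p < b /\ c <= q < d) -> ind a b c d p q = 0.
Proof.
  intros H; unfold ind. destruct (ind1_01 a b p) as [E|E]; rewrite E; [ring|].
  destruct (ind1_01 c d q) as [E'|E']; rewrite E'; [ring|]. exfalso; apply H.
  revert E E'. unfold ind1. repeat destruct Rle_dec; repeat destruct Rlt_dec; lra.
Qed.

Lemma ind_cases a b c d p q :
  (a <= p < b /\ c <= q < d /\ ind a b c d p q = 1) \/
  (~ (a <= p < b /\ c <= q < d) /\ ind a b c d p q = 0).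
Proof.
  destruct (Rle_dec a p), (Rlt_dec p b), (Rle_dec c q), (Rlt_dec q d);
    first [left; split; [lra|]; split; [lra|]; apply ind_in; lra
          |right; split; [lra|]; apply ind_out; lra].
Qed.

(* Quantifying over all enclosing boxes makes the integral independent of the grid, so that it is additive in the half-open rectangle. *)
Definition rect_int (f : R -> R -> R) a b c d l : Prop :=
  forall a' b' c' d', a' <= a -> b <= b' -> c' <= c -> d <= d' -> a' < b' -> c' < d' ->
    is_RInt2 (fun p q => ind a b c d p q * f p q) a' b' c' d' l.

Lemma rect_int_ext f g a b c d l :
  (forall p q, a <= p < b -> c <= q < d -> f p q = g p q) -> rect_int f a b c d l -> rect_int g a b c d l.
Proof.
  intros H Hf a' b' c' d' H1 H2 H3 H4 H5 H6.
  apply RInt2_ext with (fun p q => ind a b c d p q * f p q); [lra|lra| |auto].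
  intros p q _ _. destruct (ind_cases a b c d p q) as [(A & B & E)|[A E]]; rewrite E; [|ring].
  rewrite H; auto.
Qed.

Lemma rect_int_plus f g a b c d l m : rect_int f a b c d l -> rect_int g a b c d m ->
  rect_int (fun p q => f p q + g p q) a b c d (l + m).
Proof.
  intros Hf Hg a' b' c' d' H1 H2 H3 H4 H5 H6.
  eapply RInt2_ext; [lra|lra| |apply RInt2_plus; [apply Hf|apply Hg]; assumption].
  intros; simpl; ring.
Qed.

Lemma rect_int_scal k f a b c d l : rect_int f a b c d l -> rect_int (fun p q => k * f p q) a b c d (k * l).
Proof.
  intros Hf a' b' c' d' H1 H2 H3 H4 H5 H6.
  eapply RInt2_ext; [lra|lra| |apply (RInt2_scal k), Hf; assumption].
  intros; simpl; ring.
Qed.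

Lemma rect_int_minus f g a b c d l m : rect_int f a b c d l -> rect_int g a b c d m ->
  rect_int (fun p q => f p q - g p q) a b c d (l - m).
Proof.
  intros Hf Hg. replace (l - m) with (l + -1 * m) by ring.
  eapply rect_int_ext; [|apply rect_int_plus; [exact Hf|apply (rect_int_scal (-1)), Hg]].
  intros; simpl; ring.
Qed.

Lemma rect_int_le f g a b c d l m :
  (forall p q, a <= p < b -> c <= q < d -> f p q <= g p q) ->
  rect_int f a b c d l -> rect_int g a b c d m -> l <= m.
Proof.
  intros H Hf Hg.
  (* The enclosing box is widened by 1 to be nondegenerate even when the rectangle is empty. *)
  pose proof (Rmax_l a b). pose proof (Rmax_r a b). pose proof (Rmax_l c d). pose proof (Rmax_r c d).
  refine (RInt2_le _ _ a (Rmax a b + 1) c (Rmax c d + 1) l m _ _ _ (Hf _ _ _ _ _ _ _ _ _ _) (Hg _ _ _ _ _ _ _ _ _ _)); try lra.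
  intros p q _ _. destruct (ind_cases a b c d p q) as [(A & B & E)|[A E]]; rewrite E; [|lra].
  specialize (H p q A B); lra.
Qed.

Lemma rect_int_unique f a b c d l m : rect_int f a b c d l -> rect_int f a b c d m -> l = m.
Proof. intros H1 H2; apply Rle_antisym; eapply rect_int_le; eauto; intros; lra. Qed.

Lemma rect_int_const k a b c d : a <= b -> c <= d -> rect_int (fun _ _ => k) a b c d (k * ((b - a) * (d - c))).
Proof.
  intros Hab Hcd a' b' c' d' H1 H2 H3 H4 H5 H6.
  eapply RInt2_ext; [lra|lra| |apply (RInt2_scal k), (RInt2_rect a' b' c' d' a b c d); lra].
  intros; simpl; ring.
Qed.

Lemma rect_int_zero a b c d : rect_int (fun _ _ => 0) a b c d 0.
Proof.
  intros a' b' c' d' H1 H2 H3 H4 H5 H6.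
  eapply RInt2_ext; [lra|lra| |apply RInt2_zero]. intros; simpl; ring.
Qed.

Lemma rect_int_addx f a m b c d l1 l2 : a <= m -> m <= b ->
  rect_int f a m c d l1 -> rect_int f m b c d l2 -> rect_int f a b c d (l1 + l2).
Proof.
  intros H7 H8 Hf Hg a' b' c' d' H1 H2 H3 H4 H5 H6.
  eapply RInt2_ext; [lra|lra| |apply RInt2_plus; [apply Hf|apply Hg]; lra].
  intros p q _ _; simpl. rewrite <- Rmult_plus_distr_r. f_equal. unfold ind.
  rewrite <- Rmult_plus_distr_r. f_equal. unfold ind1. repeat destruct Rle_dec; repeat destruct Rlt_dec; lra.
Qed.

Lemma rect_int_swap f a b c d l : rect_int f a b c d l -> rect_int (fun p q => f q p) c d a b l.
Proof.
  intros Hf a' b' c' d' H1 H2 H3 H4 H5 H6.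
  eapply RInt2_ext; [lra|lra| |apply RInt2_swap, (Hf c' d' a' b'); lra].
  intros; unfold ind; simpl; ring.
Qed.

Lemma rect_int_addy f a b c m d l1 l2 : c <= m -> m <= d ->
  rect_int f a b c m l1 -> rect_int f a b m d l2 -> rect_int f a b c d (l1 + l2).
Proof.
  intros H1 H2 Hf Hg. apply rect_int_swap in Hf. apply rect_int_swap in Hg.
  exact (rect_int_swap _ _ _ _ _ _ (rect_int_addx _ _ _ _ _ _ _ _ H1 H2 Hf Hg)).
Qed.

Lemma rect_int_sub f a b c d A B C D l : A <= a -> b <= B -> C <= c -> d <= D ->
  rect_int f a b c d l -> rect_int (fun p q => ind a b c d p q * f p q) A B C D l.
Proof.
  intros H7 H8 H9 H10 Hf a' b' c' d' H1 H2 H3 H4 H5 H6.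
  eapply RInt2_ext; [lra|lra| |apply (Hf a' b' c' d'); lra].
  intros p q _ _; simpl.
  destruct (ind_cases a b c d p q) as [(? & ? & E)|[? E]]; rewrite E; [|ring].
  rewrite ind_in by lra; ring.
Qed.

(** The way back from half-open rectangles to the closed boxes of the definitions: the integrands
    differ only on the edges [p = b] and [q = d]. *)
Lemma rect_int_closed f a b c d l M : a < b -> c < d ->
  (forall p q, a <= p <= b -> c <= q <= d -> Rabs (f p q) <= M) ->
  rect_int f a b c d l -> is_RInt2 f a b c d l.
Proof.
  intros H1 H2 HM Hf.
  apply (RInt2_edge (fun p q => ind a b c d p q * f p q) f a b c d l M b d H1 H2).
  - intros p q Hp Hq Hpb Hqd. rewrite ind_in by lra. ring.
  - intros p q Hp Hq. specialize (HM p q Hp Hq). pose proof (Rabs_pos (f p q)).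
    destruct (ind_cases a b c d p q) as [(? & ? & E)|[? E]]; rewrite E.
    + rewrite Rmult_1_l, Rminus_diag, Rabs_R0; lra.
    + rewrite Rmult_0_l, Rminus_0_r; lra.
  - apply Hf; lra.
Qed.

Lemma rect_int_trans f a b c d l v w : rect_int f a b c d l ->
  rect_int (fun p q => f (p - v) (q - w)) (a + v) (b + v) (c + w) (d + w) l.
Proof.
  intros Hf a' b' c' d' H1 H2 H3 H4 H5 H6.
  assert (K := RInt2_trans _ _ _ _ _ _ v w
    (Hf (a' - v) (b' - v) (c' - w) (d' - w) ltac:(lra) ltac:(lra) ltac:(lra) ltac:(lra)
       ltac:(lra) ltac:(lra))).
  replace (a' - v + v) with a' in K by ring. replace (b' - v + v) with b' in K by ring.
  replace (c' - w + w) with c' in K by ring. replace (d' - w + w) with d' in K by ring.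
  eapply RInt2_ext; [lra|lra| |exact K]. intros p q _ _; simpl. f_equal.
  destruct (ind_cases a b c d (p - v) (q - w)) as [(? & ? & E)|[? E]]; rewrite E; symmetry.
  - apply ind_in; lra.
  - apply ind_out; lra.
Qed.

Lemma rect_int_reflx f a b c d l M : a <= b -> c <= d ->
  (forall p q, a <= p <= b -> c <= q <= d -> Rabs (f p q) <= M) ->
  rect_int f a b c d l -> rect_int (fun p q => f (- p) q) (- b) (- a) c d l.
Proof.
  intros Hab Hcd HM Hf a' b' c' d' H1 H2 H3 H4 H5 H6.
  assert (HM0 : 0 <= M) by (eapply Rle_trans; [apply Rabs_pos|apply (HM a c); lra]).
  assert (K := RInt2_refl _ _ _ _ _ _
    (Hf (- b') (- a') c' d' ltac:(lra) ltac:(lra) ltac:(lra) ltac:(lra) ltac:(lra) ltac:(lra))).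
  rewrite !Ropp_involutive in K.
  set (F1 := fun p q => ind a b c d (- p) q * f (- p) q) in K.
  set (F2 := fun p q => ind (- b) (- a) c d p q * f (- p) q).
  assert (B : forall p q, Rabs (F2 p q - F1 p q) <= M).
  { intros p q. unfold F1, F2.
    destruct (ind_cases a b c d (- p) q) as [(? & ? & E)|[? E]];
    destruct (ind_cases (- b) (- a) c d p q) as [(? & ? & E')|[? E']]; rewrite E, E';
    try (replace (_ - _) with 0 by ring; rewrite Rabs_R0; assumption);
    specialize (HM (- p) q ltac:(lra) ltac:(lra)).
    - replace (_ - _) with (- f (- p) q) by ring. rewrite Rabs_Ropp; assumption.
    - replace (_ - _) with (f (- p) q) by ring. assumption. }
  (* Reflection moves the closed end of the interval to the other side, so the two indicators
     disagree on the two vertical lines [p = - a] and [p = - b]. [RInt2_edge] allows one vertical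
     line at a time; [G] is the halfway function, and the ordinate 0 passed with each line is
     arbitrary. *)
  set (G := fun p q => if Req_EM_T p (- a) then F2 p q else F1 p q).
  apply (RInt2_edge G F2 a' b' c' d' l M (- b) 0 H5 H6).
  - intros p q _ _ Hp _. unfold G. destruct Req_EM_T as [E|E]; [reflexivity|].
    unfold F1, F2. f_equal.
    destruct (ind_cases a b c d (- p) q) as [(? & ? & E1)|[? E1]]; rewrite E1; symmetry.
    + apply ind_in; lra.
    + apply ind_out; lra.
  - intros p q _ _. unfold G. destruct Req_EM_T; [rewrite Rminus_diag, Rabs_R0; assumption|apply B].
  - apply (RInt2_edge F1 G a' b' c' d' l M (- a) 0 H5 H6).
    + intros p q _ _ Hp _. unfold G. destruct Req_EM_T; [contradiction|reflexivity].
    + intros p q _ _. unfold G. destruct Req_EM_T; [apply B|rewrite Rminus_diag, Rabs_R0; assumption].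
    + exact K.
Qed.

Lemma rect_int_refly f a b c d l M : a <= b -> c <= d ->
  (forall p q, a <= p <= b -> c <= q <= d -> Rabs (f p q) <= M) ->
  rect_int f a b c d l -> rect_int (fun p q => f p (- q)) a b (- d) (- c) l.
Proof.
  intros Hab Hcd HM Hf. apply rect_int_swap in Hf.
  apply (rect_int_reflx _ _ _ _ _ _ M) in Hf; [|assumption|assumption|intros; apply HM; assumption].
  exact (rect_int_swap _ _ _ _ _ _ Hf).
Qed.

(** Stated for any predicate additive in both directions, as it serves brackets, ordinary integrals
    and singular integrals alike. The counts are successors because [P] need not hold on a
    degenerate rectangle. *)
Lemma grid_add (P : R -> R -> R -> R -> R -> Prop) (x y : nat -> R) (w : nat -> nat -> R) n m :
  (forall a m b c d l1 l2, a <= m -> m <= b -> c <= d ->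
     P a m c d l1 -> P m b c d l2 -> P a b c d (l1 + l2)) ->
  (forall a b c m d l1 l2, a <= b -> c <= m -> m <= d ->
     P a b c m l1 -> P a b m d l2 -> P a b c d (l1 + l2)) ->
  (forall i, x i <= x (S i)) -> (forall i, y i <= y (S i)) ->
  (forall i j, (i < S n)%nat -> (j < S m)%nat -> P (x i) (x (S i)) (y j) (y (S j)) (w i j)) ->
  P (x O) (x (S n)) (y O) (y (S m)) (sum2 (S n) (S m) w).
Proof.
  intros addx addy Hx Hy.
  assert (Mx : forall z, (forall i, z i <= z (S i)) -> forall k, z O <= z k).
  { intros z Hz k; induction k; [lra|eapply Rle_trans; [eassumption|apply Hz]]. }
  assert (Row : forall i m, (forall j, (j < S m)%nat -> P (x i) (x (S i)) (y j) (y (S j)) (w i j)) ->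
     P (x i) (x (S i)) (y O) (y (S m)) (fsum (S m) (w i))).
  { intros i k. induction k as [|k IH]; intros H.
    - simpl. rewrite Rplus_0_l. apply H; lia.
    - change (fsum (S (S k)) (w i)) with (fsum (S k) (w i) + w i (S k)).
      apply (addy _ _ _ (y (S k))); [apply Hx|apply (Mx y Hy)|apply Hy|apply IH; intros; apply H; lia|apply H; lia]. }
  induction n as [|n IH]; intros H.
  - unfold sum2; simpl fsum at 1. rewrite Rplus_0_l. apply Row; intros; apply H; lia.
  - change (sum2 (S (S n)) (S m) w) with (sum2 (S n) (S m) w + fsum (S m) (w (S n))).
    apply (addx _ (x (S n))); [apply (Mx x Hx)|apply Hx|apply (Mx y Hy)|apply IH; intros; apply H; lia|].
    apply Row; intros; apply H; lia.
Qed.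

(** * Darboux brackets and Riemann's oscillation criterion *)

Definition squeezed (f : R -> R -> R) a b c d e : Prop :=
  exists g1 g2 l1 l2, rect_int g1 a b c d l1 /\ rect_int g2 a b c d l2 /\
    (forall p q, a <= p < b -> c <= q < d -> g1 p q <= f p q <= g2 p q) /\ l2 - l1 <= e.

Lemma squeezed_addx f a m b c d x1 x2 : a <= m -> m <= b ->
  squeezed f a m c d x1 -> squeezed f m b c d x2 -> squeezed f a b c d (x1 + x2).
Proof.
  intros H1 H2 (g1 & g2 & l1 & l2 & G1 & G2 & G & L) (g1' & g2' & l1' & l2' & G1' & G2' & G' & L').
  exists (fun p q => if Rlt_dec p m then g1 p q else g1' p q),
         (fun p q => if Rlt_dec p m then g2 p q else g2' p q), (l1 + l1'), (l2 + l2').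
  repeat split.
  - apply (rect_int_addx _ a m b); try assumption.
    + eapply rect_int_ext; [|exact G1]. intros; simpl; destruct Rlt_dec; [reflexivity|lra].
    + eapply rect_int_ext; [|exact G1']. intros; simpl; destruct Rlt_dec; [lra|reflexivity].
  - apply (rect_int_addx _ a m b); try assumption.
    + eapply rect_int_ext; [|exact G2]. intros; simpl; destruct Rlt_dec; [reflexivity|lra].
    + eapply rect_int_ext; [|exact G2']. intros; simpl; destruct Rlt_dec; [lra|reflexivity].
  - destruct Rlt_dec; [apply G; lra|apply G'; lra].
  - destruct Rlt_dec; [apply G; lra|apply G'; lra].
  - lra.
Qed.

Lemma squeezed_swap f a b c d x : squeezed f a b c d x -> squeezed (fun p q => f q p) c d a b x.
Proof.
  intros (g1 & g2 & l1 & l2 & G1 & G2 & G & L).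
  exists (fun p q => g1 q p), (fun p q => g2 q p), l1, l2.
  repeat split; [apply rect_int_swap, G1|apply rect_int_swap, G2| | |exact L]; apply G; lra.
Qed.

Lemma squeezed_addy f a b c m d x1 x2 : c <= m -> m <= d ->
  squeezed f a b c m x1 -> squeezed f a b m d x2 -> squeezed f a b c d (x1 + x2).
Proof.
  intros H1 H2 Hf Hg. apply squeezed_swap in Hf. apply squeezed_swap in Hg.
  exact (squeezed_swap _ _ _ _ _ _ (squeezed_addx _ _ _ _ _ _ _ _ H1 H2 Hf Hg)).
Qed.

(** Darboux's criterion, with arbitrary integrable brackets in the place of step functions so that
    they can be glued along edges. The value is the supremum [l] of the integrals of minorants; it
    depends neither on the bracket nor on the enclosing box, as [rect_int] demands. *)
Lemma squeezed_rect_int f a b c d : (forall eps, 0 < eps -> squeezed f a b c d eps) -> exists l, rect_int f a b c d l.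
Proof.
  intros H.
  set (E := fun z => exists g, rect_int g a b c d z /\
     forall p q, a <= p < b -> c <= q < d -> g p q <= f p q).
  assert (Up : forall g2 l2, rect_int g2 a b c d l2 ->
     (forall p q, a <= p < b -> c <= q < d -> f p q <= g2 p q) -> is_upper_bound E l2).
  { intros g2 l2 H2 Hle z (g & Hg & Hgf). eapply rect_int_le; [|exact Hg|exact H2].
    intros; eapply Rle_trans; [apply Hgf|apply Hle]; assumption. }
  destruct (completeness E) as [l [Hl1 Hl2]].
  - destruct (H 1 ltac:(lra)) as (g1 & g2 & l1 & l2 & G1 & G2 & G & L).
    exists l2. apply (Up g2); [assumption|intros; apply G; assumption].
  - destruct (H 1 ltac:(lra)) as (g1 & g2 & l1 & l2 & G1 & G2 & G & L).
    exists l1, g1. split; [assumption|intros; apply G; assumption].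
  - exists l. intros a' b' c' d' B1 B2 B3 B4 B5 B6.
    apply RInt2_squeeze; [lra|lra|]. intros eps He.
    destruct (H eps He) as (g1 & g2 & l1 & l2 & G1 & G2 & G & L).
    assert (l1 <= l) by (apply Hl1; exists g1; split; [assumption|intros; apply G; assumption]).
    assert (l <= l2) by (apply Hl2, (Up g2); [assumption|intros; apply G; assumption]).
    do 4 eexists. split; [apply G1; assumption|]. split; [apply G2; assumption|]. split; [|lra].
    intros p q _ _; simpl.
    destruct (ind_cases a b c d p q) as [(? & ? & E')|[? E']]; rewrite E'; [|lra].
    specialize (G p q ltac:(lra) ltac:(lra)); lra.
Qed.

(** Unlike monotonicity this condition is stable under products, where the bound [B] is used. [o]
    may be any majorant of the oscillation on a cell, which avoids suprema. *)
Definition osc_integrable (f : R -> R -> R) a b c d : Prop :=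
  (exists B, forall p q, a <= p <= b -> c <= q <= d -> Rabs (f p q) <= B) /\
  forall eps, 0 < eps -> exists N, forall n, (N <= n)%nat -> (0 < n)%nat ->
    exists o : nat -> nat -> R,
      (forall i j p q p' q', (i < n)%nat -> (j < n)%nat ->
        node a b n i <= p <= node a b n (S i) -> node c d n j <= q <= node c d n (S j) ->
        node a b n i <= p' <= node a b n (S i) -> node c d n j <= q' <= node c d n (S j) ->
        Rabs (f p q - f p' q') <= o i j) /\
      sum2 n n o * ((b - a) / INR n * ((d - c) / INR n)) <= eps.

Lemma osc_integrable_rect_int f a b c d : a <= b -> c <= d -> osc_integrable f a b c d -> exists l, rect_int f a b c d l.
Proof.
  intros Hab Hcd [_ H]. apply squeezed_rect_int. intros eps He.
  destruct (H (eps / 2) ltac:(lra)) as [N HN].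
  destruct (HN (S N) ltac:(lia) ltac:(lia)) as (o & Ho & Hs). clear HN.
  set (dx := (b - a) / INR (S N)) in *. set (dy := (d - c) / INR (S N)) in *.
  assert (Hdx : 0 <= dx) by (apply step_nonneg; assumption).
  assert (Hdy : 0 <= dy) by (apply step_nonneg; assumption).
  assert (G : squeezed f (node a b (S N) 0) (node a b (S N) (S N)) (node c d (S N) 0)
     (node c d (S N) (S N)) (sum2 (S N) (S N) (fun i j => 2 * (dx * dy) * o i j))).
  { apply grid_add.
    - intros; eapply squeezed_addx; eassumption.
    - intros; eapply squeezed_addy; eassumption.
    - intros; apply node_mono; [assumption|lia].
    - intros; apply node_mono; [assumption|lia].
    - intros i j Hi Hj.
      set (x := node a b (S N) i). set (y := node c d (S N) j).
      assert (Ex : node a b (S N) (S i) = x + dx) by apply node_S.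
      assert (Ey : node c d (S N) (S j) = y + dy) by apply node_S.
      (* On each cell the corner value plus or minus the oscillation is a bracket; its width
         [2 * o i j] is why the criterion was invoked with [eps / 2]. *)
      exists (fun _ _ => f x y - o i j), (fun _ _ => f x y + o i j).
      do 2 eexists. split; [apply rect_int_const; lra|]. split; [apply rect_int_const; lra|]. split.
      + intros p q Hp Hq.
        pose proof (Ho i j p q x y Hi Hj) as K. fold x y in K.
        rewrite Ex in *. rewrite Ey in *.
        specialize (K ltac:(lra) ltac:(lra) ltac:(lra) ltac:(lra)).
        apply Rabs_le_inv in K. lra.
      + rewrite Ex, Ey. right; ring. }
  rewrite !node_0, !node_n in G by lia.
  destruct G as (g1 & g2 & l1 & l2 & G1 & G2 & G & L).
  exists g1, g2, l1, l2. repeat split; try assumption; try (apply G; assumption).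
  rewrite sum2_scal in L. nra.
Qed.

Lemma osc_integrable_ext f g a b c d :
  (forall p q, a <= p <= b -> c <= q <= d -> f p q = g p q) -> a <= b -> c <= d ->
  osc_integrable f a b c d -> osc_integrable g a b c d.
Proof.
  intros E Hab Hcd [[B HB] H]. split.
  - exists B; intros; rewrite <- E by assumption; auto.
  - intros eps He. destruct (H eps He) as [N HN]. exists N; intros n Hn Hn0.
    destruct (HN n Hn Hn0) as (o & Ho & Hs). exists o; split; [|assumption].
    intros i j p q p' q' Hi Hj P Q P' Q'.
    pose proof (node_bound a b n i Hab Hn0 ltac:(lia)).
    pose proof (node_bound a b n (S i) Hab Hn0 ltac:(lia)).
    pose proof (node_bound c d n j Hcd Hn0 ltac:(lia)).
    pose proof (node_bound c d n (S j) Hcd Hn0 ltac:(lia)).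
    rewrite <- !E by lra. apply Ho; assumption.
Qed.

Lemma osc_integrable_mult f g a b c d : a <= b -> c <= d ->
  osc_integrable f a b c d -> osc_integrable g a b c d -> osc_integrable (fun p q => f p q * g p q) a b c d.
Proof.
  intros Hab Hcd [[B HB] H] [[C HC] H'].
  assert (HB0 : 0 <= B) by (eapply Rle_trans; [apply Rabs_pos|apply (HB a c); lra]).
  assert (HC0 : 0 <= C) by (eapply Rle_trans; [apply Rabs_pos|apply (HC a c); lra]).
  split.
  - exists (B * C); intros. rewrite Rabs_mult.
    apply Rmult_le_compat; auto using Rabs_pos.
  - intros eps He. set (e := eps / (B + C + 1)).
    assert (He' : 0 < e) by (apply Rdiv_lt_0_compat; lra).
    destruct (H e He') as [N1 HN1]. destruct (H' e He') as [N2 HN2].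
    exists (max N1 N2); intros n Hn Hn0.
    destruct (HN1 n ltac:(lia) Hn0) as (o1 & Ho1 & Hs1).
    destruct (HN2 n ltac:(lia) Hn0) as (o2 & Ho2 & Hs2).
    exists (fun i j => B * o2 i j + C * o1 i j). split.
    + intros i j p q p' q' Hi Hj P Q P' Q'.
      pose proof (node_bound a b n i Hab Hn0 ltac:(lia)).
      pose proof (node_bound a b n (S i) Hab Hn0 ltac:(lia)).
      pose proof (node_bound c d n j Hcd Hn0 ltac:(lia)).
      pose proof (node_bound c d n (S j) Hcd Hn0 ltac:(lia)).
      specialize (Ho1 i j p q p' q' Hi Hj P Q P' Q').
      specialize (Ho2 i j p q p' q' Hi Hj P Q P' Q').
      specialize (HB p q ltac:(lra) ltac:(lra)). specialize (HC p' q' ltac:(lra) ltac:(lra)).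
      replace (f p q * g p q - f p' q' * g p' q') with
        (f p q * (g p q - g p' q') + (f p q - f p' q') * g p' q') by ring.
      eapply Rle_trans; [apply Rabs_triang|]. rewrite !Rabs_mult.
      pose proof (Rabs_pos (f p q)). pose proof (Rabs_pos (g p q - g p' q')).
      pose proof (Rabs_pos (g p' q')). pose proof (Rabs_pos (f p q - f p' q')). nra.
    + rewrite sum2_plus, !sum2_scal.
      set (A := (b - a) / INR n * ((d - c) / INR n)) in *.
      replace eps with (e * (B + C + 1)) by (unfold e; field; lra). nra.
Qed.

(** The oscillation on a cell is at most its horizontal plus its vertical increment. Along each row
    or column these telescope to at most [M], so the total is at most [2 n M], against a cell area
    of order [1/n^2]. *)
Lemma osc_integrable_mono f a b c d : a <= b -> c <= d ->
  (forall p q p' q', a <= p -> p <= p' -> p' <= b -> c <= q -> q <= q' -> q' <= d ->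
     f p q <= f p' q') -> osc_integrable f a b c d.
Proof.
  intros Hab Hcd H. split.
  - exists (Rabs (f a c) + Rabs (f b d)). intros p q Hp Hq.
    assert (f a c <= f p q) by (apply H; lra). assert (f p q <= f b d) by (apply H; lra).
    revert H0 H1. unfold Rabs; repeat destruct Rcase_abs; lra.
  - intros eps He. set (M := f b d - f a c).
    destruct (arch_div (2 * M * (b - a) * (d - c)) eps He) as [N [_ HN]].
    exists N. intros n Hn Hn0. specialize (HN n Hn).
    set (x := node a b n). set (y := node c d n).
    assert (Hx : forall i, (i <= n)%nat -> a <= x i <= b) by (intros; apply node_bound; assumption).
    assert (Hy : forall i, (i <= n)%nat -> c <= y i <= d) by (intros; apply node_bound; assumption).
    assert (Hx' : forall i, x i <= x (S i)) by (intros; apply node_mono; [assumption|lia]).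
    assert (Hy' : forall i, y i <= y (S i)) by (intros; apply node_mono; [assumption|lia]).
    exists (fun i j => (f (x (S i)) (y (S j)) - f (x i) (y (S j))) + (f (x i) (y (S j)) - f (x i) (y j))).
    split.
    + intros i j p q p' q' Hi Hj P Q P' Q'. fold (x i) (x (S i)) in P, P'. fold (y j) (y (S j)) in Q, Q'.
      pose proof (Hx i ltac:(lia)). pose proof (Hx (S i) ltac:(lia)).
      pose proof (Hy j ltac:(lia)). pose proof (Hy (S j) ltac:(lia)).
      assert (f (x i) (y j) <= f p q) by (apply H; lra).
      assert (f p q <= f (x (S i)) (y (S j))) by (apply H; lra).
      assert (f (x i) (y j) <= f p' q') by (apply H; lra).
      assert (f p' q' <= f (x (S i)) (y (S j))) by (apply H; lra).
      apply Rabs_le; lra.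
    + assert (S1 : sum2 n n (fun i j => f (x (S i)) (y (S j)) - f (x i) (y (S j))) <= INR n * M).
      { rewrite sum2_swap. unfold sum2. rewrite <- fsum_const. apply fsum_le; intros j Hj.
        rewrite (fsum_tele n (fun i => f (x i) (y (S j)))). unfold M.
        pose proof (Hy (S j) ltac:(lia)). pose proof (Hx n ltac:(lia)). pose proof (Hx O ltac:(lia)).
        assert (f (x n) (y (S j)) <= f b d) by (apply H; lra).
        assert (f a c <= f (x O) (y (S j))) by (apply H; lra). lra. }
      assert (S2 : sum2 n n (fun i j => f (x i) (y (S j)) - f (x i) (y j)) <= INR n * M).
      { unfold sum2. rewrite <- fsum_const. apply fsum_le; intros i Hi.
        rewrite (fsum_tele n (fun j => f (x i) (y j))). unfold M.
        pose proof (Hx i ltac:(lia)). pose proof (Hy n ltac:(lia)). pose proof (Hy O ltac:(lia)).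
        assert (f (x i) (y n) <= f b d) by (apply H; lra).
        assert (f a c <= f (x i) (y O)) by (apply H; lra). lra. }
      rewrite sum2_plus.
      set (A := (b - a) / INR n * ((d - c) / INR n)).
      assert (HA : 0 <= A) by (apply Rmult_le_pos; apply step_nonneg; assumption).
      apply Rle_trans with (2 * (INR n * M) * A); [nra|].
      left. eapply Rle_lt_trans; [|exact HN]. right. unfold A. field. apply not_0_INR; lia.
Qed.

Lemma osc_integrable_anti f a b c d : a <= b -> c <= d ->
  (forall p q p' q', a <= p -> p <= p' -> p' <= b -> c <= q -> q <= q' -> q' <= d ->
     f p' q' <= f p q) -> osc_integrable f a b c d.
Proof.
  intros Hab Hcd H. apply osc_integrable_ext with (fun p q => (fun _ _ => -1) p q * (- f p q)); try assumption.
  - intros; ring.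
  - apply osc_integrable_mult; try assumption; apply osc_integrable_mono; try assumption; intros; try lra.
    apply Ropp_le_contravar, H; assumption.
Qed.

Lemma osc_integrable_uc f a b c d : a <= b -> c <= d ->
  (exists B, forall p q, a <= p <= b -> c <= q <= d -> Rabs (f p q) <= B) ->
  (forall eps, 0 < eps -> exists dl, 0 < dl /\ forall p q p' q',
     a <= p <= b -> c <= q <= d -> a <= p' <= b -> c <= q' <= d ->
     Rabs (p - p') <= dl -> Rabs (q - q') <= dl -> Rabs (f p q - f p' q') <= eps) ->
  osc_integrable f a b c d.
Proof.
  intros Hab Hcd HB H. split; [assumption|]. intros eps He.
  set (A := (b - a) * (d - c)). assert (HA : 0 <= A) by (unfold A; nra).
  destruct (H (eps / (A + 1))) as (dl & Hdl & Hf); [apply Rdiv_lt_0_compat; lra|].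
  destruct (arch_div ((b - a) + (d - c)) dl Hdl) as [N [_ HN]].
  exists N; intros n Hn Hn0. exists (fun _ _ => eps / (A + 1)). specialize (HN n Hn).
  assert (Hn' : 0 < INR n) by (apply lt_0_INR; assumption).
  split.
  - intros i j p q p' q' Hi Hj P Q P' Q'.
    pose proof (node_bound a b n i Hab Hn0 ltac:(lia)).
    pose proof (node_bound a b n (S i) Hab Hn0 ltac:(lia)).
    pose proof (node_bound c d n j Hcd Hn0 ltac:(lia)).
    pose proof (node_bound c d n (S j) Hcd Hn0 ltac:(lia)).
    rewrite node_S in *.
    pose proof (step_nonneg a b n Hab). pose proof (step_nonneg c d n Hcd).
    replace ((b - a + (d - c)) / INR n) with ((b - a) / INR n + (d - c) / INR n) in HN
      by (field; lra).
    apply Hf; try lra; apply Rabs_le; lra.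
  - rewrite sum2_const.
    set (e := eps / (A + 1)).
    replace (INR n * (INR n * e) * ((b - a) / INR n * ((d - c) / INR n)))
      with (A * e) by (unfold A; field; lra).
    unfold e.
    apply Rmult_le_reg_r with (A + 1); [lra|].
    replace (A * (eps / (A + 1)) * (A + 1)) with (A * eps) by (field; lra). nra.
Qed.

(** * Power weights and singular integrals *)

Lemma Rpower_pos x a : 0 < Rpower x a.
Proof. apply exp_pos. Qed.

Lemma nrm_sqr p q : nrm p q * nrm p q = p * p + q * q.
Proof. unfold nrm. apply sqrt_sqrt. nra. Qed.

Lemma nrm_nonneg p q : 0 <= nrm p q.
Proof. apply sqrt_pos. Qed.

Lemma nrm_ge p q x : 0 <= x -> x * x <= p * p + q * q -> x <= nrm p q.
Proof.
  intros H1 H2. rewrite <- (nrm_sqr p q) in H2. pose proof (nrm_nonneg p q).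
  apply Rnot_lt_le; intros H3. nra.
Qed.

Lemma nrm_le p q x : 0 <= x -> p * p + q * q <= x * x -> nrm p q <= x.
Proof.
  intros H1 H2. rewrite <- (nrm_sqr p q) in H2. pose proof (nrm_nonneg p q).
  apply Rnot_lt_le; intros H3. nra.
Qed.

Lemma Rmax_le_nrm p q : 0 <= p -> 0 <= q -> Rmax p q <= nrm p q.
Proof. intros; apply nrm_ge; unfold Rmax; destruct Rle_dec; nra. Qed.

Lemma nrm_le_Rmax p q : 0 <= p -> 0 <= q -> nrm p q <= 2 * Rmax p q.
Proof. intros; apply nrm_le; unfold Rmax; destruct Rle_dec; nra. Qed.

Lemma nrm_mono p q p' q' : 0 <= p -> 0 <= q -> p <= p' -> q <= q' -> nrm p q <= nrm p' q'.
Proof. intros; apply nrm_ge; [apply nrm_nonneg|]. rewrite nrm_sqr. nra. Qed.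

Lemma Rpower_le x y a : 0 <= a -> 0 < x -> x <= y -> Rpower x a <= Rpower y a.
Proof. intros; apply Rle_Rpower_l; lra. Qed.

Lemma Rpower_anti x y a : 0 <= a -> 0 < x -> x <= y -> Rpower y (- a) <= Rpower x (- a).
Proof.
  intros. rewrite !Rpower_Ropp. apply Rinv_le_contravar; [apply Rpower_pos|].
  apply Rpower_le; assumption.
Qed.

Lemma Rpower_scale r x a i : 0 < r -> 0 < x ->
  Rpower (r * x ^ i) a = Rpower r a * (Rpower x a) ^ i.
Proof.
  intros Hr Hx. rewrite <- Rpower_mult_distr by (try apply pow_lt; assumption). f_equal.
  rewrite <- !Rpower_pow by (try apply Rpower_pos; assumption).
  rewrite !Rpower_mult. f_equal; ring.
Qed.

Lemma Rpower_lt_1 x a : 1 < x -> a < 0 -> Rpower x a < 1.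
Proof.
  intros. rewrite <- (Rpower_O x) by lra. apply Rpower_lt; assumption.
Qed.

Lemma Rpower_small a eps : 0 < a -> 0 < eps ->
  exists d, 0 < d /\ forall x, 0 < x -> x <= d -> Rpower x a <= eps.
Proof.
  intros Ha He. exists (Rpower eps (/ a)). split; [apply Rpower_pos|].
  intros x Hx Hxd. replace eps with (Rpower (Rpower eps (/ a)) a).
  - apply Rpower_le; lra.
  - rewrite Rpower_mult, Rinv_l by lra. apply Rpower_1; assumption.
Qed.

Lemma geom_bound x n : 0 <= x < 1 -> fsum n (fun i => x ^ i) <= / (1 - x).
Proof.
  intros Hx. assert (E : fsum n (fun i => x ^ i) * (1 - x) = 1 - x ^ n).
  { induction n as [|n IH]; simpl; [ring|]. rewrite Rmult_plus_distr_r, IH; ring. }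
  assert (0 <= x ^ n) by (apply pow_le; lra).
  apply Rmult_le_reg_r with (1 - x); [lra|]. rewrite E, Rinv_l by lra. lra.
Qed.

Lemma fsum_nonneg n f : (forall i, (i < n)%nat -> 0 <= f i) -> 0 <= fsum n f.
Proof.
  intros H. apply Rle_trans with (fsum n (fun _ => 0)); [rewrite fsum_const; lra|].
  apply fsum_le; assumption.
Qed.

Lemma fsum_single n i f : (i < n)%nat -> (forall j, 0 <= f j) -> f i <= fsum n f.
Proof.
  intros Hi Hf. induction n as [|n IH]; [lia|]. simpl.
  assert (0 <= fsum n f).
  { apply fsum_nonneg; intros; apply Hf. }
  pose proof (Hf n). destruct (Nat.eq_dec i n) as [->|]; [lra|]. specialize (IH ltac:(lia)). lra.
Qed.

(** * Dyadic bounds for integrals of power kernels *)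

Lemma rect_int_fsum n (f : nat -> R -> R -> R) a b c d (l : nat -> R) :
  (forall i, (i < n)%nat -> rect_int (f i) a b c d (l i)) ->
  rect_int (fun p q => fsum n (fun i => f i p q)) a b c d (fsum n l).
Proof.
  induction n as [|n IH]; intros H; simpl; [apply rect_int_zero|].
  apply rect_int_plus; [apply IH; intros|]; apply H; lia.
Qed.

Lemma rect_int_abs_le f g a b c d l m :
  (forall p q, a <= p < b -> c <= q < d -> Rabs (f p q) <= g p q) ->
  rect_int f a b c d l -> rect_int g a b c d m -> Rabs l <= m.
Proof.
  intros H Hf Hg. apply Rabs_le. split.
  - replace (- m) with (-1 * m) by ring.
    eapply rect_int_le; [|apply (rect_int_scal (-1)), Hg|exact Hf].
    intros p q Hp Hq. specialize (H p q Hp Hq). apply Rabs_le_inv in H. lra.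
  - eapply rect_int_le; [|exact Hf|exact Hg].
    intros p q Hp Hq. specialize (H p q Hp Hq). apply Rabs_le_inv in H. lra.
Qed.

(** Full squares [[0, r i)^2] are used where annuli would be natural: they are rectangles of known
    integral, and the overlap costs only a constant factor. *)
Lemma shell_bound f a b c d l n (k r : nat -> R) : 0 <= a -> 0 <= c ->
  rect_int f a b c d l -> (forall i, 0 <= r i) -> (forall i, 0 <= k i) ->
  (forall p q, a <= p < b -> c <= q < d ->
     Rabs (f p q) <= fsum n (fun i => k i * ind 0 (r i) 0 (r i) p q)) ->
  Rabs l <= fsum n (fun i => k i * (r i * r i)).
Proof.
  intros Ha Hc Hf Hr Hk H.
  assert (HX : exists X, b <= X /\ d <= X /\ forall i, (i < n)%nat -> r i <= X).
  { clear H. induction n as [|n (X & H1 & H2 & H3)].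
    - exists (Rmax b d). split; [apply Rmax_l|split; [apply Rmax_r|intros; lia]].
    - exists (Rmax X (r n)). pose proof (Rmax_l X (r n)). pose proof (Rmax_r X (r n)).
      repeat split; try lra. intros i Hi.
      destruct (Nat.eq_dec i n) as [->|]; [assumption|]. specialize (H3 i ltac:(lia)); lra. }
  destruct HX as (X & H1 & H2 & H3).
  apply (rect_int_sub f a b c d 0 X 0 X) in Hf; try lra.
  refine (rect_int_abs_le _ _ 0 X 0 X _ _ _ Hf (rect_int_fsum n (fun i p q => k i * ind 0 (r i) 0 (r i) p q) 0 X 0 X (fun i => k i * (r i * r i)) _)).
  2:{ intros i Hi. specialize (H3 i Hi). specialize (Hr i). apply rect_int_scal.
      replace (r i * r i) with (1 * ((r i - 0) * (r i - 0))) by ring.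
      apply (rect_int_ext (fun p q => ind 0 (r i) 0 (r i) p q * (fun _ _ => 1) p q)); [intros p q _ _; apply Rmult_1_r|].
      apply rect_int_sub; try lra. apply rect_int_const; lra. }
  intros p q Hp Hq. destruct (ind_cases a b c d p q) as [(? & ? & E)|[? E]]; rewrite E.
  - rewrite Rmult_1_l. apply H; lra.
  - rewrite Rmult_0_l, Rabs_R0. apply fsum_nonneg; intros i Hi.
    apply Rmult_le_pos; [apply Hk|].
    destruct (ind_cases 0 (r i) 0 (r i) p q) as [(? & ? & E')|[? E']]; rewrite E'; lra.
Qed.

Definition ker (s p q : R) : R := Rpower (nrm p q) (- s).

Lemma ker_pos s p q : 0 < ker s p q.
Proof. apply Rpower_pos. Qed.

Lemma ker_le s p q x : 0 <= s -> 0 < x -> x <= nrm p q -> ker s p q <= Rpower x (- s).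
Proof. intros; apply Rpower_anti; assumption. Qed.

Lemma dyadic_up r m n : 0 < r -> r <= m -> m < r * 2 ^ n ->
  exists i, (i < n)%nat /\ r * 2 ^ i <= m < r * 2 ^ (S i).
Proof.
  intros Hr H1 H2. induction n as [|n IH]; [simpl in H2; lra|].
  destruct (Rlt_le_dec m (r * 2 ^ n)) as [H|H].
  - destruct (IH H) as (i & ? & ?). exists i; split; [lia|assumption].
  - exists n; split; [lia|split; assumption].
Qed.

Lemma dyadic_down r m n : 0 < r -> m < r -> r * (/ 2) ^ n <= m ->
  exists i, (i < n)%nat /\ r * (/ 2) ^ (S i) <= m < r * (/ 2) ^ i.
Proof.
  intros Hr H1 H2. induction n as [|n IH]; [simpl in H2; lra|].
  destruct (Rlt_le_dec m (r * (/ 2) ^ n)) as [H|H].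
  - exists n; split; [lia|split; assumption].
  - destruct (IH H) as (i & ? & ?). exists i; split; [lia|assumption].
Qed.

(** On the shell where the max norm lies between [r 2^i] and [r 2^(i+1)] the kernel is at most
    [(r 2^i)^(-s)] and the enclosing square has area [4 (r 2^i)^2]. The contributions are geometric
    with ratio [2^(2-s) < 1], so the bound does not depend on the rectangle, which only decides how
    many shells occur. *)
Lemma far_bound s : 2 < s -> exists C, 0 <= C /\ forall f a b c d l K r,
  0 <= a -> 0 <= c -> 0 < r -> 0 <= K -> rect_int f a b c d l ->
  (forall p q, a <= p < b -> c <= q < d -> r <= Rmax p q -> Rabs (f p q) <= K * ker s p q) ->
  (forall p q, a <= p < b -> c <= q < d -> Rmax p q < r -> f p q = 0) ->
  Rabs l <= K * C * Rpower r (2 - s).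
Proof.
  intros Hs. set (x := Rpower 2 (2 - s)).
  assert (Hx : 0 <= x < 1) by (split; [left; apply Rpower_pos|apply Rpower_lt_1; lra]).
  exists (4 * / (1 - x)). split.
  { apply Rmult_le_pos; [lra|]. left; apply Rinv_0_lt_compat; lra. }
  intros f a b c d l K r Ha Hc Hr HK Hf H1 H2.
  destruct (Pow_x_infinity 2 ltac:(rewrite Rabs_pos_eq; lra) (Rmax b d / r)) as [n Hn].
  specialize (Hn n (le_n n)). rewrite Rabs_pos_eq in Hn by (apply pow_le; lra).
  assert (Hbd : Rmax b d <= r * 2 ^ n).
  { apply Rge_le in Hn. apply Rmult_le_compat_l with (r := r) in Hn; [|lra].
    replace (r * (Rmax b d / r)) with (Rmax b d) in Hn by (field; lra). assumption. }
  assert (P2 : forall i, 0 < r * 2 ^ i) by (intros; apply Rmult_lt_0_compat; [assumption|apply pow_lt; lra]).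
  eapply Rle_trans; [apply (shell_bound f a b c d l n (fun i => K * Rpower (r * 2 ^ i) (- s))
     (fun i => r * 2 ^ (S i)) Ha Hc Hf)|].
  - intros; left; apply P2.
  - intros; apply Rmult_le_pos; [assumption|left; apply Rpower_pos].
  - intros p q Hp Hq. set (g := fun i : nat => _).
    assert (Hg : forall i, 0 <= g i).
    { intros i; unfold g. apply Rmult_le_pos; [apply Rmult_le_pos; [assumption|left; apply Rpower_pos]|].
      destruct (ind_cases 0 (r * 2 ^ S i) 0 (r * 2 ^ S i) p q) as [(? & ? & E')|[? E']]; rewrite E'; lra. }
    destruct (Rlt_le_dec (Rmax p q) r) as [Hlt|Hge].
    + rewrite H2 by assumption. rewrite Rabs_R0. apply fsum_nonneg; intros; apply Hg.
    + destruct (dyadic_up r (Rmax p q) n Hr Hge) as (i & Hi & Hm1 & Hm2).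
      { unfold Rmax in *; repeat destruct Rle_dec; lra. }
      eapply Rle_trans; [|apply (fsum_single n i g Hi Hg)].
      unfold g. pose proof (Rmax_l p q). pose proof (Rmax_r p q). rewrite ind_in by lra. rewrite Rmult_1_r.
      eapply Rle_trans; [apply H1; assumption|]. apply Rmult_le_compat_l; [assumption|].
      apply ker_le; [lra|apply P2|]. eapply Rle_trans; [exact Hm1|apply Rmax_le_nrm; lra].
  - rewrite (fsum_ext n _ (fun i => (4 * K * Rpower r (2 - s)) * x ^ i)).
    + rewrite fsum_scal. pose proof (geom_bound x n Hx).
      replace (K * (4 * / (1 - x)) * Rpower r (2 - s)) with (4 * K * Rpower r (2 - s) * / (1 - x)) by ring.
      apply Rmult_le_compat_l; [|assumption].
      pose proof (Rpower_pos r (2 - s)). nra.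
    + intros i _. unfold x. rewrite (Rmult_assoc (4 * K)), <- Rpower_scale by lra.
      replace (2 - s) with (- s + INR 2) by (simpl; ring). rewrite Rpower_plus, Rpower_pow by apply P2.
      simpl; ring.
Qed.

(** The same shells going inward, with ratio [2^(s-2) < 1]; the factor [(1/2)^(-s)] appears because
    the kernel is estimated at the inner edge of a shell. [eta] keeps the number of shells finite
    while the constant is independent of it, which is what makes shrinking excisions a Cauchy
    family. *)
Lemma near_bound s : 0 <= s < 2 -> exists C, 0 <= C /\ forall f a b c d l K r eta,
  0 <= a -> 0 <= c -> 0 < r -> 0 <= K -> 0 < eta -> rect_int f a b c d l ->
  (forall p q, a <= p < b -> c <= q < d -> eta <= Rmax p q < r -> Rabs (f p q) <= K * ker s p q) ->
  (forall p q, a <= p < b -> c <= q < d -> ~ (eta <= Rmax p q < r) -> f p q = 0) ->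
  Rabs l <= K * C * Rpower r (2 - s).
Proof.
  intros Hs. set (x := Rpower (/ 2) (2 - s)).
  assert (Hx : 0 <= x < 1).
  { split; [left; apply Rpower_pos|]. unfold x, Rpower. rewrite ln_Rinv by lra.
    rewrite <- exp_0. apply exp_increasing. pose proof (ln_lt_2). nra. }
  exists (Rpower (/ 2) (- s) * / (1 - x)). split.
  { apply Rmult_le_pos; [left; apply Rpower_pos|]. left; apply Rinv_0_lt_compat; lra. }
  intros f a b c d l K r eta Ha Hc Hr HK Heta Hf H1 H2.
  destruct (pow_lt_1_zero (/ 2) ltac:(rewrite Rabs_pos_eq; lra) (eta / r)) as [n Hn].
  { apply Rdiv_lt_0_compat; assumption. }
  specialize (Hn n (le_n n)). rewrite Rabs_pos_eq in Hn by (apply pow_le; lra).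
  assert (Hbd : r * (/ 2) ^ n <= eta).
  { apply Rmult_lt_compat_l with (r := r) in Hn; [|lra].
    replace (r * (eta / r)) with eta in Hn by (field; lra). lra. }
  assert (P2 : forall i, 0 < r * (/ 2) ^ i) by (intros; apply Rmult_lt_0_compat; [assumption|apply pow_lt; lra]).
  eapply Rle_trans; [apply (shell_bound f a b c d l n (fun i => K * Rpower (r * (/ 2) ^ (S i)) (- s))
     (fun i => r * (/ 2) ^ i) Ha Hc Hf)|].
  - intros; left; apply P2.
  - intros; apply Rmult_le_pos; [assumption|left; apply Rpower_pos].
  - intros p q Hp Hq. set (g := fun i : nat => _).
    assert (Hg : forall i, 0 <= g i).
    { intros i; unfold g. apply Rmult_le_pos; [apply Rmult_le_pos; [assumption|left; apply Rpower_pos]|].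
      destruct (ind_cases 0 (r * (/ 2) ^ i) 0 (r * (/ 2) ^ i) p q) as [(? & ? & E')|[? E']]; rewrite E'; lra. }
    destruct (Rlt_le_dec (Rmax p q) r) as [Hlt|Hge]; [destruct (Rle_lt_dec eta (Rmax p q)) as [Hge|Hlt']|].
    + destruct (dyadic_down r (Rmax p q) n Hr Hlt) as (i & Hi & Hm1 & Hm2); [lra|].
      eapply Rle_trans; [|apply (fsum_single n i g Hi Hg)].
      unfold g. pose proof (Rmax_l p q). pose proof (Rmax_r p q). rewrite ind_in by lra. rewrite Rmult_1_r.
      eapply Rle_trans; [apply H1; try assumption; lra|]. apply Rmult_le_compat_l; [assumption|].
      apply ker_le; [lra|apply P2|]. eapply Rle_trans; [exact Hm1|apply Rmax_le_nrm; lra].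
    + rewrite H2 by (try assumption; lra). rewrite Rabs_R0. apply fsum_nonneg; intros; apply Hg.
    + rewrite H2 by (try assumption; lra). rewrite Rabs_R0. apply fsum_nonneg; intros; apply Hg.
  - rewrite (fsum_ext n _ (fun i => (K * Rpower (/ 2) (- s) * Rpower r (2 - s)) * x ^ i)).
    + rewrite fsum_scal. pose proof (geom_bound x n Hx).
      replace (K * (Rpower (/ 2) (- s) * / (1 - x)) * Rpower r (2 - s)) with
        (K * Rpower (/ 2) (- s) * Rpower r (2 - s) * / (1 - x)) by ring.
      apply Rmult_le_compat_l; [|assumption].
      pose proof (Rpower_pos r (2 - s)). pose proof (Rpower_pos (/ 2) (- s)).
      assert (0 <= K * Rpower (/ 2) (- s)) by nra. nra.
    + intros i _. unfold x. rewrite (Rmult_assoc (K * _)), <- Rpower_scale by lra.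
      replace (r * (/ 2) ^ S i) with (/ 2 * (r * (/ 2) ^ i)) by (simpl; ring).
      rewrite <- Rpower_mult_distr by (try apply P2; lra).
      replace (2 - s) with (- s + INR 2) by (simpl; ring). rewrite Rpower_plus, Rpower_pow by apply P2.
      simpl; ring.
Qed.

(** * Integrals with a shrinking excised disc *)

Definition cut (dl : R) (f : R -> R -> R) (p q : R) : R :=
  if Rlt_dec dl (nrm p q) then f p q else 0.

(** On the quadrant the indicator of the complement of the disc is monotone. Replacing the norm by
    [Rmax dl (nrm p q)] changes nothing where the indicator is 1 and makes the power antitone up to
    the origin, so three integrable factors remain. *)
Lemma osc_integrable_cut_ker dl g s a b c d : 0 < dl -> 0 <= s -> 0 <= a -> a <= b -> 0 <= c -> c <= d ->
  osc_integrable g a b c d -> osc_integrable (cut dl (fun p q => g p q * ker s p q)) a b c d.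
Proof.
  intros Hdl Hs Ha Hab Hc Hcd Hg.
  apply osc_integrable_ext with (fun p q => g p q * (cut dl (fun _ _ => 1) p q *
     Rpower (Rmax dl (nrm p q)) (- s))); try assumption.
  - intros p q Hp Hq. unfold cut, ker. destruct Rlt_dec as [H|H].
    + rewrite Rmax_right by lra. ring.
    + ring.
  - apply osc_integrable_mult; try assumption. apply osc_integrable_mult; try assumption.
    + apply osc_integrable_mono; try assumption. intros p q p' q' H1 H2 H3 H4 H5 H6.
      pose proof (nrm_mono p q p' q' ltac:(lra) ltac:(lra) H2 H5).
      unfold cut; repeat destruct Rlt_dec; lra.
    + apply osc_integrable_anti; try assumption. intros p q p' q' H1 H2 H3 H4 H5 H6.
      pose proof (nrm_mono p q p' q' ltac:(lra) ltac:(lra) H2 H5).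
      apply Rpower_anti; [assumption|unfold Rmax; destruct Rle_dec; lra|].
      apply Rle_max_compat_l; assumption.
Qed.

(** Cauchy completeness for a relation, since integrals are given as relations. [E] collects the
    eventual lower bounds, so its supremum is the limit inferior. *)
Lemma limit_at_0 (V : R -> R -> Prop) :
  (forall dl, 0 < dl -> exists v, V dl v) ->
  (forall eps, 0 < eps -> exists d0, 0 < d0 /\ forall dl dl' v v', 0 < dl < d0 -> 0 < dl' < d0 ->
     V dl v -> V dl' v' -> Rabs (v - v') <= eps) ->
  exists l, forall eps, 0 < eps -> exists d0, 0 < d0 /\ forall dl v, 0 < dl < d0 -> V dl v ->
     Rabs (v - l) < eps.
Proof.
  intros Hex HC.
  set (E := fun z => exists d0, 0 < d0 /\ forall dl v, 0 < dl < d0 -> V dl v -> z <= v).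
  assert (K : forall eps, 0 < eps -> exists d0, 0 < d0 /\ forall dl v, 0 < dl < d0 -> V dl v ->
     E (v - eps) /\ is_upper_bound E (v + eps)).
  { intros eps He. destruct (HC eps He) as (d0 & Hd0 & H). exists d0; split; [assumption|].
    intros dl v Hdl Hv. split.
    - exists d0; split; [assumption|]. intros dl' v' Hdl' Hv'.
      specialize (H dl dl' v v' Hdl Hdl' Hv Hv'). apply Rabs_le_inv in H; lra.
    - intros z (d1 & Hd1 & Hz). set (t := Rmin d0 d1 / 2).
      assert (Ht : 0 < t < d0 /\ t < d1) by (unfold t, Rmin; destruct Rle_dec; lra).
      destruct (Hex t ltac:(lra)) as [v' Hv']. specialize (Hz t v' ltac:(lra) Hv').
      specialize (H dl t v v' Hdl ltac:(lra) Hv Hv'). apply Rabs_le_inv in H; lra. }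
  destruct (completeness E) as [l [Hl1 Hl2]].
  - destruct (K 1 ltac:(lra)) as (d0 & Hd0 & H). destruct (Hex (d0 / 2) ltac:(lra)) as [v Hv].
    exists (v + 1). apply (H (d0 / 2)); [lra|assumption].
  - destruct (K 1 ltac:(lra)) as (d0 & Hd0 & H). destruct (Hex (d0 / 2) ltac:(lra)) as [v Hv].
    exists (v - 1). apply (H (d0 / 2)); [lra|assumption].
  - exists l. intros eps He. destruct (K (eps / 2) ltac:(lra)) as (d0 & Hd0 & H).
    exists d0; split; [assumption|]. intros dl v Hdl Hv. destruct (H dl v Hdl Hv) as [H1 H2].
    apply Hl1 in H1. apply Hl2 in H2. apply Rabs_def1; lra.
Qed.

(** Half-open counterpart of [is_cell_int]; built on [rect_int], it inherits additivity. *)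
Definition sing_int (f : R -> R -> R) a b c d l : Prop :=
  forall eps, 0 < eps -> exists d0, 0 < d0 /\ forall dl, 0 < dl < d0 ->
    exists v, rect_int (cut dl f) a b c d v /\ Rabs (v - l) < eps.

(** [s] is the exponent of the kernel as written, possibly above 2; [s'] is the effective exponent
    once the smallness of [g] at the origin is counted. Only the latter has to be integrable. *)
Lemma sing_int_exists g s s' K a b c d : 0 <= a -> a <= b -> 0 <= c -> c <= d ->
  osc_integrable g a b c d -> 0 <= s -> 0 <= s' < 2 -> 0 <= K ->
  (forall p q, a <= p < b -> c <= q < d -> 0 < nrm p q ->
     Rabs (g p q * ker s p q) <= K * ker s' p q) ->
  exists l, sing_int (fun p q => g p q * ker s p q) a b c d l.
Proof.
  intros Ha Hab Hc Hcd Hg Hs Hs' HK H. set (f := fun p q => g p q * ker s p q) in *.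
  destruct (near_bound s' Hs') as (C & HC & HB).
  assert (Hex : forall dl, 0 < dl -> exists v, rect_int (cut dl f) a b c d v).
  { intros dl Hdl. apply osc_integrable_rect_int; try assumption. apply osc_integrable_cut_ker; assumption. }
  assert (Hord : forall dl dl' v v', 0 < dl' <= dl -> rect_int (cut dl f) a b c d v ->
     rect_int (cut dl' f) a b c d v' -> Rabs (v' - v) <= K * C * Rpower (2 * dl) (2 - s')).
  { intros dl dl' v v' Hd Hv Hv'.
    (* The difference lives where [dl' < nrm p q <= dl]. There the max norm exceeds [dl' / 2], being
       at least half the Euclidean norm, and is below [2 * dl]. *)
    apply (HB _ a b c d _ K (2 * dl) (dl' / 2) Ha Hc ltac:(lra) HK ltac:(lra) (rect_int_minus _ _ _ _ _ _ _ _ Hv' Hv)).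
    - intros p q Hp Hq Hm. unfold cut. pose proof (Rmax_le_nrm p q ltac:(lra) ltac:(lra)).
      pose proof (ker_pos s' p q). assert (0 <= K * ker s' p q) by nra.
      repeat destruct Rlt_dec; try lra;
        try (rewrite Rminus_diag, Rabs_R0; assumption).
      rewrite Rminus_0_r. apply H; try assumption; lra.
    - intros p q Hp Hq Hm. unfold cut.
      pose proof (Rmax_le_nrm p q ltac:(lra) ltac:(lra)). pose proof (nrm_le_Rmax p q ltac:(lra) ltac:(lra)).
      repeat destruct Rlt_dec; lra. }
  destruct (limit_at_0 (fun dl v => rect_int (cut dl f) a b c d v) Hex) as [l Hl].
  - intros eps He.
    destruct (Rpower_small (2 - s') (eps / (K * C + 1)) ltac:(lra)) as (d0 & Hd0 & Hsm).
    { apply Rdiv_lt_0_compat; [assumption|]. assert (0 <= K * C) by (apply Rmult_le_pos; assumption). lra. }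
    assert (HKC : 0 <= K * C) by (apply Rmult_le_pos; assumption).
    assert (Hfin : forall dl, 0 < dl < d0 / 2 -> K * C * Rpower (2 * dl) (2 - s') <= eps).
    { intros dl Hdl. specialize (Hsm (2 * dl) ltac:(lra) ltac:(lra)).
      pose proof (Rpower_pos (2 * dl) (2 - s')).
      assert (E : eps = (K * C + 1) * (eps / (K * C + 1))) by (field; lra). rewrite E. nra. }
    exists (d0 / 2); split; [lra|]. intros dl dl' v v' Hdl Hdl' Hv Hv'.
    destruct (Rle_dec dl' dl).
    + rewrite Rabs_minus_sym. eapply Rle_trans; [apply (Hord dl dl'); try assumption; lra|auto].
    + eapply Rle_trans; [apply (Hord dl' dl); try assumption; lra|auto].
  - exists l. intros eps He. destruct (Hl eps He) as (d0 & Hd0 & H').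
    exists d0; split; [assumption|]. intros dl Hdl. destruct (Hex dl ltac:(lra)) as [v Hv].
    exists v; split; [assumption|]. apply (H' dl); assumption.
Qed.

Lemma sing_int_near s : 0 <= s < 2 -> exists C, 0 <= C /\ forall f a b c d l K r,
  0 <= a -> 0 <= c -> b <= r -> d <= r -> 0 < r -> 0 <= K -> sing_int f a b c d l ->
  (forall p q, a <= p < b -> c <= q < d -> 0 < nrm p q -> Rabs (f p q) <= K * ker s p q) ->
  Rabs l <= K * C * Rpower r (2 - s).
Proof.
  intros Hs. destruct (near_bound s Hs) as (C & HC & HB). exists C; split; [assumption|].
  intros f a b c d l K r Ha Hc Hb Hd Hr HK Hf H.
  apply le_epsilon. intros eps He. destruct (Hf eps He) as (d0 & Hd0 & Hl).
  destruct (Hl (d0 / 2) ltac:(lra)) as (v & Hv & Hvl).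
  assert (Rabs v <= K * C * Rpower r (2 - s)).
  { apply (HB _ a b c d v K r (d0 / 4) Ha Hc Hr HK ltac:(lra) Hv).
    - intros p q Hp Hq Hm. unfold cut. pose proof (ker_pos s p q).
      pose proof (Rmax_le_nrm p q ltac:(lra) ltac:(lra)).
      destruct Rlt_dec; [apply H; try assumption; lra|]. rewrite Rabs_R0. nra.
    - intros p q Hp Hq Hm. unfold cut.
      pose proof (nrm_le_Rmax p q ltac:(lra) ltac:(lra)). destruct Rlt_dec; [|reflexivity].
      exfalso; apply Hm; split; [lra|]. unfold Rmax; destruct Rle_dec; lra. }
  replace l with (v - (v - l)) by ring. unfold Rminus at 1.
  eapply Rle_trans; [apply Rabs_triang|]. rewrite Rabs_Ropp. lra.
Qed.

Lemma sing_int_addx f a m b c d l1 l2 : a <= m -> m <= b ->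
  sing_int f a m c d l1 -> sing_int f m b c d l2 -> sing_int f a b c d (l1 + l2).
Proof.
  intros H1 H2 Hf Hg eps He.
  destruct (Hf (eps / 2) ltac:(lra)) as (d1 & Hd1 & K1).
  destruct (Hg (eps / 2) ltac:(lra)) as (d2 & Hd2 & K2).
  exists (Rmin d1 d2); split; [unfold Rmin; destruct Rle_dec; lra|]. intros dl Hdl.
  pose proof (Rmin_l d1 d2). pose proof (Rmin_r d1 d2).
  destruct (K1 dl ltac:(lra)) as (v1 & V1 & A1). destruct (K2 dl ltac:(lra)) as (v2 & V2 & A2).
  exists (v1 + v2); split; [apply (rect_int_addx _ a m b); assumption|].
  replace (v1 + v2 - (l1 + l2)) with ((v1 - l1) + (v2 - l2)) by ring.
  eapply Rle_lt_trans; [apply Rabs_triang|lra].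
Qed.

Lemma sing_int_addy f a b c m d l1 l2 : c <= m -> m <= d ->
  sing_int f a b c m l1 -> sing_int f a b m d l2 -> sing_int f a b c d (l1 + l2).
Proof.
  intros H1 H2 Hf Hg eps He.
  destruct (Hf (eps / 2) ltac:(lra)) as (d1 & Hd1 & K1).
  destruct (Hg (eps / 2) ltac:(lra)) as (d2 & Hd2 & K2).
  exists (Rmin d1 d2); split; [unfold Rmin; destruct Rle_dec; lra|]. intros dl Hdl.
  pose proof (Rmin_l d1 d2). pose proof (Rmin_r d1 d2).
  destruct (K1 dl ltac:(lra)) as (v1 & V1 & A1). destruct (K2 dl ltac:(lra)) as (v2 & V2 & A2).
  exists (v1 + v2); split; [apply (rect_int_addy _ a b c m d); assumption|].
  replace (v1 + v2 - (l1 + l2)) with ((v1 - l1) + (v2 - l2)) by ring.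
  eapply Rle_lt_trans; [apply Rabs_triang|lra].
Qed.

Lemma sing_int_away f a b c d l r : 0 < r ->
  (forall p q, a <= p < b -> c <= q < d -> r <= nrm p q) -> sing_int f a b c d l -> rect_int f a b c d l.
Proof.
  intros Hr H Hf.
  assert (K : forall eps, 0 < eps -> exists v, rect_int f a b c d v /\ Rabs (v - l) < eps).
  { intros eps He. destruct (Hf eps He) as (d0 & Hd0 & Hl).
    set (t := Rmin d0 r / 2). assert (Ht : 0 < t < d0 /\ t < r) by (unfold t, Rmin; destruct Rle_dec; lra).
    destruct (Hl t ltac:(lra)) as (v & Hv & A). exists v; split; [|assumption].
    eapply rect_int_ext; [|exact Hv]. intros p q Hp Hq. unfold cut. specialize (H p q Hp Hq).
    destruct Rlt_dec; [reflexivity|lra]. }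
  destruct (K 1 ltac:(lra)) as (v & Hv & _). replace l with v; [assumption|].
  apply cond_eq. intros eps He. destruct (K eps He) as (v' & Hv' & A).
  rewrite (rect_int_unique _ _ _ _ _ _ _ Hv Hv'). assumption.
Qed.

Lemma sing_int_cell_int f a b c d l : a < b -> c < d ->
  (forall dl, 0 < dl -> exists M, forall p q, a <= p <= b -> c <= q <= d -> Rabs (cut dl f p q) <= M) ->
  sing_int f a b c d l -> is_cell_int f a b c d l.
Proof.
  intros Hab Hcd HM Hf eps He. destruct (Hf eps He) as (d0 & Hd0 & Hl).
  exists d0; split; [assumption|]. intros dl Hdl. destruct (Hl dl Hdl) as (v & Hv & A).
  exists v; split; [|assumption]. destruct (HM dl ltac:(lra)) as [M HM'].
  exact (rect_int_closed _ _ _ _ _ _ M Hab Hcd HM' Hv).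
Qed.

(** * Local quadrature error *)

Lemma Rabs_mult_le x y a b : Rabs x <= a -> Rabs y <= b -> Rabs (x * y) <= a * b.
Proof. intros; rewrite Rabs_mult; apply Rmult_le_compat; auto using Rabs_pos. Qed.

Lemma Rabs_plus_le x y a b : Rabs x <= a -> Rabs y <= b -> Rabs (x + y) <= a + b.
Proof. intros; eapply Rle_trans; [apply Rabs_triang|lra]. Qed.

(** * Taylor estimates for powers and kernels *)

Lemma mean_value_bound f f' x y B :
  (forall c, Rmin x y <= c <= Rmax x y -> derivable_pt_lim f c (f' c) /\ Rabs (f' c) <= B) ->
  Rabs (f y - f x) <= B * Rabs (y - x).
Proof.
  intros H. destruct (Rtotal_order x y) as [Hlt|[->|Hlt]].
  - rewrite Rmin_left, Rmax_right in H by lra.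
    destruct (MVT_cor2 f f' x y Hlt (fun c Hc => proj1 (H c Hc))) as (c & E & Hc).
    rewrite E, Rabs_mult. apply Rmult_le_compat_r; [apply Rabs_pos|apply H; lra].
  - rewrite !Rminus_diag, Rabs_R0. lra.
  - rewrite Rmin_right, Rmax_left in H by lra.
    destruct (MVT_cor2 f f' y x Hlt (fun c Hc => proj1 (H c Hc))) as (c & E & Hc).
    rewrite Rabs_minus_sym, E, Rabs_mult, (Rabs_minus_sym y x).
    apply Rmult_le_compat_r; [apply Rabs_pos|apply H; lra].
Qed.

Lemma ln_le x y : 0 < x -> x <= y -> ln x <= ln y.
Proof. intros H [H1| ->]; [left; apply ln_increasing; assumption|lra]. Qed.

(** The norms of two points in one cell off the origin differ by a factor of at most 3; [t] will be
    the ratio of their squares, whence the 9. *)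
Lemma Rpower_bound_9 t b : / 9 <= t <= 9 -> Rpower t b <= Rpower 9 (Rabs b).
Proof.
  intros Ht. unfold Rpower.
  assert (Hl : - ln 9 <= ln t <= ln 9).
  { rewrite <- ln_Rinv by lra. split; apply ln_le; lra. }
  assert (b * ln t <= Rabs b * ln 9).
  { eapply Rle_trans; [apply Rle_abs|]. rewrite Rabs_mult.
    apply Rmult_le_compat_l; [apply Rabs_pos|]. apply Rabs_le; lra. }
  destruct H as [H|H]; [left; apply exp_increasing; assumption|right; rewrite H; reflexivity].
Qed.

Lemma Rpower_1_l a : Rpower 1 a = 1.
Proof. unfold Rpower. rewrite ln_1, Rmult_0_r. apply exp_0. Qed.

Lemma Rpower_sub_1 a t : / 9 <= t <= 9 ->
  Rabs (Rpower t a - 1) <= Rabs a * Rpower 9 (Rabs (a - 1)) * Rabs (t - 1).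
Proof.
  intros Ht. rewrite <- (Rpower_1_l a) at 1.
  apply (mean_value_bound (fun x => Rpower x a) (fun x => a * Rpower x (a - 1))).
  intros c Hc. assert (/ 9 <= c <= 9) by (unfold Rmin, Rmax in Hc; repeat destruct Rle_dec; lra).
  split; [apply derivable_pt_lim_power; lra|]. rewrite Rabs_mult.
  apply Rmult_le_compat_l; [apply Rabs_pos|].
  rewrite Rabs_pos_eq by (left; apply Rpower_pos). apply Rpower_bound_9; assumption.
Qed.

(** Mean value theorem for [x^a - a x], whose derivative [a (x^(a-1) - 1)] is controlled by the
    first-order bound with exponent [a - 1]. *)
Lemma Rpower_taylor_1 a t : / 9 <= t <= 9 ->
  Rabs (Rpower t a - 1 - a * (t - 1)) <=
  Rabs a * (Rabs (a - 1) * Rpower 9 (Rabs (a - 1 - 1))) * (t - 1) ^ 2.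
Proof.
  intros Ht. set (M := Rabs (a - 1) * Rpower 9 (Rabs (a - 1 - 1))).
  assert (HM : 0 <= M) by (apply Rmult_le_pos; [apply Rabs_pos|left; apply Rpower_pos]).
  pose proof (mean_value_bound (fun x => Rpower x a - a * x) (fun x => a * Rpower x (a - 1) - a * 1)
    1 t (Rabs a * (M * Rabs (t - 1)))) as K. simpl in K.
  replace (Rpower t a - 1 - a * (t - 1)) with (Rpower t a - a * t - (Rpower 1 a - a * 1))
    by (rewrite Rpower_1_l; ring).
  eapply Rle_trans; [apply K|].
  - intros c Hc. assert (Hc9 : / 9 <= c <= 9) by (unfold Rmin, Rmax in Hc; repeat destruct Rle_dec; lra).
    split.
    + apply (derivable_pt_lim_minus (fun x => Rpower x a) (fun x => a * x)).
      * apply derivable_pt_lim_power; lra.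
      * apply derivable_pt_lim_scal, derivable_pt_lim_id.
    + replace (a * Rpower c (a - 1) - a * 1) with (a * (Rpower c (a - 1) - 1)) by ring.
      apply Rabs_mult_le; [lra|]. eapply Rle_trans; [apply Rpower_sub_1; assumption|].
      fold M. apply Rmult_le_compat_l; [assumption|].
      unfold Rmin, Rmax in Hc; unfold Rabs; repeat destruct Rle_dec; repeat destruct Rcase_abs; lra.
  - right. rewrite <- (Rabs_pos_eq ((t - 1) ^ 2)) by apply pow2_ge_0.
    rewrite <- RPow_abs. simpl; ring.
Qed.

Lemma Rpower_taylor a : exists C, 0 <= C /\ forall y y', 0 < y -> y <= 9 * y' -> y' <= 9 * y ->
  Rpower y' a <= C * Rpower y a /\
  Rabs (Rpower y' a - Rpower y a) <= C * Rpower y (a - 1) * Rabs (y' - y) /\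
  Rabs (Rpower y' a - Rpower y a - a * Rpower y (a - 1) * (y' - y)) <=
    C * Rpower y (a - 2) * (y' - y) ^ 2.
Proof.
  set (C0 := Rpower 9 (Rabs a)). set (C1 := Rabs a * Rpower 9 (Rabs (a - 1))).
  set (C2 := Rabs a * (Rabs (a - 1) * Rpower 9 (Rabs (a - 1 - 1)))).
  assert (H0 : 0 <= C0) by (left; apply Rpower_pos).
  assert (H1 : 0 <= C1) by (apply Rmult_le_pos; [apply Rabs_pos|left; apply Rpower_pos]).
  assert (H2 : 0 <= C2).
  { repeat apply Rmult_le_pos; try apply Rabs_pos. left; apply Rpower_pos. }
  exists (C0 + C1 + C2). split; [lra|]. intros y y' Hy Hyy' Hy'y.
  (* By homogeneity all three bounds reduce to the expansion at 1 in the ratio [t]. *)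
  set (t := y' / y).
  assert (Et : y' = y * t) by (unfold t; field; lra).
  assert (Ht : / 9 <= t <= 9) by (rewrite Et in *; split; nra).
  assert (E0 : Rpower y' a = Rpower y a * Rpower t a) by (rewrite Et; symmetry; apply Rpower_mult_distr; lra).
  assert (E1 : Rpower y (a - 1) * y = Rpower y a).
  { rewrite <- (Rpower_1 y Hy) at 2. rewrite <- Rpower_plus. f_equal; ring. }
  assert (E2 : Rpower y (a - 2) * (y * y) = Rpower y a).
  { rewrite <- Rmult_assoc. replace (Rpower y (a - 2) * y) with (Rpower y (a - 1)); [assumption|].
    rewrite <- (Rpower_1 y Hy) at 3. rewrite <- Rpower_plus. f_equal; ring. }
  assert (P := Rpower_pos y a).
  assert (Ed : y' - y = y * (t - 1)) by (rewrite Et; ring).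
  split; [|split].
  - rewrite E0. pose proof (Rpower_bound_9 t a Ht). fold C0 in H. nra.
  - rewrite E0, Ed, Rabs_mult, (Rabs_pos_eq y) by lra.
    replace (Rpower y a * Rpower t a - Rpower y a) with (Rpower y a * (Rpower t a - 1)) by ring.
    rewrite Rabs_mult, (Rabs_pos_eq (Rpower y a)) by lra.
    replace ((C0 + C1 + C2) * Rpower y (a - 1) * (y * Rabs (t - 1))) with
      (Rpower y a * ((C0 + C1 + C2) * Rabs (t - 1))) by (rewrite <- E1; ring).
    apply Rmult_le_compat_l; [lra|]. pose proof (Rpower_sub_1 a t Ht). fold C1 in H.
    pose proof (Rabs_pos (t - 1)). nra.
  - rewrite E0, Ed.
    replace (Rpower y a * Rpower t a - Rpower y a - a * Rpower y (a - 1) * (y * (t - 1))) with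
      (Rpower y a * (Rpower t a - 1 - a * (t - 1))) by (rewrite <- E1; ring).
    rewrite Rabs_mult, (Rabs_pos_eq (Rpower y a)) by lra.
    replace ((C0 + C1 + C2) * Rpower y (a - 2) * (y * (t - 1)) ^ 2) with
      (Rpower y a * ((C0 + C1 + C2) * (t - 1) ^ 2)) by (rewrite <- E2; ring).
    apply Rmult_le_compat_l; [lra|]. pose proof (Rpower_taylor_1 a t Ht). fold C2 in H.
    pose proof (pow2_ge_0 (t - 1)). nra.
Qed.

(** The kernel becomes a power of a quadratic polynomial, whose increments are exact; the
    one-variable Taylor bounds then apply in the plane. *)
Lemma ker_Rpower_sqr s p q : 0 < p * p + q * q -> ker s p q = Rpower (p * p + q * q) (- s / 2).
Proof.
  intros H. unfold ker, nrm. rewrite <- Rpower_sqrt by assumption. rewrite Rpower_mult.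
  f_equal; field.
Qed.

Lemma Rpower_mul_self r a : 0 < r -> Rpower r a * r = Rpower r (a + 1).
Proof. intros H. rewrite Rpower_plus, (Rpower_1 r H). reflexivity. Qed.

Definition in_cell (X Y h p q : R) : Prop := X <= p <= X + h /\ Y <= q <= Y + h.

(** Holds for every grid cell but the one at the origin. It gives [h <= nrm p q] throughout the
    cell, so all norms on it are comparable. *)
Definition off_origin (X Y h : R) : Prop := 0 <= X /\ 0 <= Y /\ 0 < h /\ h <= Rmax X Y.

Lemma cell_geometry X Y h p q p0 q0 : off_origin X Y h -> in_cell X Y h p q -> in_cell X Y h p0 q0 ->
  h <= nrm p0 q0 /\ 0 <= p0 <= nrm p0 q0 /\ 0 <= q0 <= nrm p0 q0 /\
  Rabs (p - p0) <= h /\ Rabs (q - q0) <= h /\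
  p * p + q * q <= 9 * (p0 * p0 + q0 * q0) /\
  Rabs ((p * p + q * q) - (p0 * p0 + q0 * q0)) <= 6 * h * nrm p0 q0.
Proof.
  intros (HX & HY & Hh & Hm) [[P1 P2] [P3 P4]] [[Q1 Q2] [Q3 Q4]].
  assert (Hp0 : p0 <= nrm p0 q0) by (apply nrm_ge; nra).
  assert (Hq0 : q0 <= nrm p0 q0) by (apply nrm_ge; nra).
  assert (Hr : h <= nrm p0 q0) by (unfold Rmax in Hm; destruct Rle_dec; lra).
  assert (D1 : Rabs (p - p0) <= h) by (apply Rabs_le; lra).
  assert (D2 : Rabs (q - q0) <= h) by (apply Rabs_le; lra).
  pose proof (nrm_sqr p0 q0) as E. set (r := nrm p0 q0) in *.
  repeat split; try assumption; try lra.
  (* From [2 p0 (p - p0) <= p0^2 + (p - p0)^2], and likewise for [q], one gets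
     [p^2 + q^2 <= 2 r^2 + 4 h^2 <= 6 r^2]. *)
  - pose proof (pow2_ge_0 (p - 2 * p0)). pose proof (pow2_ge_0 (q - 2 * q0)).
    assert (0 <= (h - (p - p0)) * (h + (p - p0))) by (apply Rmult_le_pos; lra).
    assert (0 <= (h - (q - q0)) * (h + (q - q0))) by (apply Rmult_le_pos; lra).
    assert (0 <= (r - h) * (r + h)) by (apply Rmult_le_pos; lra). simpl in *. nra.
  - replace (p * p + q * q - (p0 * p0 + q0 * q0)) with
      ((p - p0) * (p + p0) + (q - q0) * (q + q0)) by ring.
    eapply Rle_trans; [apply Rabs_plus_le; apply Rabs_mult_le|].
    + exact D1.
    + apply (Rabs_le (p + p0) (3 * r)); lra.
    + exact D2.
    + apply (Rabs_le (q + q0) (3 * r)); lra.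
    + lra.
Qed.

Lemma ker_est s : exists C, 0 <= C /\ forall X Y h p q p0 q0,
  off_origin X Y h -> in_cell X Y h p q -> in_cell X Y h p0 q0 ->
  let r := nrm p0 q0 in
  ker s p q <= C * Rpower r (- s) /\
  Rabs (ker s p q - ker s p0 q0) <= C * (h * Rpower r (- s - 1)) /\
  Rabs (ker s p q - ker s p0 q0 - (- s * Rpower r (- s - 2) * p0 * (p - p0) + - s * Rpower r (- s - 2) * q0 * (q - q0)))
    <= C * (h * h * Rpower r (- s - 2)).
Proof.
  destruct (Rpower_taylor (- s / 2)) as (C & HC & HT).
  (* 36 is the square of the 6 in the bound on the increment of the squared norm; [Rabs s] accounts
     for the quadratic part of that increment. *)
  exists (36 * C + Rabs s). pose proof (Rabs_pos s) as Hs. split; [lra|].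
  intros X Y h p q p0 q0 Hc Hz Hz0 r.
  destruct (cell_geometry X Y h p q p0 q0 Hc Hz Hz0) as (G1 & G2 & G3 & G4 & G5 & G6 & G7).
  destruct (cell_geometry X Y h p0 q0 p q Hc Hz0 Hz) as (G1' & _ & _ & _ & _ & G6' & _).
  destruct Hc as (_ & _ & Hh & _). fold r in G1, G2, G3, G7.
  assert (Hr : 0 < r) by lra.
  assert (Ey : p0 * p0 + q0 * q0 = r * r) by (symmetry; apply nrm_sqr).
  assert (Ey' : p * p + q * q = nrm p q * nrm p q) by (symmetry; apply nrm_sqr).
  assert (Hy : 0 < p0 * p0 + q0 * q0) by nra.
  assert (Hy' : 0 < p * p + q * q) by nra.
  rewrite !ker_Rpower_sqr by assumption.
  destruct (HT _ _ Hy G6' G6) as (T0 & T1 & T2).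
  set (y := p0 * p0 + q0 * q0) in *. set (y' := p * p + q * q) in *.
  assert (Er : forall b, Rpower y b = Rpower r (2 * b)).
  { intros b. rewrite Ey, <- Rpower_mult_distr, <- Rpower_plus by assumption. f_equal; ring. }
  rewrite !Er in *.
  replace (2 * (- s / 2)) with (- s) in * by field.
  replace (2 * (- s / 2 - 1)) with (- s - 2) in * by field.
  replace (2 * (- s / 2 - 2)) with (- s - 4) in * by field.
  set (R0 := Rpower r (- s)) in *. set (R2 := Rpower r (- s - 2)) in *. set (R4 := Rpower r (- s - 4)) in *.
  assert (E1 : Rpower r (- s - 1) = R2 * r) by (unfold R2; rewrite Rpower_mul_self by assumption; f_equal; ring).
  assert (E4 : R2 = R4 * r * r) by (unfold R2, R4; rewrite !Rpower_mul_self by assumption; f_equal; ring).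
  assert (P0 : 0 < R0) by apply Rpower_pos. assert (P2 : 0 < R2) by apply Rpower_pos.
  assert (P4 : 0 < R4) by apply Rpower_pos.
  rewrite E1. split; [|split].
  - nra.
  - eapply Rle_trans; [exact T1|].
    apply Rle_trans with (C * R2 * (6 * h * r)).
    + apply Rmult_le_compat_l; [nra|assumption].
    + assert (0 <= R2 * (h * r)) by (apply Rmult_le_pos; nra). nra.
  (* The increment [y' - y] is twice the scalar product of the centre with the displacement, plus
     the squared displacement. The first part yields the gradient term; the second is moved into the
     error. *)
  - replace (Rpower y' (- s / 2) - R0 - _) with
      ((Rpower y' (- s / 2) - R0 - - s / 2 * R2 * (y' - y)) +
       (- s / 2 * R2) * ((p - p0) * (p - p0) + (q - q0) * (q - q0))) by (unfold y, y'; field).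
    apply Rle_trans with (C * R4 * (6 * h * r) ^ 2 + Rabs s / 2 * R2 * (h * h + h * h)).
    + apply Rabs_plus_le.
      * eapply Rle_trans; [exact T2|]. apply Rmult_le_compat_l; [nra|].
        rewrite <- (Rabs_pos_eq ((y' - y) ^ 2)) by apply pow2_ge_0. rewrite <- RPow_abs.
        apply pow_incr. split; [apply Rabs_pos|assumption].
      * apply Rabs_mult_le; [|apply Rabs_plus_le; apply Rabs_mult_le; assumption].
        rewrite Rabs_mult, (Rabs_pos_eq R2) by lra. unfold Rdiv.
        rewrite Rabs_mult, Rabs_Ropp, (Rabs_pos_eq (/ 2)) by lra. lra.
    + right. rewrite E4. field.
Qed.

(** The point where the ceiling on the smoothness exponent enters: [r^(b-2)] is largest at [r = h]
    only for [b <= 2]. *)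
Lemma h_pow_2 h r b : 0 < h -> h <= r -> b <= 2 -> h * h * Rpower r (b - 2) <= Rpower h b.
Proof.
  intros H1 H2 H3. replace (Rpower h b) with (h * h * Rpower h (b - 2)).
  - apply Rmult_le_compat_l; [nra|]. replace (b - 2) with (- (2 - b)) by ring. apply Rpower_anti; lra.
  - rewrite Rmult_comm, <- Rmult_assoc, !Rpower_mul_self by assumption. f_equal; ring.
Qed.

Lemma h_pow_1 h r b : 0 < h -> h <= r -> b <= 1 -> h * Rpower r (b - 1) <= Rpower h b.
Proof.
  intros H1 H2 H3. replace (Rpower h b) with (h * Rpower h (b - 1)).
  - apply Rmult_le_compat_l; [lra|]. replace (b - 1) with (- (1 - b)) by ring. apply Rpower_anti; lra.
  - rewrite Rmult_comm, Rpower_mul_self by assumption. f_equal; ring.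
Qed.

(** The radius [dl] is any positive bound on the displacement, so coinciding points need no separate
    case; [Rpower 0 s] is not 0 and could not express it. *)
Definition sup_holder (K s : R) (f : R -> R -> R) : Prop :=
  forall p q p' q' dl, 0 < dl -> Rabs (p - p') <= dl -> Rabs (q - q') <= dl ->
    Rabs (f p q - f p' q') <= K * Rpower dl s.

(** One moves from [(p0, q0)] to [(p0, q)] and on to [(p, q)]. Each leg is a mean value estimate
    after subtracting the tangent, and all intermediate points stay within [dl] of the base point in
    each coordinate. *)
Lemma taylor_2d S Sp Sq K s p0 q0 p q dl : 0 <= K ->
  (forall p q, derivable_pt_lim (fun t => S t q) p (Sp p q)) ->
  (forall p q, derivable_pt_lim (fun t => S p t) q (Sq p q)) ->
  sup_holder K s Sp -> sup_holder K s Sq -> 0 < dl -> Rabs (p - p0) <= dl -> Rabs (q - q0) <= dl ->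
  Rabs (S p q - S p0 q0 - (Sp p0 q0 * (p - p0) + Sq p0 q0 * (q - q0))) <= 2 * K * Rpower dl (s + 1).
Proof.
  intros HK Dp Dq Hp Hq Hdl H1 H2.
  assert (A : forall c x y, Rmin x y <= c <= Rmax x y -> Rabs (c - x) <= Rabs (y - x)).
  { intros c x y. unfold Rmin, Rmax, Rabs. repeat destruct Rle_dec; repeat destruct Rcase_abs; lra. }
  replace (S p q - S p0 q0 - (Sp p0 q0 * (p - p0) + Sq p0 q0 * (q - q0))) with
    (((S p q - Sp p0 q0 * p) - (S p0 q - Sp p0 q0 * p0)) +
     ((S p0 q - Sq p0 q0 * q) - (S p0 q0 - Sq p0 q0 * q0))) by ring.
  replace (2 * K * Rpower dl (s + 1)) with (K * Rpower dl s * dl + K * Rpower dl s * dl)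
    by (rewrite <- Rpower_mul_self by assumption; ring).
  assert (HB : 0 <= K * Rpower dl s) by (apply Rmult_le_pos; [assumption|left; apply Rpower_pos]).
  apply Rabs_plus_le.
  - apply Rle_trans with (K * Rpower dl s * Rabs (p - p0)); [|apply Rmult_le_compat_l; assumption].
    apply (mean_value_bound (fun t => S t q - Sp p0 q0 * t) (fun t => Sp t q - Sp p0 q0 * 1)).
    intros c Hc. split.
    + apply (derivable_pt_lim_minus (fun t => S t q) (fun t => Sp p0 q0 * t)); [apply Dp|].
      apply derivable_pt_lim_scal, derivable_pt_lim_id.
    + rewrite Rmult_1_r. apply Hp; [assumption| |assumption]. specialize (A c p0 p Hc); lra.
  - apply Rle_trans with (K * Rpower dl s * Rabs (q - q0)); [|apply Rmult_le_compat_l; assumption].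
    apply (mean_value_bound (fun t => S p0 t - Sq p0 q0 * t) (fun t => Sq p0 t - Sq p0 q0 * 1)).
    intros c Hc. split.
    + apply (derivable_pt_lim_minus (fun t => S p0 t) (fun t => Sq p0 q0 * t)); [apply Dq|].
      apply derivable_pt_lim_scal, derivable_pt_lim_id.
    + rewrite Rmult_1_r. apply Hq; [assumption|rewrite Rminus_diag, Rabs_R0; lra|].
      specialize (A c q0 q Hc); lra.
Qed.

(** * Quadrature on a single cell off the origin *)

Definition corner_avg (f : R -> R -> R) X Y h : R :=
  / 4 * (f X Y + f (X + h) Y + f X (Y + h) + f (X + h) (Y + h)).

(** The corners are symmetric about the centre, so the average is exact on affine functions and only
    the deviation [E] survives. *)
Lemma corner_avg_affine f X Y h L m1 m2 E : 0 < h ->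
  (forall p q, in_cell X Y h p q ->
     Rabs (f p q - (L + m1 * (p - (X + h / 2)) + m2 * (q - (Y + h / 2)))) <= E) ->
  Rabs (corner_avg f X Y h - L) <= E.
Proof.
  intros Hh H. unfold corner_avg.
  pose proof (H X Y ltac:(split; lra)) as H1. pose proof (H (X + h) Y ltac:(split; lra)) as H2.
  pose proof (H X (Y + h) ltac:(split; lra)) as H3.
  pose proof (H (X + h) (Y + h) ltac:(split; lra)) as H4.
  apply Rabs_le_inv in H1. apply Rabs_le_inv in H2. apply Rabs_le_inv in H3. apply Rabs_le_inv in H4.
  apply Rabs_le; lra.
Qed.

(* The cell error is second order after removal of a linear function centred in the cell, whose integral vanishes. *)
Definition quad_error (alpha gamma beta C : R) (S : R -> R -> R) : Prop :=
  forall X Y h, off_origin X Y h -> exists v1 v2, forall p q, in_cell X Y h p q ->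
    Rabs ((corner_avg (fun p q => ker gamma p q * S p q) X Y h - ker gamma p q * S p q)
            * ker (2 + alpha - gamma) p q
          - (v1 * (p - (X + h / 2)) + v2 * (q - (Y + h / 2))))
    <= C * Rpower h beta * ker (2 + alpha) p q.

Lemma quad_error_C0 alpha gamma beta K : 0 <= K -> 0 < beta <= 1 ->
  exists C, 0 <= C /\ forall S, S 0 0 = 0 -> sup_holder K beta S -> quad_error alpha gamma beta C S.
Proof.
  intros HK Hb.
  destruct (ker_est gamma) as (Cg & HCg & Eg).
  destruct (ker_est (2 + alpha - gamma)) as (Co & HCo & Eo).
  destruct (ker_est (2 + alpha)) as (Ck & HCk & Ek).
  (* [2 * K * Cg] bounds the deviation of [ker gamma * S] from its centre value; it is doubled
     because the corner average and the point value both deviate. [Co] bounds the weight, and [Ck]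
     carries the kernel from the centre back to the point. *)
  exists (4 * K * Cg * Co * Ck). split; [repeat apply Rmult_le_pos; lra|].
  (* At Hoelder regularity there is no first-order part to remove. *)
  intros S S0 HS X Y h Hc. exists 0, 0. intros p q Hz.
  set (p0 := X + h / 2). set (q0 := Y + h / 2).
  assert (Hh : 0 < h) by apply Hc.
  assert (Hz0 : in_cell X Y h p0 q0) by (unfold p0, q0; split; lra).
  destruct (cell_geometry X Y h p q p0 q0 Hc Hz Hz0) as (G1 & G2 & G3 & _).
  set (r := nrm p0 q0) in *. assert (Hr : 0 < r) by lra.
  assert (HSc : Rabs (S p0 q0) <= K * Rpower r beta).
  { replace (S p0 q0) with (S p0 q0 - S 0 0) by (rewrite S0; ring).
    apply HS; [assumption|rewrite Rminus_0_r, Rabs_pos_eq; lra|rewrite Rminus_0_r, Rabs_pos_eq; lra]. }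
  set (B := Rpower h beta * Rpower r (- gamma)).
  assert (HB : 0 < B) by (apply Rmult_lt_0_compat; apply Rpower_pos).
  assert (HE : forall p q, in_cell X Y h p q ->
    Rabs (ker gamma p q * S p q - (ker gamma p0 q0 * S p0 q0 + 0 * (p - p0) + 0 * (q - q0)))
      <= 2 * K * Cg * B).
  { intros p1 q1 H1. destruct (cell_geometry X Y h p1 q1 p0 q0 Hc H1 Hz0) as (_ & _ & _ & D1 & D2 & _).
    destruct (Eg X Y h p1 q1 p0 q0 Hc H1 Hz0) as (T0 & T1 & _). fold r in T0, T1.
    replace (_ - _) with (ker gamma p1 q1 * (S p1 q1 - S p0 q0) +
       (ker gamma p1 q1 - ker gamma p0 q0) * S p0 q0) by ring.
    apply Rle_trans with (Cg * Rpower r (- gamma) * (K * Rpower h beta) +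
       Cg * (h * Rpower r (- gamma - 1)) * (K * Rpower r beta)).
    - apply Rabs_plus_le; apply Rabs_mult_le; try assumption.
      + rewrite Rabs_pos_eq by (left; apply ker_pos). assumption.
      + apply HS; assumption.
    - assert (P : h * Rpower r (- gamma - 1) * Rpower r beta <= B).
      { unfold B. replace (h * Rpower r (- gamma - 1) * Rpower r beta) with
          (h * Rpower r (beta - 1) * Rpower r (- gamma)).
        - apply Rmult_le_compat_r; [left; apply Rpower_pos|apply h_pow_1; lra].
        - rewrite !Rmult_assoc, <- !Rpower_plus. do 2 f_equal; ring. }
      assert (0 <= Cg * K) by (apply Rmult_le_pos; assumption). unfold B in *. nra. }
  pose proof (corner_avg_affine _ X Y h _ 0 0 _ Hh HE) as HA.
  specialize (HE p q Hz).
  destruct (Eo X Y h p q p0 q0 Hc Hz Hz0) as (To & _ & _). fold r in To.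
  destruct (Ek X Y h p0 q0 p q Hc Hz0 Hz) as (Tk & _ & _). fold (ker (2 + alpha) p q) in Tk.
  set (av := corner_avg _ _ _ _) in *.
  rewrite !Rmult_0_l, Rplus_0_r, Rminus_0_r.
  apply Rle_trans with ((4 * K * Cg * B) * (Co * Rpower r (- (2 + alpha - gamma)))).
  - apply Rabs_mult_le; [|rewrite Rabs_pos_eq by (left; apply ker_pos); assumption].
    apply Rabs_le_inv in HE. apply Rabs_le_inv in HA. apply Rabs_le; lra.
  - replace (4 * K * Cg * B * (Co * Rpower r (- (2 + alpha - gamma)))) with
      (4 * K * Cg * Co * Rpower h beta * ker (2 + alpha) p0 q0).
    + rewrite (Rmult_assoc (4 * K * Cg * Co * Ck)).
      replace (4 * K * Cg * Co * Ck * (Rpower h beta * ker (2 + alpha) p q)) with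
        (4 * K * Cg * Co * Rpower h beta * (Ck * ker (2 + alpha) p q)) by ring.
      apply Rmult_le_compat_l; [|exact Tk].
      apply Rmult_le_pos; [repeat apply Rmult_le_pos; lra|left; apply Rpower_pos].
    + unfold B, ker. fold r.
      replace (- (2 + alpha)) with (- gamma + - (2 + alpha - gamma)) by ring. rewrite Rpower_plus. ring.
Qed.

Lemma quad_error_C1 alpha gamma beta K : 0 <= K -> beta <= 2 ->
  exists C, 0 <= C /\ forall S Sp Sq, S 0 0 = 0 -> Sp 0 0 = 0 -> Sq 0 0 = 0 ->
    (forall p q, derivable_pt_lim (fun t => S t q) p (Sp p q)) ->
    (forall p q, derivable_pt_lim (fun t => S p t) q (Sq p q)) ->
    sup_holder K (beta - 1) Sp -> sup_holder K (beta - 1) Sq -> quad_error alpha gamma beta C S.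
Proof.
  intros HK Hb.
  destruct (ker_est gamma) as (Cg & HCg & Eg).
  destruct (ker_est (2 + alpha - gamma)) as (Co & HCo & Eo).
  destruct (ker_est (2 + alpha)) as (Ck & HCk & Ek).
  pose proof (Rabs_pos gamma) as Hg0.
  (* The first summand is twice the second-order error [6 * K * Cg], for the average and the point
     value, times the weight bound. The second is the variation of the weight times the size of the
     linear part. *)
  set (C1 := 12 * K * Cg * Co + 2 * (K * (1 + 2 * Rabs gamma)) * Co).
  assert (HC1 : 0 <= C1).
  { unfold C1. apply Rplus_le_le_0_compat; repeat apply Rmult_le_pos; lra. }
  exists (C1 * Ck). split; [apply Rmult_le_pos; assumption|].
  intros S Sp Sq S0 Sp0 Sq0 Dp Dq Hp Hq X Y h Hc.
  set (p0 := X + h / 2). set (q0 := Y + h / 2).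
  assert (Hh : 0 < h) by apply Hc.
  assert (Hz0 : in_cell X Y h p0 q0) by (unfold p0, q0; split; lra).
  destruct (cell_geometry X Y h p0 q0 p0 q0 Hc Hz0 Hz0) as (G1 & G2 & G3 & _).
  set (r := nrm p0 q0) in *. assert (Hr : 0 < r) by lra.
  assert (R0p : Rabs (p0 - 0) <= r) by (rewrite Rminus_0_r, Rabs_pos_eq; lra).
  assert (R0q : Rabs (q0 - 0) <= r) by (rewrite Rminus_0_r, Rabs_pos_eq; lra).
  assert (HSc : Rabs (S p0 q0) <= 2 * K * Rpower r beta).
  { pose proof (taylor_2d S Sp Sq K _ 0 0 p0 q0 r HK Dp Dq Hp Hq Hr R0p R0q) as T.
    rewrite S0, Sp0, Sq0 in T. replace (beta - 1 + 1) with beta in T by ring.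
    replace (S p0 q0 - 0 - _) with (S p0 q0) in T by ring. exact T. }
  assert (HSp : Rabs (Sp p0 q0) <= K * Rpower r (beta - 1)).
  { replace (Sp p0 q0) with (Sp p0 q0 - Sp 0 0) by (rewrite Sp0; ring). apply Hp; assumption. }
  assert (HSq : Rabs (Sq p0 q0) <= K * Rpower r (beta - 1)).
  { replace (Sq p0 q0) with (Sq p0 q0 - Sq 0 0) by (rewrite Sq0; ring). apply Hq; assumption. }
  (* [k * p0] and [k * q0] are the components of the gradient of [ker gamma] at the centre; [m1] and
     [m2] below follow from the product rule. *)
  set (k := - gamma * Rpower r (- gamma - 2)).
  set (gc := ker gamma p0 q0). assert (Egc : gc = Rpower r (- gamma)) by reflexivity.
  set (m1 := gc * Sp p0 q0 + S p0 q0 * (k * p0)).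
  set (m2 := gc * Sq p0 q0 + S p0 q0 * (k * q0)).
  set (B := Rpower h beta * Rpower r (- gamma)).
  assert (HB : 0 < B) by (apply Rmult_lt_0_compat; apply Rpower_pos).
  (* All second-order errors have the form [h^2 r^(beta-2)] times a common power of [r]; this trades
     the first factor for [h^beta]. *)
  assert (HP : forall a b c, a + b = beta - 2 + c ->
     h * h * (Rpower r a * Rpower r b) <= Rpower h beta * Rpower r c).
  { intros a b c E. rewrite <- Rpower_plus, E, Rpower_plus.
    rewrite <- Rmult_assoc. apply Rmult_le_compat_r; [left; apply Rpower_pos|apply h_pow_2; lra]. }
  assert (HE : forall p q, in_cell X Y h p q ->
    Rabs (ker gamma p q * S p q - (gc * S p0 q0 + m1 * (p - p0) + m2 * (q - q0)))
      <= 6 * K * Cg * B).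
  { intros p1 q1 H1. destruct (cell_geometry X Y h p1 q1 p0 q0 Hc H1 Hz0) as (_ & _ & _ & D1 & D2 & _).
    destruct (Eg X Y h p1 q1 p0 q0 Hc H1 Hz0) as (T0 & T1 & T2). fold r in T0, T1, T2.
    fold k in T2. fold gc in T1, T2.
    pose proof (taylor_2d S Sp Sq K _ p0 q0 p1 q1 h HK Dp Dq Hp Hq Hh D1 D2) as TS.
    replace (beta - 1 + 1) with beta in TS by ring.
    set (sg := Sp p0 q0 * (p1 - p0) + Sq p0 q0 * (q1 - q0)) in *.
    (* Product rule with remainder: the Taylor remainder of [S], that of the kernel, and the product
       of the two first-order increments, each of second order. *)
    replace (_ - _) with (ker gamma p1 q1 * (S p1 q1 - S p0 q0 - sg) +
       (ker gamma p1 q1 - gc - (k * p0 * (p1 - p0) + k * q0 * (q1 - q0))) * S p0 q0 +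
       (ker gamma p1 q1 - gc) * sg) by (unfold m1, m2, sg; ring).
    assert (Hsg : Rabs sg <= 2 * K * (h * Rpower r (beta - 1))).
    { replace (2 * K * (h * Rpower r (beta - 1))) with
        (K * Rpower r (beta - 1) * h + K * Rpower r (beta - 1) * h) by ring.
      apply Rabs_plus_le; apply Rabs_mult_le; assumption. }
    apply Rle_trans with (Cg * Rpower r (- gamma) * (2 * K * Rpower h beta) +
       Cg * (h * h * Rpower r (- gamma - 2)) * (2 * K * Rpower r beta) +
       Cg * (h * Rpower r (- gamma - 1)) * (2 * K * (h * Rpower r (beta - 1)))).
    - apply Rabs_plus_le; [apply Rabs_plus_le|]; apply Rabs_mult_le; try assumption.
      rewrite Rabs_pos_eq by (left; apply ker_pos). assumption.
    - pose proof (HP (- gamma - 2) beta (- gamma) ltac:(ring)) as P1.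
      pose proof (HP (- gamma - 1) (beta - 1) (- gamma) ltac:(ring)) as P2.
      assert (0 <= Cg * K) by (apply Rmult_le_pos; assumption). fold B in P1, P2.
      replace (Cg * Rpower r (- gamma) * (2 * K * Rpower h beta)) with (2 * (Cg * K) * B) by (unfold B; ring).
      replace (Cg * (h * h * Rpower r (- gamma - 2)) * (2 * K * Rpower r beta)) with
        (2 * (Cg * K) * (h * h * (Rpower r (- gamma - 2) * Rpower r beta))) by ring.
      replace (Cg * (h * Rpower r (- gamma - 1)) * (2 * K * (h * Rpower r (beta - 1)))) with
        (2 * (Cg * K) * (h * h * (Rpower r (- gamma - 1) * Rpower r (beta - 1)))) by ring.
      nra. }
  pose proof (corner_avg_affine _ X Y h _ m1 m2 _ Hh HE) as HA.
  (* The average agrees with the centre value to second order, so average minus point value is to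
     leading order minus the linear part. Freezing the weight at the centre keeps it linear, whence
     the coefficients [- oc * m1] and [- oc * m2]. *)
  set (oc := ker (2 + alpha - gamma) p0 q0).
  exists (- oc * m1), (- oc * m2). intros p q Hz. fold p0 q0.
  specialize (HE p q Hz).
  destruct (cell_geometry X Y h p q p0 q0 Hc Hz Hz0) as (_ & _ & _ & D1 & D2 & _).
  destruct (Eo X Y h p q p0 q0 Hc Hz Hz0) as (To & To1 & _). fold r oc in To, To1.
  destruct (Ek X Y h p0 q0 p q Hc Hz0 Hz) as (Tk & _ & _). fold (ker (2 + alpha) p q) in Tk.
  set (av := corner_avg _ _ _ _) in *. set (om := ker (2 + alpha - gamma) p q) in *.
  set (md := m1 * (p - p0) + m2 * (q - q0)).
  assert (Hm : forall sx x0, Rabs sx <= K * Rpower r (beta - 1) -> 0 <= x0 <= r ->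
     Rabs (gc * sx + S p0 q0 * (k * x0)) <= K * (1 + 2 * Rabs gamma) * Rpower r (beta - 1 - gamma)).
  { intros sx x0 Hsx Hx0.
    apply Rle_trans with (Rpower r (- gamma) * (K * Rpower r (beta - 1)) +
      2 * K * Rpower r beta * (Rabs gamma * Rpower r (- gamma - 2) * r)).
    - apply Rabs_plus_le; apply Rabs_mult_le; try assumption.
      + rewrite Egc, Rabs_pos_eq by (left; apply Rpower_pos). lra.
      + apply Rabs_mult_le; [|rewrite Rabs_pos_eq; lra].
        unfold k. rewrite Rabs_mult, Rabs_Ropp, (Rabs_pos_eq (Rpower _ _)) by (left; apply Rpower_pos). lra.
    - right. rewrite (Rmult_assoc (Rabs gamma)), Rpower_mul_self by assumption.
      replace (Rpower r (beta - 1 - gamma)) with (Rpower r (beta - 1) * Rpower r (- gamma))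
        by (rewrite <- Rpower_plus; f_equal; ring).
      replace (2 * K * Rpower r beta * (Rabs gamma * Rpower r (- gamma - 2 + 1))) with
        (2 * K * Rabs gamma * (Rpower r (beta - 1) * Rpower r (- gamma))).
      + ring.
      + rewrite <- Rpower_plus. replace (beta - 1 + - gamma) with (beta + (- gamma - 2 + 1)) by ring.
        rewrite Rpower_plus. ring. }
  assert (Hmd : Rabs md <= 2 * (K * (1 + 2 * Rabs gamma)) * (h * Rpower r (beta - 1 - gamma))).
  { replace (2 * (K * (1 + 2 * Rabs gamma)) * (h * Rpower r (beta - 1 - gamma))) with
      (K * (1 + 2 * Rabs gamma) * Rpower r (beta - 1 - gamma) * h +
       K * (1 + 2 * Rabs gamma) * Rpower r (beta - 1 - gamma) * h) by ring.
    apply Rabs_plus_le; apply Rabs_mult_le; try assumption; apply Hm; assumption. }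
  (* The remainder splits into a second-order term times the weight and the variation of the weight
     times the linear part [md], a product of two first-order terms. *)
  replace (_ - _) with ((av - ker gamma p q * S p q + md) * om - (om - oc) * md) by (unfold md; ring).
  apply Rle_trans with (C1 * (Rpower h beta * Rpower r (- (2 + alpha)))).
  - unfold Rminus at 1. apply Rle_trans with
      ((12 * K * Cg * B) * (Co * Rpower r (- (2 + alpha - gamma))) +
       (Co * (h * Rpower r (- (2 + alpha - gamma) - 1))) *
         (2 * (K * (1 + 2 * Rabs gamma)) * (h * Rpower r (beta - 1 - gamma)))).
    + apply Rabs_plus_le; [|rewrite Rabs_Ropp]; apply Rabs_mult_le; try assumption.
      * apply Rabs_le_inv in HE. apply Rabs_le_inv in HA. unfold md. apply Rabs_le; lra.
      * unfold om. rewrite Rabs_pos_eq by (left; apply ker_pos). assumption.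
    + pose proof (HP (- (2 + alpha - gamma) - 1) (beta - 1 - gamma) (- (2 + alpha)) ltac:(ring)) as P1.
      set (W := Rpower h beta * Rpower r (- (2 + alpha))) in *.
      replace (12 * K * Cg * B * (Co * Rpower r (- (2 + alpha - gamma)))) with (12 * K * Cg * Co * W).
      * unfold C1. rewrite Rmult_plus_distr_r. apply Rplus_le_compat_l.
        set (Z := h * h * _) in P1.
        replace (Co * (h * Rpower r (- (2 + alpha - gamma) - 1)) *
          (2 * (K * (1 + 2 * Rabs gamma)) * (h * Rpower r (beta - 1 - gamma)))) with
          (2 * (K * (1 + 2 * Rabs gamma)) * Co * Z) by (unfold Z; ring).
        apply Rmult_le_compat_l; [repeat apply Rmult_le_pos; lra|assumption].
      * unfold W, B. replace (- (2 + alpha)) with (- gamma + - (2 + alpha - gamma)) by ring.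
        rewrite Rpower_plus. ring.
  - replace (C1 * Ck * Rpower h beta * ker (2 + alpha) p q) with
      (C1 * (Rpower h beta * (Ck * ker (2 + alpha) p q))) by ring.
    apply Rmult_le_compat_l; [assumption|]. apply Rmult_le_compat_l; [left; apply Rpower_pos|exact Tk].
Qed.

(** * Gauss limits and regularity of u *)

Lemma Rpower_exp y s : Rpower (exp y) s = exp (s * y).
Proof. unfold Rpower. rewrite ln_exp. reflexivity. Qed.

Lemma exp_le x y : x <= y -> exp x <= exp y.
Proof. intros [H| ->]; [left; apply exp_increasing; assumption|lra]. Qed.

(** This is the quotient of consecutive terms of Gauss's sequence. Below,
    [(1 + 1/m)^s >= 1 + s/(m+1)] balances the second factor exactly. Above, the exponents combine to
    [s/m - s/(s+m+1) = s(1+s)/(m(s+m+1))], which is enlarged to a telescoping difference. *)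
Lemma ratio_bounds s m : 0 < s -> 1 <= m ->
  1 <= Rpower ((m + 1) / m) s * ((m + 1) / (s + (m + 1))) <= exp (s * (1 + s) / m - s * (1 + s) / (m + 1)).
Proof.
  intros Hs Hm. set (rho := Rpower ((m + 1) / m) s). set (k := (m + 1) / (s + (m + 1))).
  assert (Hk : 0 < k) by (apply Rdiv_lt_0_compat; lra).
  assert (Hq : 0 < (m + 1) / m) by (apply Rdiv_lt_0_compat; lra).
  assert (L : 1 + s / (m + 1) <= rho).
  { eapply Rle_trans; [apply exp_ineq1_le|].
    replace (s / (m + 1)) with (s * / (m + 1)) by reflexivity. rewrite <- Rpower_exp.
    apply Rpower_le; [lra|apply exp_pos|].
    assert (E : exp (/ (m + 1)) * exp (- / (m + 1)) = 1) by (rewrite <- exp_plus, Rplus_opp_r; apply exp_0).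
    pose proof (exp_ineq1_le (- / (m + 1))) as H. pose proof (exp_pos (/ (m + 1))) as P.
    apply Rmult_le_reg_r with (m / (m + 1)); [apply Rdiv_lt_0_compat; lra|].
    replace ((m + 1) / m * (m / (m + 1))) with 1 by (field; lra).
    eapply Rle_trans; [|right; exact E].
    apply Rmult_le_compat_l; [lra|]. eapply Rle_trans; [|exact H]. right; field; lra. }
  assert (U : rho <= exp (s * / m)).
  { rewrite <- Rpower_exp. apply Rpower_le; [lra|assumption|].
    eapply Rle_trans; [|apply exp_ineq1_le]. right; field; lra. }
  split.
  - apply Rle_trans with ((1 + s / (m + 1)) * k).
    + right. unfold k. field. lra.
    + apply Rmult_le_compat_r; lra.
  - assert (U2 : k <= exp (- (s / (s + (m + 1))))).
    { eapply Rle_trans; [|apply exp_ineq1_le]. right. unfold k. field. lra. }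
    apply Rle_trans with (exp (s * / m) * exp (- (s / (s + (m + 1))))).
    + apply Rmult_le_compat; try lra. left; apply Rpower_pos.
    + rewrite <- exp_plus. apply exp_le.
      replace (s * / m + - (s / (s + (m + 1)))) with (s * (1 + s) * / (m * (s + (m + 1)))) by (field; lra).
      replace (s * (1 + s) / m - s * (1 + s) / (m + 1)) with (s * (1 + s) * / (m * (m + 1))) by (field; lra).
      apply Rmult_le_compat_l; [nra|]. apply Rinv_le_contravar; nra.
Qed.

Lemma fprod_pos n f : (forall i, 0 < f i) -> 0 < fprod n f.
Proof. intros H; induction n; simpl; [lra|]. apply Rmult_lt_0_compat; auto. Qed.

(* Gauss's sequence a_n is increasing, while a_n exp(s(1+s)/n) is decreasing. *)
Lemma Gamma_exists s : 0 < s -> exists g, is_Gamma s g.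
Proof.
  intros Hs. set (a := fun n => INR (fact n) * Rpower (INR n) s / fprod (S n) (fun k => s + INR k)).
  assert (Hpr : forall n, 0 < fprod n (fun k => s + INR k)).
  { intros; apply fprod_pos; intros i; pose proof (pos_INR i); lra. }
  assert (Ha : forall n, 0 < a n).
  { intros n; unfold a. apply Rdiv_lt_0_compat; [|apply Hpr].
    apply Rmult_lt_0_compat; [apply INR_fact_lt_0|apply Rpower_pos]. }
  assert (Hm : forall n, 1 <= INR (S n)) by (intros; rewrite S_INR; pose proof (pos_INR n); lra).
  assert (Hrat : forall n, a (S (S n)) = a (S n) *
     (Rpower ((INR (S n) + 1) / INR (S n)) s * ((INR (S n) + 1) / (s + (INR (S n) + 1))))).
  { intros n. specialize (Hm n). set (m := S n) in *.
    assert (E : Rpower (INR (S m)) s = Rpower (INR m) s * Rpower ((INR m + 1) / INR m) s).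
    { rewrite Rpower_mult_distr; [|lra|apply Rdiv_lt_0_compat; lra].
      rewrite S_INR. f_equal. field. lra. }
    unfold a. rewrite E, fact_simpl, mult_INR.
    change (fprod (S (S m)) (fun k => s + INR k)) with (fprod (S m) (fun k => s + INR k) * (s + INR (S m))).
    rewrite S_INR. specialize (Hpr (S m)). field. lra. }
  set (e := fun n => exp (s * (1 + s) / INR (S n))).
  assert (Hdec : forall n, a (S n) * e n <= a (S O) * e O).
  { induction n as [|n IH]; [lra|]. eapply Rle_trans; [|exact IH].
    rewrite Hrat, Rmult_assoc. apply Rmult_le_compat_l; [left; apply Ha|].
    destruct (ratio_bounds s (INR (S n)) Hs (Hm n)) as [_ U].
    apply Rle_trans with (exp (s * (1 + s) / INR (S n) - s * (1 + s) / (INR (S n) + 1)) * e (S n)).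
    - apply Rmult_le_compat_r; [left; apply exp_pos|exact U].
    - unfold e. rewrite <- exp_plus. apply exp_le. rewrite (S_INR (S n)). lra. }
  destruct (growing_cv (fun n => a (S n))) as [g Hg].
  - intros n. rewrite Hrat. destruct (ratio_bounds s (INR (S n)) Hs (Hm n)) as [L _].
    rewrite <- (Rmult_1_r (a (S n))) at 1. apply Rmult_le_compat_l; [left; apply Ha|exact L].
  - exists (a (S O) * e O). intros z [n ->]. eapply Rle_trans; [|apply (Hdec n)].
    assert (1 <= e n).
    { apply Rle_trans with (exp 0); [right; symmetry; apply exp_0|]. unfold e. apply exp_le. specialize (Hm n).
      apply Rmult_le_pos; [nra|]. left; apply Rinv_0_lt_compat; lra. }
    specialize (Ha (S n)). nra.
  - exists g. intros eps He. destruct (Hg eps He) as [N HN]. exists (S N). intros n Hn.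
    destruct n as [|n]; [lia|]. apply HN. lia.
Qed.

Lemma c2_exists alpha : 0 < alpha < 2 -> exists c, c2 alpha c.
Proof.
  intros H. destruct (Gamma_exists ((2 + alpha) / 2)) as [g1 H1]; [lra|].
  destruct (Gamma_exists (1 - alpha / 2)) as [g2 H2]; [lra|].
  eexists; exists g1, g2. repeat split; eassumption.
Qed.

(** * Hoelder functions and their symmetric differences *)

Lemma Rpower_nonneg x a : 0 <= Rpower x a.
Proof. left; apply Rpower_pos. Qed.

Lemma holder_sup_holder s f : 0 <= s -> holder s f -> exists K, 0 <= K /\ sup_holder K s f.
Proof.
  (* [holder] does not fix the sign of its constant, hence [Rabs K]; [2^s] pays for a Euclidean
     distance of at most [2 * dl]. *)
  intros Hs [K HK]. exists (Rabs K * Rpower 2 s). split.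
  - apply Rmult_le_pos; [apply Rabs_pos|apply Rpower_nonneg].
  - intros p q p' q' dl Hdl H1 H2.
    destruct (nrm_nonneg (p - p') (q - q')) as [Hn|Hn].
    + eapply Rle_trans; [apply HK; assumption|].
      apply Rle_trans with (Rabs K * Rpower (nrm (p - p') (q - q')) s).
      * apply Rmult_le_compat_r; [apply Rpower_nonneg|apply Rle_abs].
      * rewrite Rmult_assoc, Rpower_mult_distr by lra.
        apply Rmult_le_compat_l; [apply Rabs_pos|]. apply Rpower_le; [assumption|assumption|].
        apply Rabs_le_inv in H1. apply Rabs_le_inv in H2. apply nrm_le; [lra|].
        assert (0 <= (dl - (p - p')) * (dl + (p - p'))) by (apply Rmult_le_pos; lra).
        assert (0 <= (dl - (q - q')) * (dl + (q - q'))) by (apply Rmult_le_pos; lra). nra.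
    + pose proof (nrm_sqr (p - p') (q - q')) as E. rewrite <- Hn in E.
      pose proof (Rle_0_sqr (p - p')) as E1. pose proof (Rle_0_sqr (q - q')) as E2.
      assert (p = p') by (apply Rminus_diag_uniq, Rsqr_0_uniq; unfold Rsqr in *; lra).
      assert (q = q') by (apply Rminus_diag_uniq, Rsqr_0_uniq; unfold Rsqr in *; lra). subst.
      rewrite Rminus_diag, Rabs_R0.
      repeat apply Rmult_le_pos; try apply Rpower_nonneg; apply Rabs_pos.
Qed.

(** Read off directly from Hoelder or Lipschitz bounds on squares, this replaces a compactness
    argument, and it is preserved by sums and reflections. *)
Definition unif_cont_bdd (f : R -> R -> R) : Prop := forall X, 0 < X ->
  (exists B, forall p q, Rabs p <= X -> Rabs q <= X -> Rabs (f p q) <= B) /\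
  (forall eps, 0 < eps -> exists dl, 0 < dl /\ forall p q p' q',
     Rabs p <= X -> Rabs q <= X -> Rabs p' <= X -> Rabs q' <= X ->
     Rabs (p - p') <= dl -> Rabs (q - q') <= dl -> Rabs (f p q - f p' q') <= eps).

Lemma unif_cont_bdd_sup_holder f s : 0 < s ->
  (forall X, 0 < X -> exists M, 0 <= M /\ forall p q p' q' dl, 0 < dl ->
     Rabs p <= X -> Rabs q <= X -> Rabs p' <= X -> Rabs q' <= X ->
     Rabs (p - p') <= dl -> Rabs (q - q') <= dl -> Rabs (f p q - f p' q') <= M * Rpower dl s) -> unif_cont_bdd f.
Proof.
  intros Hs H X HX. destruct (H X HX) as (M & HM & HB). split.
  - exists (M * Rpower X s + Rabs (f 0 0)). intros p q Hp Hq.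
    replace (f p q) with ((f p q - f 0 0) + f 0 0) by ring. apply Rabs_plus_le; [|lra].
    apply HB; try assumption; rewrite ?Rminus_0_r, ?Rabs_R0; lra.
  - intros eps He. destruct (Rpower_small s (eps / (M + 1)) Hs) as (dl & Hdl & Hsm).
    { apply Rdiv_lt_0_compat; lra. }
    exists dl; split; [assumption|]. intros. eapply Rle_trans; [apply (HB p q p' q' dl); assumption|].
    specialize (Hsm dl Hdl ltac:(lra)). pose proof (Rpower_pos dl s).
    assert (E : eps = (M + 1) * (eps / (M + 1))) by (field; lra). rewrite E. nra.
Qed.

Lemma unif_cont_bdd_plus f g : unif_cont_bdd f -> unif_cont_bdd g -> unif_cont_bdd (fun p q => f p q + g p q).
Proof.
  intros Hf Hg X HX. destruct (Hf X HX) as [[B HB] H1]. destruct (Hg X HX) as [[B' HB'] H2]. split.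
  - exists (B + B'). intros; apply Rabs_plus_le; auto.
  - intros eps He. destruct (H1 (eps / 2) ltac:(lra)) as (d1 & Hd1 & K1).
    destruct (H2 (eps / 2) ltac:(lra)) as (d2 & Hd2 & K2).
    pose proof (Rmin_l d1 d2). pose proof (Rmin_r d1 d2).
    exists (Rmin d1 d2). split; [unfold Rmin; destruct Rle_dec; lra|]. intros.
    replace (f p q + g p q - (f p' q' + g p' q')) with ((f p q - f p' q') + (g p q - g p' q')) by ring.
    replace eps with (eps / 2 + eps / 2) by field.
    apply Rabs_plus_le; [apply K1|apply K2]; try assumption; lra.
Qed.

Lemma unif_cont_bdd_const k : unif_cont_bdd (fun _ _ => k).
Proof.
  intros X HX. split; [exists (Rabs k); intros; lra|]. intros eps He. exists 1; split; [lra|].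
  intros. rewrite Rminus_diag, Rabs_R0; lra.
Qed.

Lemma unif_cont_bdd_affine f k x y sg tu : Rabs sg = 1 -> Rabs tu = 1 -> unif_cont_bdd f ->
  unif_cont_bdd (fun p q => k * f (x + sg * p) (y + tu * q)).
Proof.
  intros Hs Ht Hf X HX. pose proof (Rabs_pos x). pose proof (Rabs_pos y). pose proof (Rabs_pos k).
  destruct (Hf (Rabs x + Rabs y + X) ltac:(lra)) as [[B HB] HU].
  assert (Bx : forall p, Rabs p <= X -> Rabs (x + sg * p) <= Rabs x + Rabs y + X).
  { intros p Hp. eapply Rle_trans; [apply Rabs_triang|]. rewrite Rabs_mult, Hs. lra. }
  assert (By : forall q, Rabs q <= X -> Rabs (y + tu * q) <= Rabs x + Rabs y + X).
  { intros p Hp. eapply Rle_trans; [apply Rabs_triang|]. rewrite Rabs_mult, Ht. lra. }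
  split.
  - exists (Rabs k * B). intros. apply Rabs_mult_le; [lra|]. auto.
  - intros eps He. destruct (HU (eps / (Rabs k + 1))) as (d & Hd & K); [apply Rdiv_lt_0_compat; lra|].
    exists d; split; [assumption|]. intros. rewrite <- Rmult_minus_distr_l.
    apply Rle_trans with (Rabs k * (eps / (Rabs k + 1))).
    + apply Rabs_mult_le; [lra|]. apply K; auto.
      * replace (x + sg * p - (x + sg * p')) with (sg * (p - p')) by ring. rewrite Rabs_mult, Hs; lra.
      * replace (y + tu * q - (y + tu * q')) with (tu * (q - q')) by ring. rewrite Rabs_mult, Ht; lra.
    + assert (P : 0 < eps / (Rabs k + 1)) by (apply Rdiv_lt_0_compat; lra).
      assert (E : eps = (Rabs k + 1) * (eps / (Rabs k + 1))) by (field; lra).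
      rewrite E at 2. nra.
Qed.

Lemma unif_cont_bdd_osc_integrable f a b c d : a <= b -> c <= d -> unif_cont_bdd f -> osc_integrable f a b c d.
Proof.
  intros Hab Hcd Hf.
  set (X := Rabs a + Rabs b + Rabs c + Rabs d + 1).
  pose proof (Rabs_pos a). pose proof (Rabs_pos b). pose proof (Rabs_pos c). pose proof (Rabs_pos d).
  assert (B1 : forall p, a <= p <= b -> Rabs p <= X).
  { intros p Hp. unfold X in *. revert H H0. unfold Rabs; repeat destruct Rcase_abs; lra. }
  assert (B2 : forall p, c <= p <= d -> Rabs p <= X).
  { intros p Hp. unfold X in *. revert H H0. unfold Rabs; repeat destruct Rcase_abs; lra. }
  destruct (Hf X) as [[B HB] HU]; [unfold X; lra|].
  apply osc_integrable_uc; try assumption.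
  - exists B; intros; apply HB; auto.
  - intros eps He. destruct (HU eps He) as (dl & Hdl & K). exists dl; split; [assumption|].
    intros; apply K; auto.
Qed.

Definition sym_diff (u : R -> R -> R) x y p q : R :=
  u (x + p) (y + q) + u (x + p) (y - q) + u (x - p) (y + q) + u (x - p) (y - q) - 4 * u x y.

Lemma sym_diff_0 u x y : sym_diff u x y 0 0 = 0.
Proof. unfold sym_diff. rewrite !Rplus_0_r, !Rminus_0_r. ring. Qed.

Lemma unif_cont_bdd_sym_diff u x y : unif_cont_bdd u -> unif_cont_bdd (sym_diff u x y).
Proof.
  intros Hu. assert (A1 : Rabs 1 = 1) by (apply Rabs_pos_eq; lra).
  assert (A2 : Rabs (-1) = 1) by (rewrite Rabs_left; lra).
  assert (K := unif_cont_bdd_plus _ _ (unif_cont_bdd_plus _ _ (unif_cont_bdd_plus _ _ (unif_cont_bdd_plus _ _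
    (unif_cont_bdd_affine u 1 x y 1 1 A1 A1 Hu) (unif_cont_bdd_affine u 1 x y 1 (-1) A1 A2 Hu))
    (unif_cont_bdd_affine u 1 x y (-1) 1 A2 A1 Hu)) (unif_cont_bdd_affine u 1 x y (-1) (-1) A2 A2 Hu))
    (unif_cont_bdd_const (- (4 * u x y)))).
  assert (E : forall p q, sym_diff u x y p q = 1 * u (x + 1 * p) (y + 1 * q) + 1 * u (x + 1 * p) (y + -1 * q) +
    1 * u (x + -1 * p) (y + 1 * q) + 1 * u (x + -1 * p) (y + -1 * q) + - (4 * u x y)).
  { intros. unfold sym_diff. replace (x + 1 * p) with (x + p) by ring. replace (y + 1 * q) with (y + q) by ring.
    replace (x + -1 * p) with (x - p) by ring. replace (y + -1 * q) with (y - q) by ring. ring. }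
  intros X HX. destruct (K X HX) as [[B HB] HU]. split.
  - exists B; intros; rewrite E; auto.
  - intros eps He. destruct (HU eps He) as (dl & Hdl & HK). exists dl; split; [assumption|].
    intros; rewrite !E; apply HK; assumption.
Qed.

Lemma sup_holder_plus f g K M s : sup_holder K s f -> sup_holder M s g -> sup_holder (K + M) s (fun p q => f p q + g p q).
Proof.
  intros Hf Hg p q p' q' dl Hdl H1 H2.
  replace (_ - _) with ((f p q - f p' q') + (g p q - g p' q')) by ring.
  rewrite Rmult_plus_distr_r. apply Rabs_plus_le; auto.
Qed.

Lemma sup_holder_affine f K s k x y sg tu : Rabs k = 1 -> Rabs sg = 1 -> Rabs tu = 1 -> sup_holder K s f ->
  sup_holder K s (fun p q => k * f (x + sg * p) (y + tu * q)).
Proof.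
  intros Hk Hs Ht H p q p' q' dl Hdl H1 H2. rewrite <- Rmult_minus_distr_l, Rabs_mult, Hk, Rmult_1_l.
  apply H; [assumption| |].
  - replace (x + sg * p - (x + sg * p')) with (sg * (p - p')) by ring. rewrite Rabs_mult, Hs; lra.
  - replace (y + tu * q - (y + tu * q')) with (tu * (q - q')) by ring. rewrite Rabs_mult, Ht; lra.
Qed.

(** With all signs positive this treats [sym_diff] itself up to a constant; the other signs arise in
    its partial derivatives, where each reflected coordinate brings a minus. *)
Lemma sup_holder_signs f K s x y k1 k2 k3 k4 :
  Rabs k1 = 1 -> Rabs k2 = 1 -> Rabs k3 = 1 -> Rabs k4 = 1 -> sup_holder K s f ->
  sup_holder (4 * K) s (fun p q => k1 * f (x + p) (y + q) + k2 * f (x + p) (y - q) +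
    k3 * f (x - p) (y + q) + k4 * f (x - p) (y - q)).
Proof.
  intros H1 H2 H3 H4 H. assert (A1 : Rabs 1 = 1) by (apply Rabs_pos_eq; lra).
  assert (A2 : Rabs (-1) = 1) by (rewrite Rabs_left; lra).
  assert (G : sup_holder (4 * K) s (fun p q => k1 * f (x + 1 * p) (y + 1 * q) + k2 * f (x + 1 * p) (y + -1 * q) +
    k3 * f (x + -1 * p) (y + 1 * q) + k4 * f (x + -1 * p) (y + -1 * q))).
  { replace (4 * K) with (K + K + K + K) by ring.
    repeat apply sup_holder_plus; apply sup_holder_affine; assumption. }
  intros p q p' q' dl. specialize (G p q p' q' dl). cbv beta in G.
  replace (x + 1 * p) with (x + p) in G by ring. replace (y + 1 * q) with (y + q) in G by ring.
  replace (x + -1 * p) with (x - p) in G by ring. replace (y + -1 * q) with (y - q) in G by ring.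
  replace (x + 1 * p') with (x + p') in G by ring. replace (y + 1 * q') with (y + q') in G by ring.
  replace (x + -1 * p') with (x - p') in G by ring. replace (y + -1 * q') with (y - q') in G by ring.
  exact G.
Qed.

Lemma derivable_shift f x p l : derivable_pt_lim f (x + p) l -> derivable_pt_lim (fun t => f (x + t)) p l.
Proof.
  intros H eps He. destruct (H eps He) as [d Hd]. exists d. intros h H1 H2.
  rewrite <- Rplus_assoc. apply Hd; assumption.
Qed.

Lemma derivable_refl f x p l : derivable_pt_lim f (x - p) l -> derivable_pt_lim (fun t => f (x - t)) p (- l).
Proof.
  intros H eps He. destruct (H eps He) as [d Hd]. exists d. intros h H1 H2.
  specialize (Hd (- h) ltac:(lra) ltac:(rewrite Rabs_Ropp; assumption)).
  replace (x - (p + h)) with (x - p + - h) by ring.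
  rewrite <- Rabs_Ropp.
  replace (- ((f (x - p + - h) - f (x - p)) / h - - l)) with ((f (x - p + - h) - f (x - p)) / - h - l)
    by (field; assumption).
  assumption.
Qed.

(** All that the error analysis asks of [u]. [K] and [C] come before the point [x], [y], which is
    what makes the final bound a supremum over the domain. *)
Definition regular (alpha gamma beta K C : R) (u : R -> R -> R) : Prop :=
  unif_cont_bdd u /\ forall x y, quad_error alpha gamma beta C (sym_diff u x y) /\
    forall p q, 0 <= p -> 0 <= q -> 0 < nrm p q -> Rabs (sym_diff u x y p q) <= K * Rpower (nrm p q) beta.

Lemma le_nrm p q : 0 <= p -> 0 <= q -> p <= nrm p q /\ q <= nrm p q.
Proof. intros; split; apply nrm_ge; nra. Qed.

Lemma regular_C0 alpha gamma beta u : 0 < beta <= 1 -> holder beta u ->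
  exists K C, 0 <= K /\ 0 <= C /\ regular alpha gamma beta K C u.
Proof.
  intros Hb Hh. destruct (holder_sup_holder beta u ltac:(lra) Hh) as (K & HK & H).
  destruct (quad_error_C0 alpha gamma beta (4 * K) ltac:(lra) Hb) as (C & HC & HQ).
  exists (4 * K), C. split; [lra|]. split; [assumption|]. split.
  - apply (unif_cont_bdd_sup_holder u beta ltac:(lra)). intros X HX. exists K; split; [assumption|].
    intros; apply H; assumption.
  - intros x y. assert (HS : sup_holder (4 * K) beta (sym_diff u x y)).
    { intros p q p' q' dl Hdl H1 H2. assert (A1 : Rabs 1 = 1) by (apply Rabs_pos_eq; lra).
      pose proof (sup_holder_signs u K beta x y 1 1 1 1 A1 A1 A1 A1 H p q p' q' dl Hdl H1 H2) as G.
      cbv beta in G. unfold sym_diff. eapply Rle_trans; [right|exact G]. f_equal; ring. }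
    split; [apply HQ; [apply sym_diff_0|assumption]|].
    intros p q Hp Hq Hn. destruct (le_nrm p q Hp Hq).
    replace (sym_diff u x y p q) with (sym_diff u x y p q - sym_diff u x y 0 0) by (rewrite sym_diff_0; ring).
    apply HS; [assumption| |]; rewrite Rminus_0_r, Rabs_pos_eq; assumption.
Qed.

Lemma regular_C1 alpha gamma beta u fx fy : 1 < beta <= 2 ->
  (forall x y, derivable_pt_lim (fun t => u t y) x (fx x y)) ->
  (forall x y, derivable_pt_lim (fun t => u x t) y (fy x y)) ->
  holder (beta - 1) fx -> holder (beta - 1) fy ->
  exists K C, 0 <= K /\ 0 <= C /\ regular alpha gamma beta K C u.
Proof.
  intros Hb Dx Dy Hfx Hfy.
  destruct (holder_sup_holder (beta - 1) fx ltac:(lra) Hfx) as (K1 & HK1 & H1).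
  destruct (holder_sup_holder (beta - 1) fy ltac:(lra) Hfy) as (K2 & HK2 & H2).
  set (K := K1 + K2).
  assert (H1' : sup_holder K (beta - 1) fx).
  { intros p q p' q' dl Hdl A1 A2. specialize (H1 p q p' q' dl Hdl A1 A2).
    pose proof (Rpower_pos dl (beta - 1)). unfold K. nra. }
  assert (H2' : sup_holder K (beta - 1) fy).
  { intros p q p' q' dl Hdl A1 A2. specialize (H2 p q p' q' dl Hdl A1 A2).
    pose proof (Rpower_pos dl (beta - 1)). unfold K. nra. }
  assert (HK : 0 <= K) by (unfold K; lra). clearbody K.
  destruct (quad_error_C1 alpha gamma beta (4 * K) ltac:(lra) ltac:(lra)) as (C & HC & HQ).
  exists (2 * (4 * K)), C. split; [lra|]. split; [assumption|]. split.
  (* The Hoelder bound on the gradient bounds it on each square, so [u] is Lipschitz there and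
     exponent 1 is available. *)
  - apply (unif_cont_bdd_sup_holder u 1 ltac:(lra)). intros X HX.
    set (M1 := Rabs (fx 0 0) + K * Rpower X (beta - 1)).
    set (M2 := Rabs (fy 0 0) + K * Rpower X (beta - 1)).
    assert (P : 0 <= K * Rpower X (beta - 1)) by (apply Rmult_le_pos; [assumption|apply Rpower_nonneg]).
    pose proof (Rabs_pos (fx 0 0)). pose proof (Rabs_pos (fy 0 0)).
    assert (B1 : forall p q, Rabs p <= X -> Rabs q <= X -> Rabs (fx p q) <= M1).
    { intros p q Hp Hq. replace (fx p q) with (fx 0 0 + (fx p q - fx 0 0)) by ring.
      apply Rabs_plus_le; [lra|]. apply H1'; rewrite ?Rminus_0_r; assumption. }
    assert (B2 : forall p q, Rabs p <= X -> Rabs q <= X -> Rabs (fy p q) <= M2).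
    { intros p q Hp Hq. replace (fy p q) with (fy 0 0 + (fy p q - fy 0 0)) by ring.
      apply Rabs_plus_le; [lra|]. apply H2'; rewrite ?Rminus_0_r; assumption. }
    exists (M1 + M2). split; [unfold M1, M2; lra|].
    intros p q p' q' dl Hdl A1 A2 A3 A4 A5 A6. rewrite Rpower_1 by assumption.
    assert (Bt : forall c a b, Rmin a b <= c <= Rmax a b -> Rabs a <= X -> Rabs b <= X -> Rabs c <= X).
    { intros c a b Hc Ha' Hb'. apply Rabs_le_inv in Ha'. apply Rabs_le_inv in Hb'.
      apply Rabs_le. unfold Rmin, Rmax in Hc. repeat destruct Rle_dec; lra. }
    replace (u p q - u p' q') with ((u p q - u p' q) + (u p' q - u p' q')) by ring.
    rewrite Rmult_plus_distr_r. apply Rabs_plus_le.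
    + apply Rle_trans with (M1 * Rabs (p - p')); [|apply Rmult_le_compat_l; [unfold M1; lra|assumption]].
      apply (mean_value_bound (fun t => u t q) (fun t => fx t q)).
      intros c Hc. split; [apply Dx|]. apply B1; [apply (Bt c p' p)|]; assumption.
    + apply Rle_trans with (M2 * Rabs (q - q')); [|apply Rmult_le_compat_l; [unfold M2; lra|assumption]].
      apply (mean_value_bound (fun t => u p' t) (fun t => fy p' t)).
      intros c Hc. split; [apply Dy|]. apply B2; [|apply (Bt c q' q)]; assumption.
  - intros x y.
    (* The signs make the gradient of [sym_diff] vanish at the origin; this cancellation removes the
       linear term and yields the order [beta > 1]. *)
    set (Sp := fun p q => 1 * fx (x + p) (y + q) + 1 * fx (x + p) (y - q) +
      -1 * fx (x - p) (y + q) + -1 * fx (x - p) (y - q)).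
    set (Sq := fun p q => 1 * fy (x + p) (y + q) + -1 * fy (x + p) (y - q) +
      1 * fy (x - p) (y + q) + -1 * fy (x - p) (y - q)).
    assert (A1 : Rabs 1 = 1) by (apply Rabs_pos_eq; lra).
    assert (A2 : Rabs (-1) = 1) by (rewrite Rabs_left; lra).
    assert (HSp : sup_holder (4 * K) (beta - 1) Sp) by (apply sup_holder_signs; assumption).
    assert (HSq : sup_holder (4 * K) (beta - 1) Sq) by (apply sup_holder_signs; assumption).
    assert (Sp0 : Sp 0 0 = 0) by (unfold Sp; rewrite !Rplus_0_r, !Rminus_0_r; ring).
    assert (Sq0 : Sq 0 0 = 0) by (unfold Sq; rewrite !Rplus_0_r, !Rminus_0_r; ring).
    assert (Dp : forall p q, derivable_pt_lim (fun t => sym_diff u x y t q) p (Sp p q)).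
    { intros p q. unfold sym_diff.
      replace (Sp p q) with (fx (x + p) (y + q) + fx (x + p) (y - q) + - fx (x - p) (y + q) +
        - fx (x - p) (y - q) - 0) by (unfold Sp; ring).
      apply (derivable_pt_lim_minus (fun t => u (x + t) (y + q) + u (x + t) (y - q) +
        u (x - t) (y + q) + u (x - t) (y - q)) (fun _ => 4 * u x y)); [|apply derivable_pt_lim_const].
      apply (derivable_pt_lim_plus (fun t => u (x + t) (y + q) + u (x + t) (y - q) +
        u (x - t) (y + q)) (fun t => u (x - t) (y - q))).
      2:{ apply (derivable_refl (fun t => u t (y - q))), Dx. }
      apply (derivable_pt_lim_plus (fun t => u (x + t) (y + q) + u (x + t) (y - q)) (fun t => u (x - t) (y + q))).
      2:{ apply (derivable_refl (fun t => u t (y + q))), Dx. }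
      apply (derivable_pt_lim_plus (fun t => u (x + t) (y + q)) (fun t => u (x + t) (y - q))).
      - apply (derivable_shift (fun t => u t (y + q))), Dx.
      - apply (derivable_shift (fun t => u t (y - q))), Dx. }
    assert (Dq : forall p q, derivable_pt_lim (fun t => sym_diff u x y p t) q (Sq p q)).
    { intros p q. unfold sym_diff.
      replace (Sq p q) with (fy (x + p) (y + q) + - fy (x + p) (y - q) + fy (x - p) (y + q) +
        - fy (x - p) (y - q) - 0) by (unfold Sq; ring).
      apply (derivable_pt_lim_minus (fun t => u (x + p) (y + t) + u (x + p) (y - t) +
        u (x - p) (y + t) + u (x - p) (y - t)) (fun _ => 4 * u x y)); [|apply derivable_pt_lim_const].
      apply (derivable_pt_lim_plus (fun t => u (x + p) (y + t) + u (x + p) (y - t) +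
        u (x - p) (y + t)) (fun t => u (x - p) (y - t))).
      2:{ apply (derivable_refl (fun t => u (x - p) t)), Dy. }
      apply (derivable_pt_lim_plus (fun t => u (x + p) (y + t) + u (x + p) (y - t)) (fun t => u (x - p) (y + t))).
      2:{ apply (derivable_shift (fun t => u (x - p) t)), Dy. }
      apply (derivable_pt_lim_plus (fun t => u (x + p) (y + t)) (fun t => u (x + p) (y - t))).
      - apply (derivable_shift (fun t => u (x + p) t)), Dy.
      - apply (derivable_refl (fun t => u (x + p) t)), Dy. }
    split; [apply (HQ _ Sp Sq); auto using sym_diff_0|].
    intros p q Hp Hq Hn. destruct (le_nrm p q Hp Hq).
    pose proof (taylor_2d (sym_diff u x y) Sp Sq (4 * K) (beta - 1) 0 0 p q (nrm p q) ltac:(lra) Dp Dq HSp HSq Hn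
      ltac:(rewrite Rminus_0_r, Rabs_pos_eq; assumption) ltac:(rewrite Rminus_0_r, Rabs_pos_eq; assumption)) as T.
    rewrite sym_diff_0, Sp0, Sq0 in T. replace (beta - 1 + 1) with beta in T by ring.
    replace (sym_diff u x y p q - 0 - _) with (sym_diff u x y p q) in T by ring. exact T.
Qed.

Lemma regular_Ck alpha gamma eps u : 0 < alpha < 2 -> 0 < eps <= 1 + IZR (Int_part alpha) - alpha ->
  CkHolder (Z.to_nat (Int_part alpha)) (alpha - IZR (Int_part alpha) + eps) u ->
  exists K C, 0 <= K /\ 0 <= C /\ regular alpha gamma (alpha + eps) K C u.
Proof.
  intros Ha He Hu. destruct (base_Int_part alpha) as [I1 I2].
  destruct (Rlt_le_dec alpha 1) as [H1|H1].
  - assert (E : Int_part alpha = 0%Z).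
    { assert (Int_part alpha < 1)%Z by (apply lt_IZR; lra).
      assert (-1 < Int_part alpha)%Z by (apply lt_IZR; lra). lia. }
    rewrite E in *. destruct Hu as [_ Hu]. apply regular_C0; [lra|].
    replace (alpha + eps) with (alpha - 0 + eps) by ring. exact Hu.
  - assert (E : Int_part alpha = 1%Z).
    { assert (Int_part alpha < 2)%Z by (apply lt_IZR; lra).
      assert (0 < Int_part alpha)%Z by (apply lt_IZR; lra). lia. }
    rewrite E in *. destruct Hu as (_ & fx & fy & Dx & Dy & [_ Hfx] & [_ Hfy]).
    apply (regular_C1 _ _ _ u fx fy); [lra|assumption|assumption| |].
    + replace (alpha + eps - 1) with (alpha - 1 + eps) by ring. exact Hfx.
    + replace (alpha + eps - 1) with (alpha - 1 + eps) by ring. exact Hfy.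
Qed.

(** * Principal value and assembly *)

(** Truncated by a square, as in [is_D2_int]: with [r = L] it is the far integrand of the scheme,
    with [r = h] the kernel off the origin cell. *)
Definition far_ker (r s p q : R) : R :=
  if Rle_dec r (Rmax p q) then Rpower (nrm p q) (- s) else 0.

Lemma far_ker_bounds r s p q : 0 < r -> 0 <= s -> 0 <= p -> 0 <= q -> 0 <= far_ker r s p q <= Rpower r (- s).
Proof.
  intros Hr Hs Hp Hq. unfold far_ker. pose proof (Rpower_pos r (- s)).
  destruct Rle_dec as [H1|H1]; [|lra]. split; [apply Rpower_nonneg|].
  apply Rpower_anti; [assumption|assumption|]. eapply Rle_trans; [exact H1|apply Rmax_le_nrm; assumption].
Qed.

Lemma far_ker_rect_int r s a b c d : 0 < r -> 0 <= s -> 0 <= a -> a <= b -> 0 <= c -> c <= d ->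
  exists l, 0 <= l /\ rect_int (far_ker r s) a b c d l.
Proof.
  intros Hr Hs Ha Hab Hc Hcd.
  destruct (osc_integrable_rect_int (far_ker r s) a b c d Hab Hcd) as [l Hl].
  - apply osc_integrable_ext with (fun p q => (fun p q => if Rle_dec r (Rmax p q) then 1 else 0) p q *
      Rpower (Rmax r (nrm p q)) (- s)); try assumption.
    + intros p q Hp Hq. unfold far_ker. destruct Rle_dec as [H|H]; [|ring].
      rewrite Rmax_right; [ring|]. eapply Rle_trans; [exact H|apply Rmax_le_nrm; lra].
    + apply osc_integrable_mult; try assumption.
      * apply osc_integrable_mono; try assumption. intros p q p' q' H1 H2 H3 H4 H5 H6.
        assert (Rmax p q <= Rmax p' q') by (unfold Rmax; repeat destruct Rle_dec; lra).
        repeat destruct Rle_dec; lra.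
      * apply osc_integrable_anti; try assumption. intros p q p' q' H1 H2 H3 H4 H5 H6.
        pose proof (nrm_mono p q p' q' ltac:(lra) ltac:(lra) H2 H5).
        apply Rpower_anti; [assumption|unfold Rmax; destruct Rle_dec; lra|].
        apply Rle_max_compat_l; assumption.
  - exists l; split; [|assumption]. eapply rect_int_le; [|apply rect_int_zero|exact Hl].
    intros; apply far_ker_bounds; lra.
Qed.

Lemma rect_int_dom_mono f a b c d A B C D l m : A <= a -> b <= B -> C <= c -> d <= D ->
  (forall p q, A <= p < B -> C <= q < D -> 0 <= f p q) ->
  rect_int f a b c d l -> rect_int f A B C D m -> l <= m.
Proof.
  intros H1 H2 H3 H4 H Hl Hm. eapply rect_int_le; [|apply (rect_int_sub f a b c d A B C D); eassumption|exact Hm].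
  intros p q Hp Hq. simpl. specialize (H p q Hp Hq).
  destruct (ind_cases a b c d p q) as [(? & ? & E)|[? E]]; rewrite E; lra.
Qed.

(** The limit is needed along rectangles with two independent large sides: a square about the origin
    of the plane is cut by [x] into four quadrants of unequal sizes. The integrals over squares
    increase to [W], and a rectangle lies between two squares. *)
Lemma far_limit L s : 0 < L -> 2 < s -> exists W, forall eps, 0 < eps -> exists R0, 0 < R0 /\
  forall X Y v, R0 <= X -> R0 <= Y -> rect_int (far_ker L s) 0 X 0 Y v -> Rabs (v - W) < eps.
Proof.
  intros HL Hs. destruct (far_bound s Hs) as (C & HC & HB).
  assert (Hpos : forall X Y p q, 0 <= p < X -> 0 <= q < Y -> 0 <= far_ker L s p q)
    by (intros; apply far_ker_bounds; lra).
  set (E := fun z => exists X, 0 < X /\ rect_int (far_ker L s) 0 X 0 X z).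
  destruct (completeness E) as [W [HW1 HW2]].
  - exists (1 * C * Rpower L (2 - s)). intros z (X & HX & Hz). eapply Rle_trans; [apply Rle_abs|].
    apply (HB (far_ker L s) 0 X 0 X z 1 L); try lra; try assumption.
    + intros p q Hp Hq Hm. unfold far_ker. destruct Rle_dec; [|contradiction].
      rewrite Rabs_pos_eq by apply Rpower_nonneg. unfold ker; lra.
    + intros p q Hp Hq Hm. unfold far_ker. destruct Rle_dec; lra.
  - destruct (far_ker_rect_int L s 0 1 0 1) as (l & _ & Hl); try lra. exists l, 1. split; [lra|assumption].
  - exists W. intros eps He.
    assert (Hz : exists z, E z /\ W - eps < z).
    { apply Classical_Prop.NNPP. intros Hn. assert (W <= W - eps); [|lra].
      apply HW2. intros z Hz. apply Rnot_lt_le. intros Hlt. apply Hn. exists z; split; assumption. }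
    destruct Hz as (z & (R0 & HR0 & Hz) & Hlt). exists R0; split; [assumption|].
    intros X Y v HX HY Hv. pose proof (Rmax_l X Y). pose proof (Rmax_r X Y).
    destruct (far_ker_rect_int L s 0 (Rmax X Y) 0 (Rmax X Y)) as (m & _ & Hm); try lra.
    assert (z <= v) by (eapply (rect_int_dom_mono (far_ker L s) 0 R0 0 R0 0 X 0 Y); eauto; lra).
    assert (v <= m) by (eapply (rect_int_dom_mono (far_ker L s) 0 X 0 Y 0 (Rmax X Y) 0 (Rmax X Y)); eauto; lra).
    assert (m <= W) by (apply HW1; exists (Rmax X Y); split; [lra|assumption]).
    apply Rabs_def1; lra.
Qed.

Lemma far_D2_int L s W : 0 < L -> 0 <= s ->
  (forall eps, 0 < eps -> exists R0, 0 < R0 /\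
    forall X Y v, R0 <= X -> R0 <= Y -> rect_int (far_ker L s) 0 X 0 Y v -> Rabs (v - W) < eps) ->
  is_D2_int (fun p q => Rpower (nrm p q) (- s)) L W.
Proof.
  intros HL Hs HW eps He. destruct (HW eps He) as (R0 & HR0 & H). exists R0. intros Rr HRr.
  destruct (far_ker_rect_int L s 0 Rr 0 Rr) as (v & _ & Hv); try lra.
  exists v; split; [|apply (H Rr Rr); [lra|lra|assumption]].
  apply (rect_int_closed (far_ker L s) 0 Rr 0 Rr v (Rpower L (- s))); try lra; [|assumption].
  intros p q Hp Hq. destruct (far_ker_bounds L s p q); try lra. rewrite Rabs_pos_eq; assumption.
Qed.

(** Reflection about the midline, that is [p] to [- p] followed by translation by [a + b], preserves
    the rectangle and reverses the sign of the integrand, so the integral equals its own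
    negative. *)
Lemma rect_int_centred_x k a b c d : a <= b -> c <= d -> rect_int (fun p _ => k * (p - (a + b) / 2)) a b c d 0.
Proof.
  intros Hab Hcd. set (m := (a + b) / 2).
  assert (HO : osc_integrable (fun p _ => p - m) a b c d) by (apply osc_integrable_mono; intros; lra).
  destruct (osc_integrable_rect_int _ a b c d Hab Hcd HO) as [l Hl]. destruct HO as [[B HB] _].
  pose proof (rect_int_reflx _ _ _ _ _ _ B Hab Hcd HB Hl) as Hr.
  pose proof (rect_int_trans _ _ _ _ _ _ (a + b) 0 Hr) as Ht. rewrite !Rplus_0_r in Ht.
  replace (- b + (a + b)) with a in Ht by ring. replace (- a + (a + b)) with b in Ht by ring.
  apply (rect_int_scal (-1)) in Ht.
  assert (E : l = -1 * l).
  { eapply rect_int_unique; [exact Hl|]. eapply rect_int_ext; [|exact Ht]. intros; simpl. unfold m; field. }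
  replace 0 with (k * l) by (replace l with 0 by lra; ring). apply rect_int_scal. exact Hl.
Qed.

Lemma rect_int_centred v1 v2 a b c d : a <= b -> c <= d ->
  rect_int (fun p q => v1 * (p - (a + b) / 2) + v2 * (q - (c + d) / 2)) a b c d 0.
Proof.
  intros Hab Hcd. rewrite <- (Rplus_0_r 0). apply rect_int_plus; [apply rect_int_centred_x; assumption|].
  exact (rect_int_swap _ _ _ _ _ _ (rect_int_centred_x v2 c d a b Hcd Hab)).
Qed.

Lemma sing_int_ext f g a b c d l : (forall p q, f p q = g p q) -> sing_int f a b c d l -> sing_int g a b c d l.
Proof.
  intros H Hf eps He. destruct (Hf eps He) as (d0 & Hd0 & K). exists d0; split; [assumption|].
  intros dl Hdl. destruct (K dl Hdl) as (v & Hv & A). exists v; split; [|assumption].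
  eapply rect_int_ext; [|exact Hv]. intros; unfold cut. rewrite H. reflexivity.
Qed.

(** * Folding the principal value onto one quadrant *)

Section Fold.
Variables (alpha : R) (u : R -> R -> R) (L x y : R).
Let s := 2 + alpha.
(** [G] is the truncated integrand of the principal value in the original coordinates; [Fq] is its
    pullback from the quadrant about the point [x], [y] selected by the signs [sg] and [tu]. *)
Let gq sg tu p q := -1 * u (x + sg * p) (y + tu * q) + u x y.
Let Fq dl sg tu := cut dl (fun p q => gq sg tu p q * ker s p q).
Let G dl p q := if Rlt_dec dl (nrm (x - p) (y - q))
  then (u x y - u p q) / Rpower (nrm (x - p) (y - q)) (2 + alpha) else 0.
Hypothesis Halpha : 0 < alpha.
Hypothesis HL : 0 < L.
Hypothesis Hu : unif_cont_bdd u.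
Hypothesis Hout : forall sg tu p q, Rabs sg = 1 -> Rabs tu = 1 -> 0 <= p -> 0 <= q -> L <= Rmax p q ->
  u (x + sg * p) (y + tu * q) = 0.

Lemma Fq_osc_integrable dl sg tu a b c d : Rabs sg = 1 -> Rabs tu = 1 -> 0 < dl -> 0 <= a -> a <= b -> 0 <= c -> c <= d ->
  osc_integrable (Fq dl sg tu) a b c d.
Proof.
  intros. apply osc_integrable_cut_ker; try assumption; [unfold s; lra|].
  apply unif_cont_bdd_osc_integrable; try assumption. apply unif_cont_bdd_plus; [apply unif_cont_bdd_affine; assumption|apply unif_cont_bdd_const].
Qed.

(** Beyond the square of side [L] the reflected value of [u] vanishes and the excised disc is not
    felt, so the integrand is [u x y] times the far kernel. *)
Lemma Fq_split dl sg tu X Y w A : Rabs sg = 1 -> Rabs tu = 1 -> 0 < dl < L -> L <= X -> L <= Y ->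
  rect_int (far_ker L s) 0 X 0 Y w -> rect_int (Fq dl sg tu) 0 L 0 L A -> rect_int (Fq dl sg tu) 0 X 0 Y (A + u x y * w).
Proof.
  intros Hs Ht Hdl HX HY Hw HA.
  eapply rect_int_ext; [|apply rect_int_plus; [apply (rect_int_sub _ 0 L 0 L 0 X 0 Y) in HA; [exact HA|lra..]|
    apply (rect_int_scal (u x y)), Hw]].
  intros p q Hp Hq. simpl. unfold far_ker.
  pose proof (Rmax_l p q). pose proof (Rmax_r p q).
  destruct Rle_dec as [Hm|Hm].
  - rewrite ind_out by (unfold Rmax in Hm; destruct Rle_dec; lra).
    pose proof (Rmax_le_nrm p q ltac:(lra) ltac:(lra)).
    unfold Fq, cut. destruct Rlt_dec; [|lra]. unfold gq. rewrite Hout by (try assumption; lra).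
    unfold ker. ring.
  - rewrite ind_in by lra. ring.
Qed.

Lemma G_Fq dl sg tu p q P Q : sg * sg = 1 -> tu * tu = 1 -> P = sg * (p - x) -> Q = tu * (q - y) ->
  Fq dl sg tu P Q = G dl p q.
Proof.
  intros Hs Ht -> ->. unfold Fq, G, cut, gq, ker, s.
  assert (E : nrm (sg * (p - x)) (tu * (q - y)) = nrm (x - p) (y - q)).
  { unfold nrm. f_equal.
    replace (sg * (p - x) * (sg * (p - x)) + tu * (q - y) * (tu * (q - y))) with
      (sg * sg * ((p - x) * (p - x)) + tu * tu * ((q - y) * (q - y))) by ring.
    rewrite Hs, Ht. ring. }
  rewrite E. destruct Rlt_dec; [|reflexivity].
  replace (x + sg * (sg * (p - x))) with (x + sg * sg * (p - x)) by ring.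
  replace (y + tu * (tu * (q - y))) with (y + tu * tu * (q - y)) by ring. rewrite Hs, Ht.
  replace (x + 1 * (p - x)) with p by ring. replace (y + 1 * (q - y)) with q by ring.
  rewrite Rpower_Ropp. unfold Rdiv. ring.
Qed.

Lemma G_bound dl Rr : 0 < dl -> exists M, forall p q, - Rr <= p <= Rr -> - Rr <= q <= Rr -> Rabs (G dl p q) <= M.
Proof.
  intros Hdl. set (X := Rabs Rr + 1). pose proof (Rabs_pos Rr).
  destruct (Hu X ltac:(unfold X; lra)) as [[B HB] _].
  exists ((Rabs (u x y) + B) * Rpower dl (- s)). intros p q Hp Hq.
  assert (Hb : forall p, - Rr <= p <= Rr -> Rabs p <= X).
  { intros z Hz. unfold X. revert H. unfold Rabs; repeat destruct Rcase_abs; lra. }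
  specialize (HB p q (Hb p Hp) (Hb q Hq)).
  assert (0 <= B) by (eapply Rle_trans; [apply Rabs_pos|exact HB]).
  assert (0 <= Rabs (u x y) + B) by (pose proof (Rabs_pos (u x y)); lra).
  unfold G. destruct Rlt_dec as [Hn|Hn].
  - unfold Rdiv. rewrite <- Rpower_Ropp. fold s. apply Rabs_mult_le.
    + apply Rabs_plus_le; [lra|]. rewrite Rabs_Ropp; assumption.
    + rewrite Rabs_pos_eq by apply Rpower_nonneg. apply Rpower_anti; [unfold s; lra|assumption|lra].
  - rewrite Rabs_R0. apply Rmult_le_pos; [assumption|apply Rpower_nonneg].
Qed.

(** The box is centred at the origin of the plane and not at [x], so the four quadrants have
    different sides and the far parts stay distinct, while the near parts share one square and add
    up to [- v]. *)
Lemma pv_square dl Rr w1 w2 w3 w4 v : 0 < dl < L -> L <= Rr - x -> L <= Rr + x -> L <= Rr - y -> L <= Rr + y ->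
  rect_int (far_ker L s) 0 (Rr - x) 0 (Rr - y) w1 -> rect_int (far_ker L s) 0 (Rr - x) 0 (Rr + y) w2 ->
  rect_int (far_ker L s) 0 (Rr + x) 0 (Rr - y) w3 -> rect_int (far_ker L s) 0 (Rr + x) 0 (Rr + y) w4 ->
  rect_int (cut dl (fun p q => sym_diff u x y p q * ker s p q)) 0 L 0 L v ->
  is_RInt2 (G dl) (- Rr) Rr (- Rr) Rr (- v + u x y * (w1 + w2 + w3 + w4)).
Proof.
  intros Hdl Hx1 Hx2 Hy1 Hy2 W1 W2 W3 W4 Hv.
  assert (A1 : Rabs 1 = 1) by (apply Rabs_pos_eq; lra).
  assert (A2 : Rabs (-1) = 1) by (rewrite Rabs_left; lra).
  assert (P1 : 1 * 1 = 1) by ring. assert (P2 : -1 * -1 = 1) by ring.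
  destruct (osc_integrable_rect_int _ 0 L 0 L ltac:(lra) ltac:(lra) (Fq_osc_integrable dl 1 1 0 L 0 L A1 A1 ltac:(lra) ltac:(lra) ltac:(lra) ltac:(lra) ltac:(lra))) as [a1 Ha1].
  destruct (osc_integrable_rect_int _ 0 L 0 L ltac:(lra) ltac:(lra) (Fq_osc_integrable dl 1 (-1) 0 L 0 L A1 A2 ltac:(lra) ltac:(lra) ltac:(lra) ltac:(lra) ltac:(lra))) as [a2 Ha2].
  destruct (osc_integrable_rect_int _ 0 L 0 L ltac:(lra) ltac:(lra) (Fq_osc_integrable dl (-1) 1 0 L 0 L A2 A1 ltac:(lra) ltac:(lra) ltac:(lra) ltac:(lra) ltac:(lra))) as [a3 Ha3].
  destruct (osc_integrable_rect_int _ 0 L 0 L ltac:(lra) ltac:(lra) (Fq_osc_integrable dl (-1) (-1) 0 L 0 L A2 A2 ltac:(lra) ltac:(lra) ltac:(lra) ltac:(lra) ltac:(lra))) as [a4 Ha4].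
  assert (Ea : a1 + a2 + a3 + a4 = -1 * v).
  { eapply rect_int_unique; [apply rect_int_plus; [apply rect_int_plus; [apply rect_int_plus|]|]; eassumption|].
    eapply rect_int_ext; [|apply (rect_int_scal (-1)), Hv]. intros p q _ _. unfold Fq, cut, gq, sym_diff.
    replace (x + 1 * p) with (x + p) by ring. replace (y + 1 * q) with (y + q) by ring.
    replace (x + -1 * p) with (x - p) by ring. replace (y + -1 * q) with (y - q) by ring.
    destruct Rlt_dec; ring. }
  pose proof (Fq_split dl 1 1 _ _ w1 a1 A1 A1 Hdl Hx1 Hy1 W1 Ha1) as Q1.
  pose proof (Fq_split dl 1 (-1) _ _ w2 a2 A1 A2 Hdl Hx1 Hy2 W2 Ha2) as Q2.
  pose proof (Fq_split dl (-1) 1 _ _ w3 a3 A2 A1 Hdl Hx2 Hy1 W3 Ha3) as Q3.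
  pose proof (Fq_split dl (-1) (-1) _ _ w4 a4 A2 A2 Hdl Hx2 Hy2 W4 Ha4) as Q4.
  assert (HB : forall sg tu X Y, Rabs sg = 1 -> Rabs tu = 1 -> 0 <= X -> 0 <= Y ->
    exists M, forall p q, 0 <= p <= X -> 0 <= q <= Y -> Rabs (Fq dl sg tu p q) <= M).
  { intros sg tu X Y H1 H2 HX HY. apply (Fq_osc_integrable dl sg tu 0 X 0 Y); assumption || lra. }
  apply (rect_int_trans _ _ _ _ _ _ x y) in Q1.
  destruct (HB 1 (-1) (Rr - x) (Rr + y) A1 A2 ltac:(lra) ltac:(lra)) as [M2 HM2].
  apply (rect_int_refly _ _ _ _ _ _ M2) in Q2; [|lra|lra|assumption].
  apply (rect_int_trans _ _ _ _ _ _ x y) in Q2.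
  destruct (HB (-1) 1 (Rr + x) (Rr - y) A2 A1 ltac:(lra) ltac:(lra)) as [M3 HM3].
  apply (rect_int_reflx _ _ _ _ _ _ M3) in Q3; [|lra|lra|assumption].
  apply (rect_int_trans _ _ _ _ _ _ x y) in Q3.
  destruct (HB (-1) (-1) (Rr + x) (Rr + y) A2 A2 ltac:(lra) ltac:(lra)) as [M4 HM4].
  apply (rect_int_reflx _ _ _ _ _ _ M4) in Q4; [|lra|lra|assumption].
  apply (rect_int_refly _ _ _ _ _ _ M4) in Q4; [|lra|lra|intros; apply HM4; lra].
  apply (rect_int_trans _ _ _ _ _ _ x y) in Q4.
  replace (0 + x) with x in Q1, Q2 by ring. replace (0 + y) with y in Q1, Q3 by ring.
  replace (- 0 + x) with x in Q3, Q4 by ring. replace (- 0 + y) with y in Q2, Q4 by ring.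
  replace (Rr - x + x) with Rr in Q1, Q2 by ring. replace (Rr - y + y) with Rr in Q1, Q3 by ring.
  replace (- (Rr + y) + y) with (- Rr) in Q2, Q4 by ring.
  replace (- (Rr + x) + x) with (- Rr) in Q3, Q4 by ring.
  assert (T1 : rect_int (G dl) x Rr y Rr (a1 + u x y * w1)).
  { eapply rect_int_ext; [|exact Q1]. intros p q _ _; simpl. apply G_Fq; [assumption|assumption|ring|ring]. }
  assert (T2 : rect_int (G dl) x Rr (- Rr) y (a2 + u x y * w2)).
  { eapply rect_int_ext; [|exact Q2]. intros p q _ _; simpl. apply G_Fq; [assumption|assumption|ring|ring]. }
  assert (T3 : rect_int (G dl) (- Rr) x y Rr (a3 + u x y * w3)).
  { eapply rect_int_ext; [|exact Q3]. intros p q _ _; simpl. apply G_Fq; [assumption|assumption|ring|ring]. }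
  assert (T4 : rect_int (G dl) (- Rr) x (- Rr) y (a4 + u x y * w4)).
  { eapply rect_int_ext; [|exact Q4]. intros p q _ _; simpl. apply G_Fq; [assumption|assumption|ring|ring]. }
  destruct (G_bound dl Rr ltac:(lra)) as [M HM].
  apply (rect_int_closed _ _ _ _ _ _ M); [lra|lra|assumption|].
  replace (- v + u x y * (w1 + w2 + w3 + w4)) with
    ((a4 + u x y * w4 + (a3 + u x y * w3)) + (a2 + u x y * w2 + (a1 + u x y * w1))).
  - apply (rect_int_addx _ _ x); [lra|lra| |]; apply (rect_int_addy _ _ _ _ y); lra || assumption.
  - replace (- v) with (a1 + a2 + a3 + a4) by lra. ring.
Qed.

(** For a fixed excision radius the near part [v] does not depend on the outer box and the four far
    parts each tend to [W], so the integral over the plane is exactly [4 * u x y * W - v]. Only then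
    does the radius shrink. *)
Lemma pv_fold J W :
  sing_int (fun p q => sym_diff u x y p q * ker s p q) 0 L 0 L J ->
  (forall eps, 0 < eps -> exists R0, 0 < R0 /\
    forall X Y v, R0 <= X -> R0 <= Y -> rect_int (far_ker L s) 0 X 0 Y v -> Rabs (v - W) < eps) ->
  is_pv alpha u x y (4 * u x y * W - J).
Proof.
  intros HJ HW eps He. destruct (HJ eps He) as (d0 & Hd0 & HJd).
  exists (Rmin d0 L). split; [unfold Rmin; destruct Rle_dec; lra|]. intros dl Hdl.
  pose proof (Rmin_l d0 L). pose proof (Rmin_r d0 L).
  destruct (HJd dl ltac:(lra)) as (v & Hv & Av).
  exists (4 * u x y * W - v). split.
  2:{ replace (4 * u x y * W - v - (4 * u x y * W - J)) with (- (v - J)) by ring.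
      rewrite Rabs_Ropp; assumption. }
  intros eps' He'. pose proof (Rabs_pos (u x y)) as Hup.
  set (e := eps' / (4 * (Rabs (u x y) + 1))).
  assert (Hepos : 0 < e) by (apply Rdiv_lt_0_compat; lra).
  destruct (HW e Hepos) as (R1 & HR1 & HWd).
  exists (R1 + L + Rabs x + Rabs y). intros Rr HRr.
  pose proof (Rle_abs x). pose proof (Rle_abs y). pose proof (Rle_abs (- x)) as Nx. pose proof (Rle_abs (- y)) as Ny.
  rewrite Rabs_Ropp in Nx, Ny. pose proof (Rabs_pos x). pose proof (Rabs_pos y).
  assert (Hs : 0 <= s) by (unfold s; lra).
  destruct (far_ker_rect_int L s 0 (Rr - x) 0 (Rr - y)) as (w1 & _ & W1); try lra.
  destruct (far_ker_rect_int L s 0 (Rr - x) 0 (Rr + y)) as (w2 & _ & W2); try lra.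
  destruct (far_ker_rect_int L s 0 (Rr + x) 0 (Rr - y)) as (w3 & _ & W3); try lra.
  destruct (far_ker_rect_int L s 0 (Rr + x) 0 (Rr + y)) as (w4 & _ & W4); try lra.
  exists (- v + u x y * (w1 + w2 + w3 + w4)). split.
  - apply (pv_square dl Rr w1 w2 w3 w4 v); lra || assumption.
  - replace (- v + u x y * (w1 + w2 + w3 + w4) - (4 * u x y * W - v)) with
      (u x y * ((w1 - W) + (w2 - W) + (w3 - W) + (w4 - W))) by ring.
    apply HWd in W1; try lra. apply HWd in W2; try lra. apply HWd in W3; try lra. apply HWd in W4; try lra.
    assert (E4 : Rabs ((w1 - W) + (w2 - W) + (w3 - W) + (w4 - W)) <= e + e + e + e)
      by (repeat apply Rabs_plus_le; lra).
    rewrite Rabs_mult. apply Rle_lt_trans with (Rabs (u x y) * (e + e + e + e)).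
    + apply Rmult_le_compat_l; assumption.
    + assert (E : eps' = 4 * (Rabs (u x y) + 1) * e) by (unfold e; field; lra). rewrite E. nra.
Qed.
End Fold.

(** Integrals are relations, so the values on the cells have to be collected into a function; the
    grid being finite, induction does it. *)
Lemma fin_choice (T : Type) (t0 : T) n (P : nat -> T -> Prop) :
  (forall i, (i < n)%nat -> exists t, P i t) -> exists f, forall i, (i < n)%nat -> P i (f i).
Proof.
  induction n as [|n IH]; intros H; [exists (fun _ => t0); intros; lia|].
  destruct IH as [f Hf]; [intros; apply H; lia|]. destruct (H n ltac:(lia)) as [t Ht].
  exists (fun i => if Nat.eq_dec i n then t else f i). intros i Hi.
  destruct Nat.eq_dec as [->|]; [assumption|apply Hf; lia].
Qed.

Lemma fin_choice2 n (P : nat -> nat -> R -> Prop) :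
  (forall i j, (i < n)%nat -> (j < n)%nat -> exists t, P i j t) ->
  exists f, forall i j, (i < n)%nat -> (j < n)%nat -> P i j (f i j).
Proof.
  intros H.
  destruct (fin_choice (nat -> R) (fun _ => 0) n (fun i g => forall j, (j < n)%nat -> P i j (g j)))
    as [f Hf].
  - intros i Hi. apply (fin_choice R 0 n (P i)). intros; apply H; assumption.
  - exists f. intros; apply Hf; assumption.
Qed.

(** * Summation of the cell errors *)

Definition is_origin_cell (i j : nat) : bool := andb (Nat.eqb i 0) (Nat.eqb j 0).

Lemma sum2_00 n f : sum2 (S n) (S n) f =
  f O O + sum2 (S n) (S n) (fun i j => if is_origin_cell i j then 0 else f i j).
Proof.
  unfold sum2. rewrite (fsum_S_l n (fun i => fsum (S n) (f i))).
  rewrite (fsum_S_l n (fun i => fsum (S n) (fun j => if is_origin_cell i j then 0 else f i j))).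
  rewrite (fsum_S_l n (f O)), (fsum_S_l n (fun j => if is_origin_cell 0 j then 0 else f O j)).
  rewrite (fsum_ext n (fun i => fsum (S n) (fun j => if is_origin_cell (S i) j then 0 else f (S i) j))
    (fun i => fsum (S n) (f (S i)))) by reflexivity.
  rewrite (fsum_ext n (fun i => if is_origin_cell 0 (S i) then 0 else f 0%nat (S i)) (fun i => f 0%nat (S i))) by reflexivity.
  change (is_origin_cell 0 0) with true. cbv iota. ring.
Qed.

Lemma cell_error alpha gamma beta C S X Y h w J t : 0 <= C ->
  off_origin X Y h -> quad_error alpha gamma beta C S ->
  rect_int (ker (2 + alpha - gamma)) X (X + h) Y (Y + h) w ->
  rect_int (fun p q => S p q * ker (2 + alpha) p q) X (X + h) Y (Y + h) J ->
  rect_int (ker (2 + alpha)) X (X + h) Y (Y + h) t ->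
  Rabs (corner_avg (fun p q => ker gamma p q * S p q) X Y h * w - J) <= C * Rpower h beta * t.
Proof.
  intros HC Ho HQ Hw HJ Ht. destruct (HQ X Y h Ho) as (v1 & v2 & H). destruct Ho as (_ & _ & Hh & _).
  set (av := corner_avg _ _ _ _) in *.
  pose proof (rect_int_centred v1 v2 X (X + h) Y (Y + h) ltac:(lra) ltac:(lra)) as H0.
  replace (av * w - J) with (av * w - J - 0) by ring.
  eapply rect_int_abs_le; [|apply rect_int_minus; [apply rect_int_minus; [apply (rect_int_scal av), Hw|exact HJ]|exact H0]
    |apply (rect_int_scal (C * Rpower h beta)), Ht].
  intros p q Hp Hq. specialize (H p q ltac:(split; lra)). simpl.
  replace ((X + (X + h)) / 2) with (X + h / 2) by field.
  replace ((Y + (Y + h)) / 2) with (Y + h / 2) by field.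
  replace (av * ker (2 + alpha - gamma) p q - S p q * ker (2 + alpha) p q) with
    ((av - ker gamma p q * S p q) * ker (2 + alpha - gamma) p q); [exact H|].
  unfold ker. replace (- (2 + alpha)) with (- gamma + - (2 + alpha - gamma)) by ring.
  rewrite Rpower_plus. ring.
Qed.

(** [T] stands for the corner combination on the origin cell. Only its size enters, so both choices
    of the weights [cg] are covered at once. [C'] is fixed before [S] and [N], hence uniform in the
    point and in the grid. *)
Lemma quadrature_error alpha gamma eps K C L M : 0 < alpha < 2 -> alpha < gamma <= 2 -> 0 < eps <= 1 ->
  0 <= K -> 0 <= C -> 0 < L -> 0 <= M ->
  exists C', 0 <= C' /\ forall S N, unif_cont_bdd S -> quad_error alpha gamma (alpha + eps) C S ->
    (forall p q, 0 <= p -> 0 <= q -> 0 < nrm p q -> Rabs (S p q) <= K * Rpower (nrm p q) (alpha + eps)) ->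
    (0 < N)%nat -> let h := L / INR N in
    exists (w : nat -> nat -> R) J,
      (forall i j, (i < N)%nat -> (j < N)%nat ->
         sing_int (omega alpha gamma) (INR i * h) (INR (Datatypes.S i) * h) (INR j * h) (INR (Datatypes.S j) * h) (w i j)) /\
      sing_int (fun p q => S p q * ker (2 + alpha) p q) 0 L 0 L J /\
      forall T, Rabs T <= M * Rpower h (alpha + eps - gamma) ->
        Rabs (T * w O O + sum2 N N (fun i j => if is_origin_cell i j then 0 else
          corner_avg (fun p q => ker gamma p q * S p q) (INR i * h) (INR j * h) h * w i j) - J)
        <= C' * Rpower h eps.
Proof.
  intros Ha Hg He HK HC HL HM.
  (* Integrability of the weight at the origin is the condition [alpha < gamma]. The exponent
     [2 - eps] is that of [S] times the kernel, as [S] contributes [alpha + eps] powers. *)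
  destruct (sing_int_near (2 + alpha - gamma) ltac:(lra)) as (Cw & HCw & Bw).
  destruct (sing_int_near (2 - eps) ltac:(lra)) as (Cj & HCj & Bj).
  destruct (far_bound (2 + alpha) ltac:(lra)) as (Cf & HCf & Bf).
  (* In order: the scheme on the origin cell, the exact integral there, and all remaining cells. *)
  exists (M * Cw + K * Cj + C * Cf). split.
  { repeat apply Rplus_le_le_0_compat; apply Rmult_le_pos; assumption. }
  intros S N HS HQ HSK HN h.
  assert (HN' : 0 < INR N) by (apply lt_0_INR; assumption).
  assert (Hh : 0 < h) by (apply Rdiv_lt_0_compat; assumption).
  assert (HhN : INR N * h = L) by (unfold h; field; lra). clearbody h.
  set (x := fun i => INR i * h).
  assert (x0 : x O = 0) by (unfold x; simpl; ring).
  assert (xS : forall i, x (Datatypes.S i) = x i + h) by (intros; unfold x; rewrite S_INR; ring).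
  assert (xpos : forall i, 0 <= x i) by (intros; unfold x; apply Rmult_le_pos; [apply pos_INR|lra]).
  assert (Hbnd : forall p q, 0 <= p -> 0 <= q -> 0 < nrm p q ->
     Rabs (S p q * ker (2 + alpha) p q) <= K * ker (2 - eps) p q).
  { intros p q Hp Hq Hn. rewrite Rabs_mult, (Rabs_pos_eq (ker _ _ _)) by (left; apply ker_pos).
    unfold ker. replace (- (2 - eps)) with ((alpha + eps) + - (2 + alpha)) by ring. rewrite Rpower_plus.
    rewrite <- Rmult_assoc. apply Rmult_le_compat_r; [apply Rpower_nonneg|]. apply HSK; assumption. }
  assert (Hw : exists w, forall i j, (i < N)%nat -> (j < N)%nat ->
     sing_int (ker (2 + alpha - gamma)) (x i) (x (Datatypes.S i)) (x j) (x (Datatypes.S j)) (w i j)).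
  { apply (fin_choice2 N (fun i j => sing_int (ker (2 + alpha - gamma)) (x i) (x (Datatypes.S i)) (x j) (x (Datatypes.S j)))).
    intros i j _ _. pose proof (xpos i). pose proof (xpos j).
    destruct (sing_int_exists (fun _ _ => 1) (2 + alpha - gamma) (2 + alpha - gamma) 1
      (x i) (x (Datatypes.S i)) (x j) (x (Datatypes.S j))) as [l Hl]; rewrite ?xS; try lra.
    - apply osc_integrable_mono; intros; lra.
    - intros. cbv beta. rewrite !Rmult_1_l, Rabs_pos_eq by (left; apply ker_pos). lra.
    - exists l. rewrite <- !xS. eapply sing_int_ext; [|exact Hl]. intros; simpl; ring. }
  destruct Hw as [w Hw].
  assert (HJ : exists J, forall i j, (i < N)%nat -> (j < N)%nat ->
     sing_int (fun p q => S p q * ker (2 + alpha) p q) (x i) (x (Datatypes.S i)) (x j) (x (Datatypes.S j)) (J i j)).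
  { apply (fin_choice2 N (fun i j => sing_int (fun p q => S p q * ker (2 + alpha) p q) (x i) (x (Datatypes.S i)) (x j) (x (Datatypes.S j)))).
    intros i j _ _. pose proof (xpos i). pose proof (xpos j).
    apply (sing_int_exists S (2 + alpha) (2 - eps) K); rewrite ?xS; try lra.
    - apply unif_cont_bdd_osc_integrable; [lra|lra|assumption].
    - intros. apply Hbnd; lra. }
  destruct HJ as [J HJ].
  (* Vanishing on the origin cell, [far_ker h] can be summed over the whole grid, which turns the
     sum of error bounds into a single integral over the square of side [L]. *)
  assert (Ht : exists t, forall i j, (i < N)%nat -> (j < N)%nat ->
     0 <= t i j /\ rect_int (far_ker h (2 + alpha)) (x i) (x (Datatypes.S i)) (x j) (x (Datatypes.S j)) (t i j)).
  { apply (fin_choice2 N (fun i j l => 0 <= l /\ rect_int (far_ker h (2 + alpha)) (x i) (x (Datatypes.S i)) (x j) (x (Datatypes.S j)) l)).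
    intros i j _ _. pose proof (xpos i). pose proof (xpos j). apply far_ker_rect_int; rewrite ?xS; lra. }
  destruct Ht as [t Ht].
  exists w, (sum2 N N J). destruct N as [|n]; [lia|].
  assert (xN : x (Datatypes.S n) = L) by exact HhN.
  assert (xmono : forall i, x i <= x (Datatypes.S i)) by (intros; rewrite xS; lra).
  split; [|split].
  - intros i j Hi Hj. eapply sing_int_ext; [|exact (Hw i j Hi Hj)].
    intros p q. unfold ker, omega. f_equal. ring.
  - rewrite <- x0, <- xN. apply (grid_add (sing_int (fun p q => S p q * ker (2 + alpha) p q)) x x J n n);
      try assumption; intros; [eapply sing_int_addx|eapply sing_int_addy]; eassumption.
  - intros T HT.
    assert (Tt : Rabs (sum2 (Datatypes.S n) (Datatypes.S n) t) <= 1 * Cf * Rpower h (2 - (2 + alpha))).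
    { apply (Bf (far_ker h (2 + alpha)) 0 L 0 L _ 1 h); try lra.
      - rewrite <- x0, <- xN. apply (grid_add (rect_int (far_ker h (2 + alpha))) x x t n n); try assumption.
        + intros; eapply rect_int_addx; eassumption.
        + intros; eapply rect_int_addy; eassumption.
        + intros; apply Ht; assumption.
      - intros p q Hp Hq Hm. unfold far_ker. destruct Rle_dec; [|contradiction].
        rewrite Rabs_pos_eq by apply Rpower_nonneg. unfold ker; lra.
      - intros p q Hp Hq Hm. unfold far_ker. destruct Rle_dec; lra. }
    assert (Bcell : forall i j, (i < Datatypes.S n)%nat -> (j < Datatypes.S n)%nat -> is_origin_cell i j = false ->
      Rabs (corner_avg (fun p q => ker gamma p q * S p q) (INR i * h) (INR j * h) h * w i j - J i j)
        <= C * Rpower h (alpha + eps) * t i j).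
    { intros i j Hi Hj Hij. fold (x i) (x j). pose proof (xpos i). pose proof (xpos j).
      assert (Hm : h <= Rmax (x i) (x j)).
      { assert (Hge : forall k, k <> O -> h <= x k).
        { intros k Hk. destruct k; [contradiction|]. rewrite xS. pose proof (xpos k). lra. }
        pose proof (Rmax_l (x i) (x j)). pose proof (Rmax_r (x i) (x j)).
        destruct i; [|pose proof (Hge (Datatypes.S i) ltac:(lia)); lra].
        destruct j; [discriminate|pose proof (Hge (Datatypes.S j) ltac:(lia)); lra]. }
      assert (Haway : forall p q, x i <= p < x i + h -> x j <= q < x j + h -> h <= Rmax p q).
      { intros p q Hp Hq. eapply Rle_trans; [exact Hm|]. unfold Rmax; repeat destruct Rle_dec; lra. }
      assert (Haway' : forall p q, x i <= p < x i + h -> x j <= q < x j + h -> h <= nrm p q).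
      { intros p q Hp Hq. eapply Rle_trans; [apply Haway; eassumption|apply Rmax_le_nrm; lra]. }
      specialize (Hw i j Hi Hj). specialize (HJ i j Hi Hj). destruct (Ht i j Hi Hj) as [_ Htij].
      rewrite !xS in Hw, HJ, Htij.
      apply (cell_error alpha gamma (alpha + eps) C S); try assumption.
      - repeat split; assumption.
      - apply (sing_int_away _ _ _ _ _ _ h Hh Haway' Hw).
      - apply (sing_int_away _ _ _ _ _ _ h Hh Haway' HJ).
      - eapply rect_int_ext; [|exact Htij]. intros p q Hp Hq. unfold far_ker.
        destruct Rle_dec as [|Hn]; [reflexivity|]. exfalso; apply Hn, Haway; assumption. }
    rewrite (sum2_00 n J).
    set (av := fun i j => corner_avg (fun p q => ker gamma p q * S p q) (INR i * h) (INR j * h) h).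
    set (m := Datatypes.S n) in *.
    replace (T * w O O + sum2 m m (fun i j => if is_origin_cell i j then 0 else corner_avg (fun p q => ker gamma p q * S p q) (INR i * h) (INR j * h) h * w i j) -
       (J O O + sum2 m m (fun i j => if is_origin_cell i j then 0 else J i j))) with
      (T * w O O + - J O O + sum2 m m (fun i j => if is_origin_cell i j then 0 else av i j * w i j - J i j)).
    2:{ rewrite (sum2_ext m m (fun i j => if is_origin_cell i j then 0 else av i j * w i j - J i j)
          (fun i j => (if is_origin_cell i j then 0 else av i j * w i j) - (if is_origin_cell i j then 0 else J i j)))
          by (intros; destruct is_origin_cell; ring).
        rewrite sum2_minus. unfold av. ring. }
    rewrite !Rmult_plus_distr_r.
    specialize (Hw O O ltac:(unfold m; lia) ltac:(unfold m; lia)).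
    specialize (HJ O O ltac:(unfold m; lia) ltac:(unfold m; lia)).
    rewrite xS, x0, Rplus_0_l in Hw, HJ.
    apply Rabs_plus_le; [apply Rabs_plus_le; [|rewrite Rabs_Ropp]|].
    (* The weight integrates to order [h^(gamma-alpha)], which cancels [gamma] in the size
       [h^(alpha+eps-gamma)] of [T]. *)
    + assert (Hw0 : Rabs (w O O) <= 1 * Cw * Rpower h (2 - (2 + alpha - gamma))).
      { apply (Bw (ker (2 + alpha - gamma)) 0 h 0 h _ 1 h); try lra; try assumption.
        intros. rewrite Rabs_pos_eq by (left; apply ker_pos). lra. }
      eapply Rle_trans; [apply Rabs_mult_le; [exact HT|exact Hw0]|]. right.
      replace eps with ((alpha + eps - gamma) + (2 - (2 + alpha - gamma))) at 2 by ring.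
      rewrite Rpower_plus. ring.
    + replace eps with (2 - (2 - eps)) at 1 by ring.
      apply (Bj _ 0 h 0 h _ K h ltac:(lra) ltac:(lra) ltac:(lra) ltac:(lra) Hh HK HJ).
      intros; apply Hbnd; lra.
    + eapply Rle_trans; [apply sum2_abs|].
      apply Rle_trans with (sum2 m m (fun i j => C * Rpower h (alpha + eps) * t i j)).
      * apply sum2_le. intros i j Hi Hj. destruct (is_origin_cell i j) eqn:E.
        -- rewrite Rabs_R0. destruct (Ht i j Hi Hj) as [Htp _].
           apply Rmult_le_pos; [apply Rmult_le_pos; [assumption|apply Rpower_nonneg]|assumption].
        -- apply Bcell; assumption.
      * rewrite sum2_scal. apply Rle_trans with (C * Rpower h (alpha + eps) * (1 * Cf * Rpower h (2 - (2 + alpha)))).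
        -- apply Rmult_le_compat_l; [apply Rmult_le_pos; [assumption|apply Rpower_nonneg]|].
           eapply Rle_trans; [apply Rle_abs|exact Tt].
        -- right. replace eps with ((alpha + eps) + (2 - (2 + alpha))) at 2 by ring.
           rewrite (Rpower_plus (alpha + eps) (2 - (2 + alpha))). ring.
Qed.

Lemma cg_bound gamma m n : Rabs (cg gamma m n) <= 2.
Proof. unfold cg. destruct Req_EM_T; destruct m as [|[|]], n as [|[|]]; rewrite Rabs_pos_eq; lra. Qed.

(** [Rmax p q = h] holds at the three corners of the origin cell other than the origin. The norm
    there lies between [h] and [2 h], whence the factor [2^beta]. *)
Lemma psi_corner gamma u x y K beta h p q : 0 < h -> 0 <= gamma -> 0 <= beta -> 0 <= K ->
  (forall p q, 0 <= p -> 0 <= q -> 0 < nrm p q -> Rabs (sym_diff u x y p q) <= K * Rpower (nrm p q) beta) ->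
  0 <= p -> 0 <= q -> Rmax p q = h ->
  Rabs (psi gamma u x y p q) <= K * Rpower 2 beta * Rpower h (beta - gamma).
Proof.
  intros Hh Hg Hb HK HS Hp Hq Hm.
  pose proof (Rmax_le_nrm p q Hp Hq) as H1. pose proof (nrm_le_Rmax p q Hp Hq) as H2. rewrite Hm in H1, H2.
  change (psi gamma u x y p q) with (ker gamma p q * sym_diff u x y p q).
  replace (K * Rpower 2 beta * Rpower h (beta - gamma)) with (Rpower h (- gamma) * (K * (Rpower 2 beta * Rpower h beta))).
  - apply Rabs_mult_le.
    + rewrite Rabs_pos_eq by (left; apply ker_pos). apply ker_le; assumption.
    + eapply Rle_trans; [apply HS; lra|]. apply Rmult_le_compat_l; [assumption|].
      rewrite Rpower_mult_distr by lra. apply Rpower_le; lra.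
  - replace (beta - gamma) with (- gamma + beta) by ring. rewrite Rpower_plus. ring.
Qed.

Theorem theorem1 (alpha ax bx ay by_ eps gamma : R) (u : R -> R -> R)
  (Halpha : 0 < alpha < 2) (Hx : ax < bx) (Hy : ay < by_)
  (Hsupp : forall x y, ~ (ax < x < bx /\ ay < y < by_) -> u x y = 0)
  (Heps : 0 < eps <= 1 + IZR (Int_part alpha) - alpha)
  (Hu : CkHolder (Z.to_nat (Int_part alpha)) (alpha - IZR (Int_part alpha) + eps) u)
  (Hgamma : alpha < gamma <= 2) :
  let L := Rmax (bx - ax) (by_ - ay) in
  exists C, C > 0 /\ exists h0, h0 > 0 /\
    forall N : nat, (0 < N)%nat -> L / INR N < h0 ->
      forall x y, ax < x < bx -> ay < y < by_ ->
        exists lap dlap,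
          frac_lap alpha u x y lap /\ disc_lap alpha gamma L N u x y dlap /\
          Rabs (lap - dlap) <= C * Rpower (L / INR N) eps.
Proof.
  intros L.
  pose proof (Rmax_l (bx - ax) (by_ - ay)) as HLx. pose proof (Rmax_r (bx - ax) (by_ - ay)) as HLy.
  fold L in HLx, HLy. assert (HL : 0 < L) by lra.
  destruct (c2_exists alpha Halpha) as [c Hc].
  destruct (regular_Ck alpha gamma eps u Halpha Heps Hu) as (K & C & HK & HC & HU & HR).
  assert (He1 : 0 < eps <= 1) by (destruct (base_Int_part alpha); lra).
  (* One quarter of three corner terms, each with a coefficient of at most 2. *)
  set (M := 3 / 2 * (K * Rpower 2 (alpha + eps))).
  assert (HM0 : 0 <= K * Rpower 2 (alpha + eps)) by (apply Rmult_le_pos; [assumption|apply Rpower_nonneg]).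
  assert (HM : 0 <= M) by (unfold M; lra).
  destruct (quadrature_error alpha gamma eps K C L M Halpha Hgamma He1 HK HC HL HM) as (C' & HC' & HE).
  destruct (far_limit L (2 + alpha) HL ltac:(lra)) as [W HW].
  pose proof (Rabs_pos c) as Hc0.
  (* The added 1 makes the constant strictly positive. *)
  exists (Rabs c * C' + 1). split; [assert (0 <= Rabs c * C') by (apply Rmult_le_pos; assumption); lra|].
  exists 1. split; [lra|]. intros N HN _ x y Hxx Hyy. destruct (HR x y) as [HQ HS].
  destruct (HE (sym_diff u x y) N (unif_cont_bdd_sym_diff u x y HU) HQ HS HN) as (w & J & Hw & HJ & HT).
  set (h := L / INR N) in *.
  assert (Hh : 0 < h) by (apply Rdiv_lt_0_compat; [assumption|apply lt_0_INR; assumption]).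
  exists (c * (4 * u x y * W - J)). eexists. split; [|split].
  - exists c, (4 * u x y * W - J). split; [assumption|]. split; [|reflexivity].
    apply (pv_fold alpha u L x y); try assumption; [lra|].
    (* [L] is at least both side lengths, so a shift by [L] or more in some coordinate leaves the
       rectangle from any of its points. *)
    intros sg tu p q Hs Ht Hp Hq Hm. apply Hsupp. intros [Hi1 Hi2].
    assert (Habs : forall z, Rabs z = 1 -> z = 1 \/ z = -1).
    { intros z. unfold Rabs; destruct Rcase_abs; lra. }
    unfold Rmax in Hm. destruct (Habs sg Hs) as [->| ->]; destruct (Habs tu Ht) as [->| ->];
      destruct Rle_dec; lra.
  - exists c, w, W. split; [assumption|]. split; [|split; [|reflexivity]].
    + intros i j Hi Hj. fold h.
      assert (Hst : forall k, INR k * h < INR (S k) * h) by (intros; rewrite S_INR; lra).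
      apply sing_int_cell_int; [apply Hst|apply Hst| |apply Hw; assumption].
      intros dl Hdl. exists (Rpower dl (- (2 + alpha - gamma))). intros p q Hp Hq. unfold cut.
      destruct Rlt_dec; [|rewrite Rabs_R0; apply Rpower_nonneg].
      unfold omega. rewrite Rabs_pos_eq by apply Rpower_nonneg.
      replace (gamma - (2 + alpha)) with (- (2 + alpha - gamma)) by ring. apply Rpower_anti; lra.
    + apply far_D2_int; [assumption|lra|assumption].
  - cbv zeta. fold h.
    set (T := / 4 * (cg gamma 1 0 * psi gamma u x y h 0 + cg gamma 0 1 * psi gamma u x y 0 h
             + cg gamma 1 1 * psi gamma u x y h h)).
    assert (HTb : Rabs T <= M * Rpower h (alpha + eps - gamma)).
    { set (Z := K * Rpower 2 (alpha + eps) * Rpower h (alpha + eps - gamma)).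
      assert (PC : forall p q, 0 <= p -> 0 <= q -> Rmax p q = h -> Rabs (psi gamma u x y p q) <= Z).
      { intros; apply psi_corner; try assumption; lra. }
      replace (M * Rpower h (alpha + eps - gamma)) with (/ 4 * (2 * Z + 2 * Z + 2 * Z)) by (unfold M, Z; field).
      unfold T. apply Rabs_mult_le; [rewrite Rabs_pos_eq; lra|].
      repeat apply Rabs_plus_le; (apply Rabs_mult_le; [apply cg_bound|apply PC]); try lra;
        unfold Rmax; destruct Rle_dec; lra. }
    specialize (HT T HTb).
    match goal with |- context [/ 4 * fsum N ?F] =>
      replace (/ 4 * fsum N F) with (sum2 N N (fun i j => if is_origin_cell i j then 0 else
          corner_avg (fun p q => ker gamma p q * sym_diff u x y p q) (INR i * h) (INR j * h) h * w i j)) end.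
    2:{ match goal with |- _ = / 4 * fsum N (fun i => fsum N (@?F i)) =>
          change (sum2 N N (fun i j => if is_origin_cell i j then 0 else
          corner_avg (fun p q => ker gamma p q * sym_diff u x y p q) (INR i * h) (INR j * h) h * w i j) =
            / 4 * sum2 N N F) end.
        rewrite <- sum2_scal. apply sum2_ext. intros i j _ _. unfold is_origin_cell.
        destruct (andb _ _); [ring|]. unfold corner_avg.
        replace (INR i * h + h) with (INR (S i) * h) by (rewrite S_INR; ring).
        replace (INR j * h + h) with (INR (S j) * h) by (rewrite S_INR; ring).
        unfold psi, ker, sym_diff. ring. }
    set (A := sum2 N N _) in *.
    (* The far terms [4 * u x y * W] of the two operators cancel, leaving [c] times the quadrature
       error on the square. *)
    replace (c * (4 * u x y * W - J) - _) with (c * (T * w O O + A - J)) by (unfold T; ring).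
    rewrite Rabs_mult, Rmult_plus_distr_r, Rmult_assoc.
    pose proof (Rpower_pos h eps).
    assert (Rabs c * Rabs (T * w O O + A - J) <= Rabs c * (C' * Rpower h eps))
      by (apply Rmult_le_compat_l; assumption).
    lra.
Qed.
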